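(* Let $\mathcal{F}$ be a Frobenius category with the additive subcategory $\mathcal{P}$ of projective-injective objects. Then $$\big((\mathsf{K}^{+,\mathrm{b}}/\mathsf{K}^{\mathrm{b}})(\mathcal{P},\mathcal{F}),\ (\mathsf{K}^{-,\mathrm{b}}/\mathsf{K}^{\mathrm{b}})(\mathcal{P},\mathcal{F}),\ \mathsf{K}^{\infty,\emptyset}(\mathcal{P},\mathcal{F})\big)$$ is a triangle of recollements in $(\mathsf{K}^{\infty,\mathrm{b}}/\mathsf{K}^{\mathrm{b}})(\mathcal{P},\mathcal{F})$. In particular, there are triangle equivalences $$(\mathsf{K}^{+,\mathrm{b}}/\mathsf{K}^{\mathrm{b}})(\mathcal{P},\mathcal{F})\simeq(\mathsf{K}^{-,\mathrm{b}}/\mathsf{K}^{\mathrm{b}})(\mathcal{P},\mathcal{F})\simeq\mathsf{K}^{\infty,\emptyset}(\mathcal{P},\mathcal{F}).$$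
   Context: A Frobenius category is an exact category (in the sense of Quillen) with enough projectives and enough injectives in which projective and injective objects coincide. $\mathsf{K}(\mathcal{P})$ is the homotopy category of complexes over $\mathcal{P}$, with full subcategories $\mathsf{K}^{+}(\mathcal{P})$, $\mathsf{K}^{-}(\mathcal{P})$, $\mathsf{K}^{\mathrm{b}}(\mathcal{P})$ of bounded below, bounded above, bounded complexes. $\mathsf{K}^{\infty,\emptyset}(\mathcal{P},\mathcal{F})$ is the full subcategory of $\mathsf{K}(\mathcal{P})$ consisting of complexes $X$ such that for every $i\in\mathbb{Z}$ the cycle object $\mathrm{Z}^i(X)$ exists and $0\to\mathrm{Z}^i(X)\to X^i\to\mathrm{Z}^{i+1}(X)\to0$ is an exact sequence of $\mathcal{F}$. For a complex $X$, $\tau_{\ge n}X$ is the brutal truncation $\cdots\to0\to X^n\to X^{n+1}\to\cdots$ and $\tau_{\le n}X$ is $\cdots\to X^{n-1}\to X^n\to0\to\cdots$. $\mathsf{K}^{\infty,\mathrm{b}}(\mathcal{P},\mathcal{F})$ is the full subcategory of $\mathsf{K}(\mathcal{P})$ of complexes $X$ satisfying $\tau_{\le m}X=\tau_{\le m}Y$ and $\tau_{\ge n}X=\tau_{\ge n}Y'$ for some integers $m\le n$ and some $Y,Y'\in\mathsf{K}^{\infty,\emptyset}(\mathcal{P},\mathcal{F})$. $\mathsf{K}^{\pm,\mathrm{b}}(\mathcal{P},\mathcal{F})=\mathsf{K}^{\pm}(\mathcal{P})\cap\mathsf{K}^{\infty,\mathrm{b}}(\mathcal{P},\mathcal{F})$.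 For $*\in\{\infty,+,-\}$, $(\mathsf{K}^{*,\mathrm{b}}/\mathsf{K}^{\mathrm{b}})(\mathcal{P},\mathcal{F})$ is the Verdier quotient of $\mathsf{K}^{*,\mathrm{b}}(\mathcal{P},\mathcal{F})$ by $\mathsf{K}^{\mathrm{b}}(\mathcal{P})$. The categories $(\mathsf{K}^{\pm,\mathrm{b}}/\mathsf{K}^{\mathrm{b}})(\mathcal{P},\mathcal{F})$ and $\mathsf{K}^{\infty,\emptyset}(\mathcal{P},\mathcal{F})$ are regarded as full subcategories of $(\mathsf{K}^{\infty,\mathrm{b}}/\mathsf{K}^{\mathrm{b}})(\mathcal{P},\mathcal{F})$ via the canonical functors. A pair $(\mathcal{U},\mathcal{V})$ of full subcategories of a triangulated category $\mathcal{D}$ (translation $\Sigma$) is a stable t-structure in $\mathcal{D}$ if (a) $\mathcal{U}=\Sigma\mathcal{U}$, $\mathcal{V}=\Sigma\mathcal{V}$; (b) $\operatorname{Hom}_{\mathcal{D}}(\mathcal{U},\mathcal{V})=0$; (c) every $X\in\mathcal{D}$ fits in a triangle $U\to X\to V\to\Sigma U$ with $U\in\mathcal{U}$, $V\in\mathcal{V}$. A triple $(\mathcal{U},\mathcal{V},\mathcal{W})$ of triangulated full subcategories of $\mathcal{D}$ is a triangle of recollements in $\mathcal{D}$ if $(\mathcal{U},\mathcal{V})$, $(\mathcal{V},\mathcal{W})$ and $(\mathcal{W},\mathcal{U})$ are stable t-structures in $\mathcal{D}$. *)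

(* Defs.v *)
From HB Require Import structures.
From mathcomp Require Import all_boot all_order all_algebra boolp.

Set Implicit Arguments.
Unset Strict Implicit.
Unset Printing Implicit Defensive.

Import Order.TTheory GRing.Theory Num.Theory.
Local Open Scope ring_scope.
Local Open Scope quotient_scope.

Declare Scope cat_scope.
Delimit Scope cat_scope with cat.
Local Open Scope cat_scope.

Record preadditive := Preadditive {
  Ob :> Type;
  Hom : Ob -> Ob -> zmodType;
  idm : forall X, Hom X X;
  comp : forall X Y Z, Hom Y Z -> Hom X Y -> Hom X Z;
  compA : forall X Y Z T (h : Hom Z T) (g : Hom Y Z) (f : Hom X Y),
    comp h (comp g f) = comp (comp h g) f;
  comp1m : forall X Y (f : Hom X Y), comp (idm Y) f = f;
  compm1 : forall X Y (f : Hom X Y), comp f (idm X) = f;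
  compDl : forall X Y Z (g g' : Hom Y Z) (f : Hom X Y),
    comp (g + g') f = comp g f + comp g' f;
  compDr : forall X Y Z (g : Hom Y Z) (f f' : Hom X Y),
    comp g (f + f') = comp g f + comp g f' }.

Arguments Hom {p} X Y.
Arguments idm {p} X.
Arguments comp {p X Y Z} g f.

Notation "g ∘ f" := (comp g f) (at level 40, left associativity) : cat_scope.

Section PreadditiveTheory.
Variable C : preadditive.

Lemma comp0m (X Y Z : C) (f : Hom X Y) : (0 : Hom Y Z) ∘ f = 0.
Proof. by apply: (addrI (0 ∘ f)); rewrite -compDl !addr0. Qed.

Lemma compm0 (X Y Z : C) (g : Hom Y Z) : g ∘ (0 : Hom X Y) = 0.
Proof. by apply: (addrI (g ∘ 0)); rewrite -compDr !addr0. Qed.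

Lemma compNm (X Y Z : C) (g : Hom Y Z) (f : Hom X Y) : - g ∘ f = - (g ∘ f).
Proof. by apply: (addrI (g ∘ f)); rewrite -compDl !subrr comp0m. Qed.

Lemma compmN (X Y Z : C) (g : Hom Y Z) (f : Hom X Y) : g ∘ (- f) = - (g ∘ f).
Proof. by apply: (addrI (g ∘ f)); rewrite -compDr !subrr compm0. Qed.

Definition is_iso (X Y : C) (f : Hom X Y) : Prop :=
  exists g : Hom Y X, g ∘ f = idm X /\ f ∘ g = idm Y.

Definition isomorphic (X Y : C) : Prop := exists f : Hom X Y, is_iso f.

Definition is_zero (X : C) : Prop := idm X = 0.

Lemma is_iso_id (X : C) : is_iso (idm X).
Proof. by exists (idm X); rewrite comp1m. Qed.

Lemma is_iso_comp (X Y Z : C) (g : Hom Y Z) (f : Hom X Y) :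
  is_iso g -> is_iso f -> is_iso (g ∘ f).
Proof.
move=> [g' [g'g gg']] [f' [f'f ff']]; exists (f' ∘ g'); split.
  by rewrite compA -(compA f') g'g compm1.
by rewrite compA -(compA g) ff' compm1.
Qed.

End PreadditiveTheory.

Record functor (C D : preadditive) := Functor {
  fob :> C -> D;
  fmap : forall X Y, Hom X Y -> Hom (fob X) (fob Y);
  fmap1 : forall X, fmap (idm X) = idm (fob X);
  fmapM : forall X Y Z (g : Hom Y Z) (f : Hom X Y),
    fmap (g ∘ f) = fmap g ∘ fmap f;
  fmapD : forall X Y (f g : Hom X Y), fmap (f + g) = fmap f + fmap g }.

Arguments fmap {C D} f {X Y} _ : rename.

Section FunctorTheory.
Variables (C D : preadditive) (F : functor C D).

Lemma fmap0 (X Y : C) : fmap F (0 : Hom X Y) = 0.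
Proof. by apply: (addrI (fmap F 0)); rewrite -fmapD !addr0. Qed.

Lemma fmapN (X Y : C) (f : Hom X Y) : fmap F (- f) = - fmap F f.
Proof. by apply: (addrI (fmap F f)); rewrite -fmapD !subrr fmap0. Qed.

Lemma fmap_iso (X Y : C) (f : Hom X Y) : is_iso f -> is_iso (fmap F f).
Proof. by move=> [g [gf fg]]; exists (fmap F g); rewrite -!fmapM gf fg !fmap1. Qed.

End FunctorTheory.

Definition functor_id (C : preadditive) : functor C C :=
  @Functor C C id (fun _ _ f => f) (fun _ => erefl) (fun _ _ _ _ _ => erefl)
    (fun _ _ _ _ => erefl).

Section FunctorComp.
Variables (C D E : preadditive) (G : functor D E) (F : functor C D).

Lemma functor_comp1 X : fmap G (fmap F (idm X)) = idm (G (F X)).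
Proof. by rewrite !fmap1. Qed.

Lemma functor_compM X Y Z (g : Hom Y Z) (f : Hom X Y) :
  fmap G (fmap F (g ∘ f)) = fmap G (fmap F g) ∘ fmap G (fmap F f).
Proof. by rewrite !fmapM. Qed.

Lemma functor_compD X Y (f g : Hom X Y) :
  fmap G (fmap F (f + g)) = fmap G (fmap F f) + fmap G (fmap F g).
Proof. by rewrite !fmapD. Qed.

Definition functor_comp : functor C E :=
  @Functor C E (fun X => G (F X)) (fun _ _ f => fmap G (fmap F f))
    functor_comp1 functor_compM functor_compD.

End FunctorComp.

Definition natural_iso (C D : preadditive) (F G : functor C D) : Prop :=
  exists a : forall X, Hom (F X) (G X),
    (forall X, is_iso (a X)) /\
    (forall X Y (f : Hom X Y), a Y ∘ fmap F f = fmap G f ∘ a X).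

Definition is_equivalence (C D : preadditive) (F : functor C D) : Prop :=
  exists G : functor D C,
    natural_iso (functor_comp G F) (functor_id C) /\
    natural_iso (functor_comp F G) (functor_id D).

Definition fully_faithful (C D : preadditive) (F : functor C D) : Prop :=
  forall X Y : C, bijective (fun f : Hom X Y => fmap F f).

Definition ess_image (C D : preadditive) (F : functor C D) (Y : D) : Prop :=
  exists X : C, isomorphic (F X) Y.

Section FullSubcategory.
Variables (C : preadditive) (S : C -> Prop).

Definition full_sub : preadditive :=
  @Preadditive {X : C | S X} (fun X Y => Hom (sval X) (sval Y))
    (fun X => idm (sval X)) (fun _ _ _ g f => g ∘ f)
    (fun _ _ _ _ h g f => compA h g f) (fun _ _ f => comp1m f)
    (fun _ _ f => compm1 f) (fun _ _ _ g g' f => compDl g g' f)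
    (fun _ _ _ g f f' => compDr g f f').

End FullSubcategory.

Record additive := Additive {
  acat :> preadditive;
  zero : acat;
  zero_is_zero : is_zero zero;
  bip : acat -> acat -> acat;
  inl : forall X Y, Hom X (bip X Y);
  inr : forall X Y, Hom Y (bip X Y);
  prl : forall X Y, Hom (bip X Y) X;
  prr : forall X Y, Hom (bip X Y) Y;
  prl_inl : forall X Y, prl X Y ∘ inl X Y = idm X;
  prr_inr : forall X Y, prr X Y ∘ inr X Y = idm Y;
  prl_inr : forall X Y, prl X Y ∘ inr X Y = 0;
  prr_inl : forall X Y, prr X Y ∘ inl X Y = 0;
  bip_id : forall X Y, inl X Y ∘ prl X Y + inr X Y ∘ prr X Y = idm (bip X Y) }.

Arguments inl {a} X Y.
Arguments inr {a} X Y.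
Arguments prl {a} X Y.
Arguments prr {a} X Y.

Lemma bip_ext (A : additive) (Z X Y : A) (a b : Hom Z (bip X Y)) :
  prl X Y ∘ a = prl X Y ∘ b -> prr X Y ∘ a = prr X Y ∘ b -> a = b.
Proof.
move=> e1 e2; rewrite -(comp1m a) -(comp1m b) -bip_id !compDl -!compA.
by rewrite e1 e2.
Qed.

Section FullAdditive.
Variables (A : additive) (S : A -> Prop).
Hypothesis S0 : S (zero A).
Hypothesis SD : forall X Y, S X -> S Y -> S (bip X Y).

Let C := full_sub S.
Let bipS (X Y : C) : C := exist S _ (SD (proj2_sig X) (proj2_sig Y)).

Definition full_additive : additive :=
  @Additive C (exist S _ S0) (zero_is_zero A) bipS
    (fun X Y => inl (sval X) (sval Y)) (fun X Y => inr (sval X) (sval Y))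
    (fun X Y => prl (sval X) (sval Y)) (fun X Y => prr (sval X) (sval Y))
    (fun X Y => prl_inl (sval X) (sval Y)) (fun X Y => prr_inr (sval X) (sval Y))
    (fun X Y => prl_inr (sval X) (sval Y)) (fun X Y => prr_inl (sval X) (sval Y))
    (fun X Y => bip_id (sval X) (sval Y)).

End FullAdditive.

Section KernelsPushouts.
Variable C : preadditive.

Definition is_kernel (X Y Z : C) (k : Hom X Y) (g : Hom Y Z) : Prop :=
  g ∘ k = 0 /\
  forall T (h : Hom T Y), g ∘ h = 0 -> exists! h' : Hom T X, k ∘ h' = h.

Definition is_cokernel (X Y Z : C) (f : Hom X Y) (c : Hom Y Z) : Prop :=
  c ∘ f = 0 /\
  forall T (h : Hom Y T), h ∘ f = 0 -> exists! h' : Hom Z T, h' ∘ c = h.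

Definition is_pushout (X Y X' Y' : C) (f : Hom X Y) (a : Hom X X')
    (b : Hom Y Y') (f' : Hom X' Y') : Prop :=
  b ∘ f = f' ∘ a /\
  forall T (u : Hom Y T) (v : Hom X' T), u ∘ f = v ∘ a ->
    exists! w : Hom Y' T, w ∘ b = u /\ w ∘ f' = v.

Definition is_pullback (X Y X' Y' : C) (f : Hom X Y) (a : Hom X X')
    (b : Hom Y Y') (f' : Hom X' Y') : Prop :=
  b ∘ f = f' ∘ a /\
  forall T (u : Hom T Y) (v : Hom T X'), b ∘ u = f' ∘ v ->
    exists! w : Hom T X, f ∘ w = u /\ a ∘ w = v.

End KernelsPushouts.

Section Inflations.
Variables (A : preadditive)
  (conf : forall X Y Z : A, Hom X Y -> Hom Y Z -> Prop).

Definition inflation_of (X Y : A) (f : Hom X Y) : Prop :=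
  exists (Z : A) (g : Hom Y Z), conf f g.

Definition deflation_of (Y Z : A) (g : Hom Y Z) : Prop :=
  exists (X : A) (f : Hom X Y), conf f g.

End Inflations.

(* Quillen's axioms in Keller's reduced form; [conflation f g] means that
   0 -> X -> Y -> Z -> 0 is an exact sequence of the category. *)
Record exactCategory := ExactCategory {
  ecat :> additive;
  conflation : forall X Y Z : ecat, Hom X Y -> Hom Y Z -> Prop;
  conflation_ker : forall X Y Z (f : Hom X Y) (g : Hom Y Z),
    conflation f g -> is_kernel f g;
  conflation_coker : forall X Y Z (f : Hom X Y) (g : Hom Y Z),
    conflation f g -> is_cokernel f g;
  conflation_iso : forall X Y Z (f : Hom X Y) (g : Hom Y Z)
      X' Y' Z' (f' : Hom X' Y') (g' : Hom Y' Z')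
      (a : Hom X X') (b : Hom Y Y') (c : Hom Z Z'),
    is_iso a -> is_iso b -> is_iso c -> b ∘ f = f' ∘ a -> c ∘ g = g' ∘ b ->
    conflation f g -> conflation f' g';
  inflation_id : forall X, inflation_of conflation (idm X);
  deflation_id : forall X, deflation_of conflation (idm X);
  inflation_comp : forall X Y Z (g : Hom Y Z) (f : Hom X Y),
    inflation_of conflation g -> inflation_of conflation f ->
    inflation_of conflation (g ∘ f);
  deflation_comp : forall X Y Z (g : Hom Y Z) (f : Hom X Y),
    deflation_of conflation g -> deflation_of conflation f ->
    deflation_of conflation (g ∘ f);
  inflation_pushout : forall X Y X' (f : Hom X Y) (a : Hom X X'),
    inflation_of conflation f ->
    exists Y' (b : Hom Y Y') (f' : Hom X' Y'),
      is_pushout f a b f' /\ inflation_of conflation f';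
  deflation_pullback : forall Y X' Y' (b : Hom Y Y') (f' : Hom X' Y'),
    deflation_of conflation f' ->
    exists X (f : Hom X Y) (a : Hom X X'),
      is_pullback f a b f' /\ deflation_of conflation f }.

Arguments conflation {e X Y Z} f g : rename.

Section Projectives.
Variable E : exactCategory.

Definition inflation (X Y : E) (f : Hom X Y) := inflation_of (@conflation E) f.
Definition deflation (X Y : E) (f : Hom X Y) := deflation_of (@conflation E) f.

Definition projective (P : E) : Prop :=
  forall (Y Z : E) (g : Hom Y Z) (h : Hom P Z), deflation g ->
    exists h' : Hom P Y, g ∘ h' = h.

Definition injective_object (I : E) : Prop :=
  forall (X Y : E) (f : Hom X Y) (h : Hom X I), inflation f ->
    exists h' : Hom Y I, h' ∘ f = h.

Definition enough_projectives : Prop :=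
  forall X : E, exists (P : E) (g : Hom P X), projective P /\ deflation g.

Definition enough_injectives : Prop :=
  forall X : E, exists (I : E) (f : Hom X I), injective_object I /\ inflation f.

Lemma projective_zero : projective (zero E).
Proof.
move=> Y Z g h _; exists 0.
by rewrite compm0 -(compm1 h) (zero_is_zero E) compm0.
Qed.

Lemma projective_bip (P Q : E) : projective P -> projective Q -> projective (bip P Q).
Proof.
move=> pP pQ Y Z g h dg.
have [a ga] := pP Y Z g (h ∘ inl P Q) dg.
have [b gb] := pQ Y Z g (h ∘ inr P Q) dg.
exists (a ∘ prl P Q + b ∘ prr P Q).
by rewrite compDr !compA ga gb -!compA -compDr bip_id compm1.
Qed.

Definition projectives : additive :=
  full_additive projective_zero projective_bip.

End Projectives.

Record frobeniusCategory := FrobeniusCategory {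
  frob :> exactCategory;
  frob_enough_proj : enough_projectives frob;
  frob_enough_inj : enough_injectives frob;
  frob_proj_inj : forall X : frob, projective X <-> injective_object X }.

Section TriangleIso.
Variables (C : preadditive) (S : functor C C).

Definition tri_iso (X Y Z : C) (u : Hom X Y) (v : Hom Y Z) (w : Hom Z (S X))
    (X' Y' Z' : C) (u' : Hom X' Y') (v' : Hom Y' Z') (w' : Hom Z' (S X')) : Prop :=
  exists (a : Hom X X') (b : Hom Y Y') (c : Hom Z Z'),
    [/\ is_iso a, is_iso b & is_iso c] /\
    [/\ b ∘ u = u' ∘ a, c ∘ v = v' ∘ b & fmap S a ∘ w = w' ∘ c].

End TriangleIso.

(* The data of a triangulated category: the definitions below (stable
   t-structures, Verdier quotients, triangle functors) only refer to the
   translation and to the distinguished triangles, so Verdier's axioms are not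
   part of the record.  [dist_susp] is what lets [Sig] descend to quotients. *)
Record triangulation := Triangulation {
  tcat :> preadditive;
  Sig : functor tcat tcat;
  dist : forall X Y Z : tcat, Hom X Y -> Hom Y Z -> Hom Z (Sig X) -> Prop;
  dist_susp : forall X Y Z (u : Hom X Y) (v : Hom Y Z) (w : Hom Z (Sig X)),
    dist u v w -> dist (fmap Sig u) (fmap Sig v) (- fmap Sig w) }.

Arguments Sig {t}.
Arguments dist {t X Y Z} u v w.

Definition full_tri (T : triangulation) (S : T -> Prop)
    (hS : forall X, S X -> S (Sig X)) : triangulation :=
  let C := full_sub S in
  let SigS : functor C C :=
    @Functor C C (fun X => exist S (Sig (sval X)) (hS _ (proj2_sig X)))
      (fun X Y (f : Hom (sval X) (sval Y)) => fmap Sig f)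
      (fun X => fmap1 Sig (sval X)) (fun _ _ _ g f => fmapM Sig g f)
      (fun _ _ f g => fmapD Sig f g) in
  @Triangulation C SigS
    (fun X Y Z (u : Hom (sval X) (sval Y)) (v : Hom (sval Y) (sval Z))
         (w : Hom (sval Z) (Sig (sval X))) => dist u v w)
    (fun _ _ _ u v w => @dist_susp T _ _ _ u v w).

Definition full_inc (T : triangulation) (S S' : T -> Prop)
    (hS : forall X, S X -> S (Sig X)) (hS' : forall X, S' X -> S' (Sig X))
    (SS' : forall X, S X -> S' X) : functor (full_tri hS) (full_tri hS') :=
  @Functor (full_tri hS) (full_tri hS')
    (fun X => exist S' (sval X) (SS' _ (proj2_sig X))) (fun _ _ f => f)
    (fun _ => erefl) (fun _ _ _ _ _ => erefl) (fun _ _ _ _ => erefl).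

Record triFunctor (T T' : triangulation) := TriFunctor {
  trif :> functor T T';
  trif_shift : forall X, Hom (trif (Sig X)) (Sig (trif X));
  trif_shift_iso : forall X, is_iso (trif_shift X);
  trif_shift_nat : forall X Y (f : Hom X Y),
    trif_shift Y ∘ fmap trif (fmap Sig f) = fmap Sig (fmap trif f) ∘ trif_shift X;
  trif_dist : forall X Y Z (u : Hom X Y) (v : Hom Y Z) (w : Hom Z (Sig X)),
    dist u v w -> dist (fmap trif u) (fmap trif v) (trif_shift X ∘ fmap trif w) }.

Definition triangle_equivalent (T T' : triangulation) : Prop :=
  exists F : triFunctor T T', is_equivalence F.

Section Recollements.
Variable D : triangulation.
Implicit Types U V W : D -> Prop.

(* U = Sig U, where Sig U is understood up to isomorphism. *)
Definition shift_stable U : Prop :=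
  forall X, U X <-> exists Y, U Y /\ isomorphic X (Sig Y).

Definition triangulated_sub U : Prop :=
  [/\ exists2 X, is_zero X & U X,
      forall X Y, isomorphic X Y -> U X -> U Y,
      shift_stable U &
      forall X Y Z (u : Hom X Y) (v : Hom Y Z) (w : Hom Z (Sig X)),
        dist u v w -> U X -> U Y -> U Z].

Definition stable_t_structure U V : Prop :=
  [/\ shift_stable U, shift_stable V,
      forall X Y (f : Hom X Y), U X -> V Y -> f = 0 &
      forall X, exists A B (u : Hom A X) (v : Hom X B) (w : Hom B (Sig A)),
        [/\ U A, V B & dist u v w]].

Definition triangle_of_recollements U V W : Prop :=
  [/\ triangulated_sub U, triangulated_sub V & triangulated_sub W] /\
  [/\ stable_t_structure U V, stable_t_structure V W & stable_t_structure W U].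

End Recollements.

Section Verdier.
Variables (T : triangulation) (S : T -> Prop).
Hypothesis hS : forall X, S X -> S (Sig X).

Definition cone_in (X Y : T) (f : Hom X Y) : Prop :=
  exists Z (g : Hom Y Z) (h : Hom Z (Sig X)), dist f g h /\ S Z.

Lemma cone_in_susp (X Y : T) (f : Hom X Y) : cone_in f -> cone_in (fmap Sig f).
Proof.
move=> [Z [g [h [fgh SZ]]]]; exists (Sig Z), (fmap Sig g), (- fmap Sig h).
by split; [apply: dist_susp | apply: hS].
Qed.

(* The Verdier quotient T/S is the localization of T at the morphisms with cone
   in S.  It is presented by generators and relations, as the universal
   preadditive category under T in which these morphisms become invertible (see
   [verdier_lift] and [verdier_lift_unique]).  When S is a triangulated
   subcategory these morphisms admit a calculus of fractions, and every morphism
   of T/S is a roof. *)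
Inductive frac : T -> T -> Type :=
| FMor X Y of Hom X Y : frac X Y
| FInv X Y (s : Hom X Y) of cone_in s : frac Y X
| FComp X Y Z of frac Y Z & frac X Y : frac X Z
| FAdd X Y of frac X Y & frac X Y : frac X Y
| FOpp X Y of frac X Y : frac X Y.

Inductive frac_eq : forall X Y : T, frac X Y -> frac X Y -> Prop :=
| FRefl X Y (a : frac X Y) : frac_eq a a
| FSym X Y (a b : frac X Y) : frac_eq a b -> frac_eq b a
| FTrans X Y (a b c : frac X Y) : frac_eq a b -> frac_eq b c -> frac_eq a c
| FCompC X Y Z (a a' : frac Y Z) (b b' : frac X Y) :
    frac_eq a a' -> frac_eq b b' -> frac_eq (FComp a b) (FComp a' b')
| FAddC X Y (a a' b b' : frac X Y) :
    frac_eq a a' -> frac_eq b b' -> frac_eq (FAdd a b) (FAdd a' b')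
| FOppC X Y (a a' : frac X Y) : frac_eq a a' -> frac_eq (FOpp a) (FOpp a')
| FCompA X Y Z U (c : frac Z U) (b : frac Y Z) (a : frac X Y) :
    frac_eq (FComp c (FComp b a)) (FComp (FComp c b) a)
| FComp1m X Y (a : frac X Y) : frac_eq (FComp (FMor (idm Y)) a) a
| FCompm1 X Y (a : frac X Y) : frac_eq (FComp a (FMor (idm X))) a
| FCompDl X Y Z (a a' : frac Y Z) (b : frac X Y) :
    frac_eq (FComp (FAdd a a') b) (FAdd (FComp a b) (FComp a' b))
| FCompDr X Y Z (a : frac Y Z) (b b' : frac X Y) :
    frac_eq (FComp a (FAdd b b')) (FAdd (FComp a b) (FComp a b'))
| FAddA X Y (a b c : frac X Y) : frac_eq (FAdd a (FAdd b c)) (FAdd (FAdd a b) c)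
| FAddComm X Y (a b : frac X Y) : frac_eq (FAdd a b) (FAdd b a)
| FAdd0 X Y (a : frac X Y) : frac_eq (FAdd (FMor 0) a) a
| FAddN X Y (a : frac X Y) : frac_eq (FAdd (FOpp a) a) (FMor 0)
| FMorM X Y Z (g : Hom Y Z) (f : Hom X Y) :
    frac_eq (FMor (g ∘ f)) (FComp (FMor g) (FMor f))
| FMorD X Y (f g : Hom X Y) : frac_eq (FMor (f + g)) (FAdd (FMor f) (FMor g))
| FInvL X Y (s : Hom X Y) (hs : cone_in s) :
    frac_eq (FComp (FInv hs) (FMor s)) (FMor (idm X))
| FInvR X Y (s : Hom X Y) (hs : cone_in s) :
    frac_eq (FComp (FMor s) (FInv hs)) (FMor (idm Y)).

Section VHom.
Variables X Y : T.

HB.instance Definition _ := gen_eqMixin (frac X Y).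
HB.instance Definition _ := gen_choiceMixin (frac X Y).

Definition frac_eqb (a b : frac X Y) : bool := `[< frac_eq a b >].

Lemma frac_eqb_refl : reflexive frac_eqb.
Proof. by move=> a; apply/asboolP; constructor. Qed.

Lemma frac_eqb_sym : symmetric frac_eqb.
Proof. by move=> a b; apply/asboolP/asboolP => h; apply: FSym. Qed.

Lemma frac_eqb_trans : transitive frac_eqb.
Proof. by move=> b a c /asboolP ab /asboolP bc; apply/asboolP; apply: FTrans bc. Qed.

Canonical frac_equiv :=
  EquivRel frac_eqb frac_eqb_refl frac_eqb_sym frac_eqb_trans.

Definition vhom := {eq_quot frac_eqb}.
HB.instance Definition _ : EqQuotient _ frac_eqb vhom := EqQuotient.on vhom.
HB.instance Definition _ := Choice.on vhom.

Definition cls (a : frac X Y) : vhom := \pi_vhom a.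

Lemma vhomP (a b : frac X Y) : (cls a = cls b) <-> frac_eq a b.
Proof. by split=> [/eqmodP/asboolP|h]; last exact/eqmodP/asboolP. Qed.

Lemma clsW (P : vhom -> Prop) : (forall a, P (cls a)) -> forall a, P a.
Proof. by move=> Pc a; rewrite -[a]reprK; apply: Pc. Qed.

Lemma frac_repr (a : frac X Y) : frac_eq (repr (cls a)) a.
Proof. by apply/vhomP; rewrite /cls reprK. Qed.

Definition vadd (a b : vhom) : vhom := cls (FAdd (repr a) (repr b)).
Definition vopp (a : vhom) : vhom := cls (FOpp (repr a)).
Definition vzero : vhom := cls (FMor 0).

Lemma vaddE a b : vadd (cls a) (cls b) = cls (FAdd a b).
Proof. by apply/vhomP; apply: FAddC; apply: frac_repr. Qed.

Lemma voppE a : vopp (cls a) = cls (FOpp a).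
Proof. by apply/vhomP; apply: FOppC; apply: frac_repr. Qed.

Lemma vaddA : associative vadd.
Proof. by elim/clsW=> a; elim/clsW=> b; elim/clsW=> c; rewrite (vaddE b c) (vaddE a b) !vaddE; apply/vhomP; constructor. Qed.

Lemma vaddC : commutative vadd.
Proof. by elim/clsW=> a; elim/clsW=> b; rewrite !vaddE; apply/vhomP; constructor. Qed.

Lemma vadd0 : left_id vzero vadd.
Proof. by elim/clsW=> a; rewrite vaddE; apply/vhomP; constructor. Qed.

Lemma vaddN : left_inverse vzero vopp vadd.
Proof. by elim/clsW=> a; rewrite (voppE a) vaddE; apply/vhomP; constructor. Qed.

HB.instance Definition _ := GRing.isZmodule.Build vhom vaddA vaddC vadd0 vaddN.

Lemma cls_add a b : (cls a + cls b : vhom) = cls (FAdd a b).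
Proof. exact: vaddE. Qed.

End VHom.

Definition vcomp X Y Z (a : vhom Y Z) (b : vhom X Y) : vhom X Z :=
  cls (FComp (repr a) (repr b)).

Lemma vcompE X Y Z (a : frac Y Z) (b : frac X Y) :
  vcomp (cls a) (cls b) = cls (FComp a b).
Proof. by apply/vhomP; apply: FCompC; apply: frac_repr. Qed.

Lemma vcompA X Y Z U (c : vhom Z U) (b : vhom Y Z) (a : vhom X Y) :
  vcomp c (vcomp b a) = vcomp (vcomp c b) a.
Proof.
by elim/clsW: a => a; elim/clsW: b => b; elim/clsW: c => c;
  rewrite (vcompE b a) (vcompE c b) !vcompE; apply/vhomP; constructor.
Qed.

Lemma vcomp1m X Y (a : vhom X Y) : vcomp (cls (FMor (idm Y))) a = a.
Proof. by elim/clsW: a => a; rewrite vcompE; apply/vhomP; constructor. Qed.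

Lemma vcompm1 X Y (a : vhom X Y) : vcomp a (cls (FMor (idm X))) = a.
Proof. by elim/clsW: a => a; rewrite vcompE; apply/vhomP; constructor. Qed.

Lemma vcompDl X Y Z (a a' : vhom Y Z) (b : vhom X Y) :
  vcomp (a + a') b = vcomp a b + vcomp a' b.
Proof.
by elim/clsW: a => a; elim/clsW: a' => a'; elim/clsW: b => b;
  rewrite (cls_add a a') (vcompE a b) (vcompE a' b) cls_add vcompE;
  apply/vhomP; constructor.
Qed.

Lemma vcompDr X Y Z (a : vhom Y Z) (b b' : vhom X Y) :
  vcomp a (b + b') = vcomp a b + vcomp a b'.
Proof.
by elim/clsW: a => a; elim/clsW: b => b; elim/clsW: b' => b';
  rewrite (cls_add b b') (vcompE a b) (vcompE a b') cls_add vcompE;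
  apply/vhomP; constructor.
Qed.

Definition verdier_cat : preadditive :=
  @Preadditive T (fun X Y => vhom X Y : zmodType) (fun X => cls (FMor (idm X)))
    vcomp vcompA vcomp1m vcompm1 vcompDl vcompDr.

Lemma cls1 (X : T) : cls (FMor (idm X)) = @idm verdier_cat X.
Proof. by []. Qed.

Lemma clsM X Y Z (g : Hom Y Z) (f : Hom X Y) :
  (cls (FMor (g ∘ f)) : vhom X Z) = vcomp (cls (FMor g)) (cls (FMor f)).
Proof. by rewrite vcompE; apply/vhomP; constructor. Qed.

Lemma clsD X Y (f g : Hom X Y) :
  (cls (FMor (f + g)) : vhom X Y) = cls (FMor f) + cls (FMor g).
Proof. by rewrite cls_add; apply/vhomP; constructor. Qed.

Definition vquot : functor T verdier_cat :=
  @Functor T verdier_cat (fun X => X) (fun X Y (f : Hom X Y) => cls (FMor f) : vhom X Y)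
    cls1 clsM clsD.

Fixpoint frac_susp X Y (a : frac X Y) : frac (Sig X) (Sig Y) :=
  match a with
  | FMor _ _ f => FMor (fmap Sig f)
  | FInv _ _ _ hs => FInv (cone_in_susp hs)
  | FComp _ _ _ a b => FComp (frac_susp a) (frac_susp b)
  | FAdd _ _ a b => FAdd (frac_susp a) (frac_susp b)
  | FOpp _ _ a => FOpp (frac_susp a)
  end.

Lemma frac_susp_eq X Y (a b : frac X Y) :
  frac_eq a b -> frac_eq (frac_susp a) (frac_susp b).
Proof.
induction 1 => /=; rewrite ?(fmap1, fmap0, fmapM, fmapD);
  by [apply: FSym | apply: FTrans; eassumption | constructor].
Qed.

Definition vsusp X Y (a : vhom X Y) : vhom (Sig X) (Sig Y) := cls (frac_susp (repr a)).

Lemma vsuspE X Y (a : frac X Y) : vsusp (cls a) = cls (frac_susp a).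
Proof. by apply/vhomP/frac_susp_eq/frac_repr. Qed.

Lemma vsusp1 X : vsusp (cls (FMor (idm X))) = cls (FMor (idm (Sig X))).
Proof. by rewrite vsuspE /= fmap1. Qed.

Lemma vsuspM X Y Z (a : vhom Y Z) (b : vhom X Y) :
  vsusp (vcomp a b) = vcomp (vsusp a) (vsusp b).
Proof.
by elim/clsW: a => a; elim/clsW: b => b; rewrite (vcompE a b) (vsuspE a) (vsuspE b) vcompE vsuspE.
Qed.

Lemma vsuspD X Y (a b : vhom X Y) : vsusp (a + b) = vsusp a + vsusp b.
Proof.
by elim/clsW: a => a; elim/clsW: b => b; rewrite (cls_add a b) (vsuspE a) (vsuspE b) cls_add vsuspE.
Qed.

Definition vSig : functor verdier_cat verdier_cat :=
  @Functor verdier_cat verdier_cat (fun X : T => Sig X) vsusp vsusp1 vsuspM vsuspD.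

Lemma vSig_quot X Y (f : Hom X Y) :
  fmap vSig (fmap vquot f) = fmap vquot (fmap Sig f).
Proof. exact: vsuspE. Qed.

Definition vdist (X Y Z : verdier_cat) (u : Hom X Y) (v : Hom Y Z)
    (w : Hom Z (vSig X)) : Prop :=
  exists (X' Y' Z' : T) (u' : Hom X' Y') (v' : Hom Y' Z') (w' : Hom Z' (Sig X')),
    dist u' v' w' /\
    @tri_iso verdier_cat vSig X Y Z u v w X' Y' Z'
      (fmap vquot u') (fmap vquot v') (fmap vquot w').

Lemma vdist_susp (X Y Z : verdier_cat) (u : Hom X Y) (v : Hom Y Z)
    (w : Hom Z (vSig X)) :
  vdist u v w -> vdist (fmap vSig u) (fmap vSig v) (- fmap vSig w).
Proof.
move=> [X' [Y' [Z' [u' [v' [w' [uvw [a [b [c [[ia ib ic] [e1 e2 e3]]]]]]]]]]]].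
exists (Sig X'), (Sig Y'), (Sig Z'), (fmap Sig u'), (fmap Sig v'), (- fmap Sig w').
split; first exact: dist_susp.
exists (fmap vSig a), (fmap vSig b), (fmap vSig c); split.
  by split; apply: fmap_iso.
split; rewrite ?fmapN -?vSig_quot -?fmapM ?e1 ?e2 //.
by rewrite compmN compNm -!fmapM -e3.
Qed.

Definition verdier : triangulation := @Triangulation verdier_cat vSig vdist vdist_susp.

Lemma vquot_iso (X Y : T) (s : Hom X Y) : cone_in s -> is_iso (fmap vquot s).
Proof.
move=> hs; exists (cls (FInv hs) : @Hom verdier_cat Y X).
by split; [rewrite -(cls1 X)|rewrite -(cls1 Y)]; rewrite [LHS]vcompE; apply/vhomP; constructor.
Qed.

Section Lift.
Variables (C : preadditive) (G : functor T C).
Hypothesis GS : forall (X Y : T) (s : Hom X Y), cone_in s -> is_iso (fmap G s).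

Fixpoint frac_eval X Y (a : frac X Y) : Hom (G X) (G Y) :=
  match a with
  | FMor _ _ f => fmap G f
  | FInv _ _ _ hs => sval (cid (GS hs))
  | FComp _ _ _ a b => frac_eval a ∘ frac_eval b
  | FAdd _ _ a b => frac_eval a + frac_eval b
  | FOpp _ _ a => - frac_eval a
  end.

Lemma frac_eval_eq X Y (a b : frac X Y) : frac_eq a b -> frac_eval a = frac_eval b.
Proof.
induction 1 => /=; rewrite ?(fmap1, fmap0, fmapM, fmapD); try congruence.
- by rewrite compA.
- by rewrite comp1m.
- by rewrite compm1.
- by rewrite compDl.
- by rewrite compDr.
- by rewrite addrA.
- by rewrite addrC.
- by rewrite add0r.
- by rewrite addNr.
- by case: cid => t [].
- by case: cid => t [].
Qed.

Definition vlift X Y (a : vhom X Y) : Hom (G X) (G Y) := frac_eval (repr a).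

Lemma vliftE X Y (a : frac X Y) : vlift (cls a) = frac_eval a.
Proof. exact/frac_eval_eq/frac_repr. Qed.

Lemma vlift1 (X : verdier_cat) : vlift (idm X) = idm (G X).
Proof. by rewrite vliftE /= fmap1. Qed.

Lemma vliftM (X Y Z : verdier_cat) (a : Hom Y Z) (b : Hom X Y) :
  vlift (a ∘ b) = vlift a ∘ vlift b.
Proof.
elim/clsW: a => a; elim/clsW: b => b.
by rewrite [a in vlift a](vcompE a b) !vliftE.
Qed.

Lemma vliftD (X Y : verdier_cat) (a b : Hom X Y) : vlift (a + b) = vlift a + vlift b.
Proof.
elim/clsW: a => a; elim/clsW: b => b.
by rewrite [a in vlift a](cls_add a b) !vliftE.
Qed.

Definition verdier_lift : functor verdier_cat C :=
  @Functor verdier_cat C (fun X => G X) vlift vlift1 vliftM vliftD.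

Lemma verdier_lift_quot X Y (f : Hom X Y) :
  fmap verdier_lift (fmap vquot f) = fmap G f.
Proof. exact: vliftE. Qed.

(* Uniqueness, for functors with the prescribed action on objects. *)
Lemma verdier_lift_unique (L : forall X Y : T, vhom X Y -> Hom (G X) (G Y)) :
    (forall X Y Z (a : vhom Y Z) (b : vhom X Y), L _ _ (vcomp a b) = L _ _ a ∘ L _ _ b) ->
    (forall X Y (a b : vhom X Y), L _ _ (a + b) = L _ _ a + L _ _ b) ->
    (forall X Y (f : Hom X Y), L _ _ (cls (FMor f)) = fmap G f) ->
  forall X Y (a : vhom X Y), L _ _ a = vlift a.
Proof.
move=> LM LD LG X Y; elim/clsW=> a; rewrite vliftE.
elim: a => {X Y} /=.
- by move=> X Y f; apply: LG.
- move=> X Y s hs; case: cid => t [ts st] /=.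
  rewrite -[LHS]comp1m -ts -compA -LG -LM vcompE.
  have /vhomP -> := FInvR hs.
  by rewrite LG fmap1 compm1.
- by move=> X Y Z a IHa b IHb; rewrite -vcompE LM IHa IHb.
- by move=> X Y a IHa b IHb; rewrite -cls_add LD IHa IHb.
- move=> X Y a IHa; apply: (addIr (L _ _ (cls a))).
  rewrite -LD cls_add; have /vhomP -> := FAddN a.
  by rewrite LG fmap0 IHa addNr.
Qed.

End Lift.

End Verdier.

Record complex (A : preadditive) := Complex {
  cob :> int -> A;
  dif : forall i, Hom (cob i) (cob (i + 1));
  dif_dif : forall i, dif (i + 1) ∘ dif i = 0 }.

Arguments dif {A} c i.

Record cmap (A : preadditive) (X Y : complex A) := CMap {
  cmap_fun :> forall i, Hom (X i) (Y i);
  cmap_dif : forall i, cmap_fun (i + 1) ∘ dif X i = dif Y i ∘ cmap_fun i }.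

Lemma cmap_ext (A : preadditive) (X Y : complex A) (f g : cmap X Y) :
  (forall i, f i = g i) -> f = g.
Proof.
case: f g => [f cf] [g cg] /= fg.
have {}fg : f = g by apply: functional_extensionality_dep.
by case: g / fg cg => cg; congr CMap; apply: Prop_irrelevance.
Qed.

Section ComplexCategory.
Variable A : preadditive.

Section CMapZmod.
Variables X Y : complex A.
Implicit Types f g h : cmap X Y.

HB.instance Definition _ := gen_eqMixin (cmap X Y).
HB.instance Definition _ := gen_choiceMixin (cmap X Y).

Lemma cmap0_dif i : (0 : Hom (X (i + 1)) (Y (i + 1))) ∘ dif X i = dif Y i ∘ 0.
Proof. by rewrite comp0m compm0. Qed.

Lemma cmapD_dif f g i :
  (f (i + 1) + g (i + 1)) ∘ dif X i = dif Y i ∘ (f i + g i).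
Proof. by rewrite compDl compDr !cmap_dif. Qed.

Lemma cmapN_dif f i : - f (i + 1) ∘ dif X i = dif Y i ∘ (- f i).
Proof. by rewrite compNm compmN cmap_dif. Qed.

Definition cmap0 : cmap X Y := CMap cmap0_dif.
Definition cmapD f g : cmap X Y := CMap (cmapD_dif f g).
Definition cmapN f : cmap X Y := CMap (cmapN_dif f).

Lemma cmapDA : associative cmapD.
Proof. by move=> f g h; apply: cmap_ext => i /=; rewrite addrA. Qed.

Lemma cmapDC : commutative cmapD.
Proof. by move=> f g; apply: cmap_ext => i /=; rewrite addrC. Qed.

Lemma cmap0D : left_id cmap0 cmapD.
Proof. by move=> f; apply: cmap_ext => i /=; rewrite add0r. Qed.

Lemma cmapND : left_inverse cmap0 cmapN cmapD.
Proof. by move=> f; apply: cmap_ext => i /=; rewrite addNr. Qed.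

HB.instance Definition _ :=
  GRing.isZmodule.Build (cmap X Y) cmapDA cmapDC cmap0D cmapND.

Lemma cmap_addE f g i : (f + g) i = f i + g i.
Proof. by []. Qed.

Lemma cmap_oppE f i : (- f) i = - f i.
Proof. by []. Qed.

(* The homotopy s has components s i : X^(i+1) -> Y^i, so that all differences
   of degree are of the form i, i + 1. *)
Definition null_homotopic f : Prop :=
  exists s : forall i, Hom (X (i + 1)) (Y i),
    forall i, f (i + 1) = dif Y i ∘ s i + s (i + 1) ∘ dif X (i + 1).

Definition null_pred : {pred cmap X Y} := [pred f | `[< null_homotopic f >]].

Lemma null_predP f : reflect (null_homotopic f) (f \in null_pred).
Proof. exact: asboolP. Qed.

Lemma null_pred_closed : zmod_closed null_pred.
Proof.
split=> [|f g /null_predP [s fs] /null_predP [t gt]]; apply/null_predP.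
  by exists (fun=> 0) => i; rewrite compm0 comp0m addr0.
exists (fun i => s i - t i) => i; rewrite /= fs gt.
by rewrite compDl compDr compNm compmN opprD addrACA.
Qed.

HB.instance Definition _ := GRing.isZmodClosed.Build _ null_pred null_pred_closed.

Definition khom := {ideal_quot null_pred}.
HB.instance Definition _ := GRing.Zmodule.on khom.

Definition kcls f : khom := \pi_khom f.

Lemma kclsP f g : kcls f = kcls g <-> null_homotopic (f - g).
Proof.
rewrite /kcls; split=> [/eqP|h]; first by rewrite -Quotient.idealrBE => /null_predP.
by apply/eqP; rewrite -Quotient.idealrBE; apply/null_predP.
Qed.

Lemma kclsW (P : khom -> Prop) : (forall f, P (kcls f)) -> forall a, P a.
Proof. by move=> Pc a; rewrite -[a]reprK; apply: Pc. Qed.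

Lemma kclsD f g : kcls (f + g) = kcls f + kcls g.
Proof. by rewrite /kcls raddfD. Qed.

Lemma kclsN f : kcls (- f) = - kcls f.
Proof. by rewrite /kcls raddfN. Qed.

Lemma krepr f : null_homotopic (repr (kcls f) - f).
Proof. by apply/kclsP; rewrite /kcls reprK. Qed.

End CMapZmod.

Lemma cmap_id_dif (X : complex A) i : idm (X (i + 1)) ∘ dif X i = dif X i ∘ idm (X i).
Proof. by rewrite comp1m compm1. Qed.

Definition cmap_id (X : complex A) : cmap X X := CMap (@cmap_id_dif X).

Lemma cmap_comp_dif (X Y Z : complex A) (g : cmap Y Z) (f : cmap X Y) i :
  (g (i + 1) ∘ f (i + 1)) ∘ dif X i = dif Z i ∘ (g i ∘ f i).
Proof. by rewrite -compA cmap_dif !compA cmap_dif. Qed.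

Definition cmap_comp (X Y Z : complex A) (g : cmap Y Z) (f : cmap X Y) : cmap X Z :=
  CMap (cmap_comp_dif g f).

Lemma null_comp (X Y Z : complex A) (g g' : cmap Y Z) (f f' : cmap X Y) :
  null_homotopic (g - g') -> null_homotopic (f - f') ->
  null_homotopic (cmap_comp g f - cmap_comp g' f').
Proof.
move=> [t gt] [s fs].
exists (fun i => t i ∘ f (i + 1) + g' i ∘ s i) => i /=.
have eg : g (i + 1) = g' (i + 1) + (dif Z i ∘ t i + t (i + 1) ∘ dif Y (i + 1)).
  by rewrite -gt cmap_addE cmap_oppE addrCA subrr addr0.
have ef : f (i + 1) = f' (i + 1) + (dif Y i ∘ s i + s (i + 1) ∘ dif X (i + 1)).
  by rewrite -fs cmap_addE cmap_oppE addrCA subrr addr0.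
have -> : g (i + 1) ∘ f (i + 1) - g' (i + 1) ∘ f' (i + 1) =
    (g (i + 1) - g' (i + 1)) ∘ f (i + 1) + g' (i + 1) ∘ (f (i + 1) - f' (i + 1)).
  by rewrite compDl compDr compNm compmN addrA subrK.
rewrite eg ef [_ + _ - g' _]addrC addKr [_ + _ - f' _]addrC addKr -ef.
rewrite !compDl !compDr -!compA !cmap_dif !compA !cmap_dif -!compA.
by rewrite addrACA.
Qed.

Definition kcomp (X Y Z : complex A) (b : khom Y Z) (a : khom X Y) : khom X Z :=
  kcls (cmap_comp (repr b) (repr a)).

Lemma kcompE (X Y Z : complex A) (g : cmap Y Z) (f : cmap X Y) :
  kcomp (kcls g) (kcls f) = kcls (cmap_comp g f).
Proof. by apply/kclsP/null_comp; apply: krepr. Qed.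

Lemma kcompA (X Y Z U : complex A) (c : khom Z U) (b : khom Y Z) (a : khom X Y) :
  kcomp c (kcomp b a) = kcomp (kcomp c b) a.
Proof.
elim/kclsW: a => a; elim/kclsW: b => b; elim/kclsW: c => c.
rewrite (kcompE b a) (kcompE c b) !kcompE; congr kcls.
by apply: cmap_ext => i /=; rewrite compA.
Qed.

Lemma kcomp1m (X Y : complex A) (a : khom X Y) : kcomp (kcls (cmap_id Y)) a = a.
Proof.
elim/kclsW: a => a; rewrite kcompE; congr kcls.
by apply: cmap_ext => i /=; rewrite comp1m.
Qed.

Lemma kcompm1 (X Y : complex A) (a : khom X Y) : kcomp a (kcls (cmap_id X)) = a.
Proof.
elim/kclsW: a => a; rewrite kcompE; congr kcls.
by apply: cmap_ext => i /=; rewrite compm1.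
Qed.

Lemma kcompDl (X Y Z : complex A) (b b' : khom Y Z) (a : khom X Y) :
  kcomp (b + b') a = kcomp b a + kcomp b' a.
Proof.
elim/kclsW: a => a; elim/kclsW: b => b; elim/kclsW: b' => b'.
rewrite -(kclsD b b') (kcompE b a) (kcompE b' a) kcompE -kclsD; congr kcls.
by apply: cmap_ext => i /=; rewrite compDl.
Qed.

Lemma kcompDr (X Y Z : complex A) (b : khom Y Z) (a a' : khom X Y) :
  kcomp b (a + a') = kcomp b a + kcomp b a'.
Proof.
elim/kclsW: a => a; elim/kclsW: b => b; elim/kclsW: a' => a'.
rewrite -(kclsD a a') (kcompE b a) (kcompE b a') kcompE -kclsD; congr kcls.
by apply: cmap_ext => i /=; rewrite compDr.
Qed.

Definition homotopy_cat : preadditive :=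
  @Preadditive (complex A) (fun X Y => khom X Y : zmodType)
    (fun X => kcls (cmap_id X)) kcomp kcompA kcomp1m kcompm1 kcompDl kcompDr.

Lemma shift_dif_dif (X : complex A) i : - dif X (i + 1 + 1) ∘ - dif X (i + 1) = 0.
Proof. by rewrite compNm compmN dif_dif !oppr0. Qed.

Definition shift (X : complex A) : complex A := Complex (@shift_dif_dif X).

Lemma cmap_shift_dif (X Y : complex A) (f : cmap X Y) i :
  f (i + 1 + 1) ∘ dif (shift X) i = dif (shift Y) i ∘ f (i + 1).
Proof. by rewrite /= compmN compNm cmap_dif. Qed.

Definition cmap_shift (X Y : complex A) (f : cmap X Y) : cmap (shift X) (shift Y) :=
  @CMap A (shift X) (shift Y) (fun i => f (i + 1)) (cmap_shift_dif f).

Lemma null_shift (X Y : complex A) (f g : cmap X Y) :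
  null_homotopic (f - g) -> null_homotopic (cmap_shift f - cmap_shift g).
Proof.
move=> [s fs]; exists (fun i => - s (i + 1)) => i.
move: (fs (i + 1)); rewrite !cmap_addE !cmap_oppE => /= ->.
by rewrite !(compNm, compmN) !opprK.
Qed.

Definition kshift (X Y : complex A) (a : khom X Y) : khom (shift X) (shift Y) :=
  kcls (cmap_shift (repr a)).

Lemma kshiftE (X Y : complex A) (f : cmap X Y) :
  kshift (kcls f) = kcls (cmap_shift f).
Proof. by apply/kclsP/null_shift/krepr. Qed.

Lemma kshift1 (X : homotopy_cat) : kshift (idm X) = kcls (cmap_id (shift X)).
Proof. by rewrite kshiftE; congr kcls; apply: cmap_ext. Qed.

Lemma kshiftM (X Y Z : complex A) (b : khom Y Z) (a : khom X Y) :
  kshift (kcomp b a) = kcomp (kshift b) (kshift a).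
Proof.
elim/kclsW: a => a; elim/kclsW: b => b.
by rewrite (kcompE b a) (kshiftE a) (kshiftE b) kcompE kshiftE; congr kcls; apply: cmap_ext.
Qed.

Lemma kshiftD (X Y : complex A) (a b : khom X Y) :
  kshift (a + b) = kshift a + kshift b.
Proof.
elim/kclsW: a => a; elim/kclsW: b => b.
by rewrite -(kclsD a b) (kshiftE a) (kshiftE b) kshiftE -kclsD; congr kcls; apply: cmap_ext.
Qed.

Definition kSig : functor homotopy_cat homotopy_cat :=
  @Functor homotopy_cat homotopy_cat shift kshift kshift1 kshiftM kshiftD.

End ComplexCategory.

Section MappingCone.
Variable A : additive.

Section Cone.
Variables (X Y : complex A) (f : cmap X Y).

Definition cone_ob (i : int) : A := bip (X (i + 1)) (Y i).

(* The matrix (-d, 0; f, d). *)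
Definition cone_dif i : Hom (cone_ob i) (cone_ob (i + 1)) :=
  inl _ _ ∘ - dif X (i + 1) ∘ prl _ _ +
  (inr _ _ ∘ f (i + 1) ∘ prl _ _ + inr _ _ ∘ dif Y i ∘ prr _ _).

Lemma prl_cone_dif i : prl _ _ ∘ cone_dif i = - dif X (i + 1) ∘ prl _ _.
Proof.
by rewrite /cone_dif !compDr !compA prl_inl prl_inr !comp0m !addr0 comp1m.
Qed.

Lemma prr_cone_dif i :
  prr _ _ ∘ cone_dif i = f (i + 1) ∘ prl _ _ + dif Y i ∘ prr _ _.
Proof.
by rewrite /cone_dif !compDr !compA prr_inl prr_inr !comp0m !add0r !comp1m.
Qed.

Lemma cone_dif_dif i : cone_dif (i + 1) ∘ cone_dif i = 0.
Proof.
apply: bip_ext; rewrite compA compm0 ?prl_cone_dif ?prr_cone_dif.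
  by rewrite -compA prl_cone_dif compA compNm compmN dif_dif !oppr0 comp0m.
rewrite compDl -!compA prl_cone_dif prr_cone_dif compDr !compA dif_dif comp0m addr0.
by rewrite compmN compNm cmap_dif addNr.
Qed.

Definition cone : complex A := Complex cone_dif_dif.

Lemma cone_in_dif i :
  inr (X (i + 1 + 1)) (Y (i + 1)) ∘ dif Y i = dif cone i ∘ inr (X (i + 1)) (Y i).
Proof.
rewrite /= /cone_dif !compDl -!compA prl_inr prr_inr.
by rewrite !(compm0, compm1, add0r).
Qed.

Definition cone_inr : cmap Y cone := @CMap _ Y cone (fun i => inr _ _) cone_in_dif.

Lemma cone_pr_dif i :
  prl (X (i + 1 + 1)) (Y (i + 1)) ∘ dif cone i = dif (shift X) i ∘ prl (X (i + 1)) (Y i).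
Proof.
rewrite /= /cone_dif !compDr !compA prl_inl prl_inr.
by rewrite !(comp0m, comp1m, addr0).
Qed.

Definition cone_prl : cmap cone (shift X) :=
  @CMap _ cone (shift X) (fun i => prl _ _) cone_pr_dif.

End Cone.

Definition kdist (X Y Z : homotopy_cat A) (u : Hom X Y) (v : Hom Y Z)
    (w : Hom Z (kSig A X)) : Prop :=
  exists (X' Y' : complex A) (f : cmap X' Y'),
    @tri_iso (homotopy_cat A) (kSig A) X Y Z u v w X' Y' (cone f)
      (kcls f) (kcls (cone_inr f)) (kcls (cone_prl f)).

Section ConeShift.
Variables (X Y : complex A) (f : cmap X Y).

(* The isomorphism between shift (cone f) and cone (shift f) changes the sign of
   the first component. *)
Definition cone_sgn (U V : A) : Hom (bip U V) (bip U V) :=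
  - (inl _ _ ∘ prl _ _) + inr _ _ ∘ prr _ _.

Lemma prl_cone_sgn U V : prl U V ∘ cone_sgn U V = - prl U V.
Proof. by rewrite compDr compmN !compA prl_inl prl_inr comp0m comp1m addr0. Qed.

Lemma prr_cone_sgn U V : prr U V ∘ cone_sgn U V = prr U V.
Proof. by rewrite compDr compmN !compA prr_inl prr_inr comp0m comp1m oppr0 add0r. Qed.

Lemma cone_sgn_inr U V : cone_sgn U V ∘ inr U V = inr U V.
Proof.
apply: bip_ext; rewrite compA ?prl_cone_sgn ?prr_cone_sgn //.
by rewrite compNm prl_inr oppr0.
Qed.

Lemma cone_sgnK U V : cone_sgn U V ∘ cone_sgn U V = idm _.
Proof.
apply: bip_ext; rewrite compA compm1 ?prl_cone_sgn ?prr_cone_sgn //.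
by rewrite compNm prl_cone_sgn opprK.
Qed.

Lemma cone_shift_dif i :
  cone_sgn _ _ ∘ dif (shift (cone f)) i = dif (cone (cmap_shift f)) i ∘ cone_sgn _ _.
Proof.
apply: bip_ext; rewrite !compA.
  rewrite prl_cone_sgn [in RHS]prl_cone_dif -[RHS]compA prl_cone_sgn /=.
  by rewrite !(compNm, compmN) !opprK prl_cone_dif compNm.
rewrite prr_cone_sgn [in RHS]prr_cone_dif compDl -[in RHS]compA prl_cone_sgn.
rewrite -[in RHS]compA prr_cone_sgn /= !(compNm, compmN) prr_cone_dif.
by rewrite opprD.
Qed.

Definition cone_shift : cmap (shift (cone f)) (cone (cmap_shift f)) :=
  @CMap _ (shift (cone f)) (cone (cmap_shift f))
    (fun i => cone_sgn (X (i + 1 + 1)) (Y (i + 1))) cone_shift_dif.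

Lemma cone_shift_dif' i :
  cone_sgn _ _ ∘ dif (cone (cmap_shift f)) i = dif (shift (cone f)) i ∘ cone_sgn _ _.
Proof.
have := congr1 (fun z => cone_sgn _ _ ∘ z ∘ cone_sgn _ _) (cone_shift_dif i).
by rewrite compA cone_sgnK comp1m -!compA cone_sgnK compm1 => ->.
Qed.

Definition cone_shift' : cmap (cone (cmap_shift f)) (shift (cone f)) :=
  @CMap _ (cone (cmap_shift f)) (shift (cone f))
    (fun i => cone_sgn (X (i + 1 + 1)) (Y (i + 1))) cone_shift_dif'.

Lemma cone_shift_iso : @is_iso (homotopy_cat A) _ _ (kcls cone_shift).
Proof.
exists (kcls cone_shift'); rewrite /= !kcompE.
by split; congr kcls; apply: cmap_ext => i; apply: cone_sgnK.
Qed.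

End ConeShift.

Lemma kdist_susp (X Y Z : homotopy_cat A) (u : Hom X Y) (v : Hom Y Z)
    (w : Hom Z (kSig A X)) :
  kdist u v w -> kdist (fmap (kSig A) u) (fmap (kSig A) v) (- fmap (kSig A) w).
Proof.
move=> [X' [Y' [f [a [b [c [[ia ib ic] [e1 e2 e3]]]]]]]].
exists (shift X'), (shift Y'), (cmap_shift f).
exists (fmap (kSig A) a), (fmap (kSig A) b).
exists ((kcls (cone_shift f) : @Hom (homotopy_cat A) _ _) ∘ fmap (kSig A) c).
split; first split; try exact: fmap_iso.
  by apply: is_iso_comp; [apply: cone_shift_iso | apply: fmap_iso].
split.
- by rewrite -fmapM e1 fmapM /= kshiftE.
- rewrite -compA -fmapM e2 fmapM compA; congr (_ ∘ _).
  rewrite /= kshiftE kcompE; congr kcls.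
  by apply: cmap_ext => i; apply: cone_sgn_inr.
- rewrite compmN -fmapM e3 fmapM compA -compNm; congr (_ ∘ _).
  rewrite /= kshiftE kcompE -kclsN; congr kcls.
  by apply: cmap_ext => i /=; rewrite prl_cone_sgn.
Qed.

Definition homotopyCategory : triangulation :=
  @Triangulation (homotopy_cat A) (kSig A) kdist kdist_susp.

End MappingCone.

Lemma complex_ext (A : preadditive) (o : int -> A)
    (d d' : forall i, Hom (o i) (o (i + 1)))
    (dd : forall i, d (i + 1) ∘ d i = 0) (dd' : forall i, d' (i + 1) ∘ d' i = 0) :
  (forall i, d i = d' i) -> Complex dd = Complex dd'.
Proof.
move=> e; have {}e : d = d' by apply: functional_extensionality_dep.
by case: d' / e dd' => dd'; congr Complex; apply: Prop_irrelevance.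
Qed.

Definition bounded_below (A : preadditive) (X : complex A) : Prop :=
  exists n, forall i, i < n -> is_zero (X i).

Definition bounded_above (A : preadditive) (X : complex A) : Prop :=
  exists n, forall i, n < i -> is_zero (X i).

Definition bounded (A : preadditive) (X : complex A) : Prop :=
  bounded_below X /\ bounded_above X.

Section BrutalTruncation.
Variable A : additive.

Section Trunc.
Variables (p : pred int) (X : complex A).

Definition trunc_ob (i : int) : A := if p i then X i else zero A.

Definition trunc_dif (i : int) : Hom (trunc_ob i) (trunc_ob (i + 1)) :=
  match p i as b, p (i + 1) as c
  return Hom (if b then X i else zero A) (if c then X (i + 1) else zero A) with
  | true, true => dif X i
  | _, _ => 0
  end.

Lemma trunc_dif_dif i : trunc_dif (i + 1) ∘ trunc_dif i = 0.
Proof.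
rewrite /trunc_dif /trunc_ob.
case: (p i); case: (p (i + 1)); case: (p (i + 1 + 1));
  by rewrite ?(compm0, comp0m, dif_dif).
Qed.

Definition trunc : complex A := Complex trunc_dif_dif.

End Trunc.

Definition trunc_le (m : int) (X : complex A) : complex A := trunc (fun i => i <= m) X.
Definition trunc_ge (n : int) (X : complex A) : complex A := trunc (fun i => n <= i) X.

Lemma shift_trunc p (X : complex A) :
  trunc (fun i => p (i + 1)) (shift X) = shift (trunc p X).
Proof.
apply: (@complex_ext A (fun i => trunc_ob p X (i + 1))) => i.
rewrite /= /trunc_dif /trunc_ob /=.
by case: (p (i + 1)); case: (p (i + 1 + 1)); rewrite ?oppr0.
Qed.

Lemma shift_trunc_le m (X : complex A) : trunc_le (m - 1) (shift X) = shift (trunc_le m X).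
Proof.
rewrite -shift_trunc /trunc_le; congr trunc.
by apply: functional_extensionality_dep => i; rewrite lerBrDr.
Qed.

Lemma shift_trunc_ge n (X : complex A) : trunc_ge (n - 1) (shift X) = shift (trunc_ge n X).
Proof.
rewrite -shift_trunc /trunc_ge; congr trunc.
by apply: functional_extensionality_dep => i; rewrite lerBlDr.
Qed.

End BrutalTruncation.

Section Subcategories.
Variable F : frobeniusCategory.
Local Notation P := (projectives F).
Local Notation K := (homotopyCategory P).
Implicit Types X Y : complex P.

Definition acyclic X : Prop :=
  exists (Z : int -> F) (k : forall i, Hom (Z i) (sval (X i)))
         (p : forall i, Hom (sval (X i)) (Z (i + 1))),
    let d i : @Hom F (sval (X i)) (sval (X (i + 1))) := dif X i in
    forall i, [/\ is_kernel (k i) (d i), k (i + 1) ∘ p i = d i &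
                  conflation (k i) (p i)].

Definition infty_b X : Prop :=
  exists m n : int, m <= n /\ exists Y Y' : complex P,
    [/\ acyclic Y, acyclic Y', trunc_le m X = trunc_le m Y &
        trunc_ge n X = trunc_ge n Y'].

Definition plus_b X : Prop := bounded_below X /\ infty_b X.
Definition minus_b X : Prop := bounded_above X /\ infty_b X.

Lemma bounded_below_shift X : bounded_below X -> bounded_below (shift X).
Proof. by move=> [n Xn]; exists (n - 1) => i; rewrite ltrBrDr => /Xn. Qed.

Lemma bounded_above_shift X : bounded_above X -> bounded_above (shift X).
Proof. by move=> [n Xn]; exists (n - 1) => i; rewrite ltrBlDr => /Xn. Qed.

Lemma bounded_shift X : bounded X -> bounded (shift X).
Proof. by move=> [b a]; split; [apply: bounded_below_shift | apply: bounded_above_shift]. Qed.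

Lemma acyclic_shift X : acyclic X -> acyclic (shift X).
Proof.
move=> [Z [k [p h]]].
exists (fun i => Z (i + 1)), (fun i => k (i + 1)), (fun i => - p (i + 1)) => d i; rewrite {}/d.
have [[dk ku] kp c] := h (i + 1); split.
- split; first by rewrite [LHS]compNm dk oppr0.
  move=> T t; rewrite [X in X = _]compNm => /eqP; rewrite oppr_eq0 => /eqP.
  exact: ku.
- by rewrite compmN kp.
- apply: (conflation_iso (a := idm _) (b := idm _) (c := - idm _) _ _ _ _ _ c);
    try exact: is_iso_id.
  + by exists (- idm _); rewrite compNm compmN opprK comp1m.
  + by rewrite comp1m compm1.
  + by rewrite compNm comp1m compm1.
Qed.

Lemma infty_b_shift X : infty_b X -> infty_b (shift X).
Proof.
move=> [m [n [mn [Y [Y' [aY aY' e e']]]]]]; exists (m - 1), (n - 1).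
split; first by rewrite lerD2r.
exists (shift Y), (shift Y'); split; try exact: acyclic_shift.
  by rewrite !shift_trunc_le e.
by rewrite !shift_trunc_ge e'.
Qed.

Lemma plus_b_shift X : plus_b X -> plus_b (shift X).
Proof. by move=> [b i]; split; [apply: bounded_below_shift | apply: infty_b_shift]. Qed.

Lemma minus_b_shift X : minus_b X -> minus_b (shift X).
Proof. by move=> [b i]; split; [apply: bounded_above_shift | apply: infty_b_shift]. Qed.

Lemma plus_infty_b X : plus_b X -> infty_b X.
Proof. by case. Qed.

Lemma minus_infty_b X : minus_b X -> infty_b X.
Proof. by case. Qed.

Lemma acyclic_infty_b X : acyclic X -> infty_b X.
Proof. by move=> aX; exists 0, 0; split=> //; exists X, X. Qed.

Definition K_infty_empty : triangulation := @full_tri K acyclic acyclic_shift.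
Definition K_infty_b : triangulation := @full_tri K infty_b infty_b_shift.

Section ModKb.
Variables (S : K -> Prop) (hS : forall X, S X -> S (shift X)).

Definition Kb (X : @full_tri K S hS) : Prop := bounded (sval X).

Lemma Kb_Sig (X : @full_tri K S hS) : Kb X -> Kb (Sig X).
Proof. exact: bounded_shift. Qed.

Definition modKb : triangulation := verdier Kb_Sig.

End ModKb.

Definition K_infty_b_mod_Kb : triangulation := modKb infty_b_shift.
Definition K_plus_b_mod_Kb : triangulation := modKb plus_b_shift.
Definition K_minus_b_mod_Kb : triangulation := modKb minus_b_shift.

Section Canonical.
Variables (S : K -> Prop) (hS : forall X, S X -> S (shift X)).
Hypothesis SS' : forall X, S X -> infty_b X.

Definition quot_inc : functor (@full_tri K S hS) K_infty_b_mod_Kb :=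
  functor_comp (vquot (@Kb _ infty_b_shift)) (@full_inc K S infty_b hS infty_b_shift SS').

Lemma quot_inc_iso (X Y : @full_tri K S hS) (s : Hom X Y) :
  cone_in (@Kb S hS) s -> is_iso (fmap quot_inc s).
Proof.
move=> [[Z SZ] [g [h [d bZ]]]]; apply: vquot_iso.
by exists (exist _ Z (SS' SZ)), g, h.
Qed.

Definition mod_inc : functor (modKb hS) K_infty_b_mod_Kb := verdier_lift quot_inc_iso.

End Canonical.

Definition plus_functor : functor K_plus_b_mod_Kb K_infty_b_mod_Kb :=
  mod_inc plus_b_shift plus_infty_b.
Definition minus_functor : functor K_minus_b_mod_Kb K_infty_b_mod_Kb :=
  mod_inc minus_b_shift minus_infty_b.
Definition acyclic_functor : functor K_infty_empty K_infty_b_mod_Kb :=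
  quot_inc acyclic_shift acyclic_infty_b.

End Subcategories.

(* Main.v *)
(* Let A be an acyclic complex of projective-injectives. Every map from A to a
   bounded below complex, and every map from a bounded above complex to A, is null
   homotopic. Hence Hom(A, -) and Hom(-, A) invert the maps with bounded cone, so
   that Hom(A, X) and Hom(X, A) are the same in K^{oo,b} and in its quotient; no
   calculus of fractions is needed.

   A complex X of K^{oo,b} agrees far to the left with some acyclic A. As the terms
   of X are injective and A is exact, the identity extends from there to a map
   A -> X, whose cone is bounded below: this is the triangle for (K^{oo,0}, K^{+,b}).
   Dually, far to the right one finds X -> A with bounded above cone, and the brutal
   truncations X^{>=0} -> X -> X^{<=0} give the third t-structure. In the quotient
   the three subcategories become: the right and the left orthogonal of the acyclic
   complexes, and the objects X with a map A -> X inducing bijections on all maps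
   from and to acyclic complexes. These descriptions are visibly stable under cones.

   Brutal truncation is not a functor on K(P), but the error terms are bounded. So
   X -> X^{<=0} and X -> X^{>=0} are triangle functors from K^{oo,b} to K^{-,b}/K^b and
   K^{+,b}/K^b. They invert the maps that acyclic complexes see as isomorphisms, hence
   descend to the quotient, and restrict on K^{oo,0} to the triangle equivalences. *)
From HB Require Import structures.
From mathcomp Require Import all_boot all_order all_algebra boolp zify.

Set Implicit Arguments.
Unset Strict Implicit.
Unset Printing Implicit Defensive.

Import Order.TTheory GRing.Theory Num.Theory.
Require Import Defs.
Local Open Scope ring_scope.
Local Open Scope quotient_scope.
Local Open Scope cat_scope.

(** * Equations in abelian groups *)

(** The record [triangulation] carries no axioms, and the morphisms of a Verdier quotient are words
    in generators, so little can be read off the quotient directly. Exactness arguments therefore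
    take place in K(P), where the needed consequences of the axioms are proved from mapping cones.
    The quotient is reached by lifting functors and natural transformations out of it, and by a
    Yoneda argument for objects that see every map with bounded cone as an isomorphism. A second
    obstacle is that K^{oo,b} is defined by equality of truncated complexes, so it is not visibly
    closed under isomorphism in K(P). Third terms of triangles are thus replaced by explicit
    complexes: cones of maps already in K^{oo,b}, or cones cut down by elimination to the degrees
    where a map may fail to be invertible. That K^{oo,b} contains the cones of its maps relies on
    the exact structure of F, since the cycles of a cone live in F and not in P; they are pullbacks
    along deflations. *)

(* [ring] does not apply to zmodTypes, and rewriting with [addrC] would also match
   the degrees. *)
Inductive zexp := ZVar of nat | ZAdd of zexp & zexp | ZOpp of zexp | ZZero.

Fixpoint zeval (V : zmodType) (env : seq V) (e : zexp) : V :=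
  match e with
  | ZVar k => nth 0 env k
  | ZAdd a b => zeval env a + zeval env b
  | ZOpp a => - zeval env a
  | ZZero => 0
  end.

Fixpoint zcoef (e : zexp) (i : nat) : int :=
  match e with
  | ZVar k => (i == k)%:Z
  | ZAdd a b => zcoef a i + zcoef b i
  | ZOpp a => - zcoef a i
  | ZZero => 0
  end.

(** An expression acts through its vector of integer coefficients, as in the free abelian group on
    the atoms; equality becomes a finite boolean check. *)
Lemma zevalE (V : zmodType) (env : seq V) e :
  zeval env e = \sum_(i < size env) nth 0 env i *~ zcoef e i.
Proof.
elim: e => [k|a IHa b IHb|a IHa|] /=.
- have [lk|lk] := ltnP k (size env).
    rewrite (bigD1 (Ordinal lk)) //= eqxx mulr1z big1 ?addr0 // => i /eqP ne.
    by have [e|] := eqVneq; [case: ne; apply: val_inj | rewrite mulr0z].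
  rewrite nth_default // big1 // => i _; rewrite (_ : _ == _ = false) ?mulr0z //.
  by apply/eqP => e; move: (ltn_ord i); rewrite e ltnNge lk.
- by rewrite IHa IHb -big_split; apply: eq_bigr => i _; rewrite mulrzDr.
- by rewrite IHa -sumrN; apply: eq_bigr => i _; rewrite mulrNz.
- by rewrite big1.
Qed.

Lemma zexp_eq (V : zmodType) (env : seq V) n (a b : zexp) : size env = n ->
  all (fun i => zcoef a i == zcoef b i) (iota 0 n) -> zeval env a = zeval env b.
Proof.
move=> <- /allP h; rewrite !zevalE; apply: eq_bigr => i _.
by rewrite (eqP (h i _)) // mem_iota add0n ltn_ord.
Qed.

(* Atoms are compared up to conversion: canonical instances of the same
   structure on a degree may be inferred along different paths. *)
Ltac zindex x l :=
  lazymatch l with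
  | ?y :: ?l' =>
    match goal with
    | _ => let _ := match goal with _ => unify x y end in constr:(Some 0%N)
    | _ => let k := zindex x l' in
           lazymatch k with Some ?k => constr:(Some (S k)) | None => constr:(@None nat) end
    end
  | _ => constr:(@None nat)
  end.

Ltac zatoms e l :=
  lazymatch e with
  | ?a + ?b => let l := zatoms a l in zatoms b l
  | - ?a => zatoms a l
  | 0 => l
  | ?x => let m := zindex x l in
          lazymatch m with None => constr:(x :: l) | _ => l end
  end.

Ltac zreify e l :=
  lazymatch e with
  | ?a + ?b => let a := zreify a l in let b := zreify b l in constr:(ZAdd a b)
  | - ?a => let a := zreify a l in constr:(ZOpp a)
  | 0 => constr:(ZZero)
  | ?x => let k := zindex x l in lazymatch k with Some ?k => constr:(ZVar k) end
  end.

Ltac zlen l :=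
  lazymatch l with
  | nil => constr:(0%N)
  | _ :: ?l' => let k := zlen l' in constr:(S k)
  end.

Ltac zmod :=
  lazymatch goal with
  | |- @eq ?T ?a ?b =>
    let l := zatoms a (@nil T) in
    let l := zatoms b l in
    let ea := zreify a l in
    let eb := zreify b l in
    let n := zlen l in
    refine (@zexp_eq _ l n ea eb erefl _); vm_compute; reflexivity
  end.

(** Uses a known equation linearly: what remains is an identity between differences, which [zmod]
    decides. *)
Lemma zmod_from (V : zmodType) (a b c d : V) : c = d -> a - b = c - d -> a = b.
Proof. by move=> ->; rewrite subrr => /eqP; rewrite subr_eq0 => /eqP. Qed.

(** * Functors, triangle functors and localization *)

Lemma inj_surj_bijective (S T : Type) (f : S -> T) :
  injective f -> (forall y, exists x, f x = y) -> bijective f.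
Proof.
move=> fi fs; exists (fun y => sval (cid (fs y))) => [x|y]; last by case: cid.
by apply: fi; case: cid.
Qed.

(** * Opposite categories and Hom functors *)

Section Opposite.
Variable C : preadditive.

(** Makes contravariant Hom functors covariant, and lets [ff_unit] and [resolved_iso] be
    dualized. *)
Definition op : preadditive :=
  @Preadditive C (fun X Y => @Hom C Y X) (fun X => idm X)
    (fun _ _ _ g f => f ∘ g) (fun _ _ _ _ h g f => esym (compA f g h))
    (fun _ _ f => compm1 f) (fun _ _ f => comp1m f)
    (fun _ _ _ g g' f => compDr f g g') (fun _ _ _ g f f' => compDl f f' g).

Lemma is_iso_op (X Y : C) (f : Hom X Y) : @is_iso op Y X f <-> is_iso f.
Proof. by split=> -[g [fg gf]]; exists g. Qed.

End Opposite.

Definition op_functor (C D : preadditive) (F : functor C D) : functor (op C) (op D) :=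
  @Functor (op C) (op D) (fun X => F X) (fun X Y (f : @Hom C Y X) => fmap F f)
    (fun X => fmap1 F X) (fun _ _ _ g f => fmapM F f g) (fun _ _ f g => fmapD F f g).

Record addmap (U V : zmodType) := AddMap {
  addmap_fun :> U -> V;
  addmapD : forall x y, addmap_fun (x + y) = addmap_fun x + addmap_fun y }.

Section AddMap.
Variables U V : zmodType.
Implicit Types f g h : addmap U V.

Lemma addmap_ext f g : f =1 g -> f = g.
Proof.
case: f g => [f fD] [g gD] /= fg; have {}fg : f = g by apply: funext.
by case: g / fg gD => gD; congr AddMap; apply: Prop_irrelevance.
Qed.

HB.instance Definition _ := gen_eqMixin (addmap U V).
HB.instance Definition _ := gen_choiceMixin (addmap U V).

Lemma addmap0_subproof (x y : U) : 0 = 0 + 0 :> V. Proof. by rewrite addr0. Qed.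
Lemma addmapD_subproof f g x y : f (x + y) + g (x + y) = (f x + g x) + (f y + g y).
Proof. by rewrite !addmapD addrACA. Qed.
Lemma addmapN_subproof f x y : - f (x + y) = - f x + - f y.
Proof. by rewrite addmapD opprD. Qed.

Definition addmap_zero := AddMap addmap0_subproof.
Definition addmap_add f g := AddMap (addmapD_subproof f g).
Definition addmap_opp f := AddMap (addmapN_subproof f).

Lemma addmap_addA : associative addmap_add.
Proof. by move=> f g h; apply: addmap_ext => x /=; rewrite addrA. Qed.
Lemma addmap_addC : commutative addmap_add.
Proof. by move=> f g; apply: addmap_ext => x /=; rewrite addrC. Qed.
Lemma addmap_add0 : left_id addmap_zero addmap_add.
Proof. by move=> f; apply: addmap_ext => x /=; rewrite add0r. Qed.
Lemma addmap_addN : left_inverse addmap_zero addmap_opp addmap_add.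
Proof. by move=> f; apply: addmap_ext => x /=; rewrite addNr. Qed.

HB.instance Definition _ :=
  GRing.isZmodule.Build (addmap U V) addmap_addA addmap_addC addmap_add0 addmap_addN.

End AddMap.

Lemma addmap_id_subproof (U : zmodType) (x y : U) : id (x + y) = id x + id y.
Proof. by []. Qed.
Definition addmap_id (U : zmodType) : addmap U U := AddMap (@addmap_id_subproof U).

Lemma addmap_comp_subproof (U V W : zmodType) (g : addmap V W) (f : addmap U V) x y :
  g (f (x + y)) = g (f x) + g (f y).
Proof. by rewrite !addmapD. Qed.
Definition addmap_comp (U V W : zmodType) (g : addmap V W) (f : addmap U V) : addmap U W :=
  AddMap (addmap_comp_subproof g f).

(* Universes forbid a preadditive category of all zmodTypes, hence the index type. *)
Definition Ab (I : Type) (M : I -> zmodType) : preadditive.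
Proof.
refine (@Preadditive I (fun i j => addmap (M i) (M j) : zmodType)
  (fun i => addmap_id (M i)) (fun _ _ _ g f => addmap_comp g f) _ _ _ _ _) => *;
  apply: addmap_ext => x //=.
by rewrite addmapD.
Defined.

Section HomFunctors.
Variables (C D : preadditive) (X : C) (X' : D).

(** The Hom functor of a category and that of its quotient must land in one category before a
    natural transformation can compare them; hence the index by a sum. *)
Definition homs_from (i : C + D) : zmodType :=
  match i with Datatypes.inl Y => Hom X Y | Datatypes.inr Y => Hom X' Y end.

Definition homs_to (i : C + D) : zmodType :=
  match i with Datatypes.inl Y => Hom Y X | Datatypes.inr Y => Hom Y X' end.

Definition hom_from_l : functor C (Ab homs_from).
Proof.
refine (@Functor C (Ab homs_from) Datatypes.inl
  (fun Y Z (f : Hom Y Z) => @AddMap (Hom X Y) (Hom X Z) (fun h => f ∘ h) (compDr f)) _ _ _).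
- by move=> Y; apply: addmap_ext => h /=; rewrite comp1m.
- by move=> Y Z T g f; apply: addmap_ext => h /=; rewrite compA.
- by move=> Y Z f g; apply: addmap_ext => h /=; rewrite compDl.
Defined.

Definition hom_from_r : functor D (Ab homs_from).
Proof.
refine (@Functor D (Ab homs_from) Datatypes.inr
  (fun Y Z (f : Hom Y Z) => @AddMap (Hom X' Y) (Hom X' Z) (fun h => f ∘ h) (compDr f)) _ _ _).
- by move=> Y; apply: addmap_ext => h /=; rewrite comp1m.
- by move=> Y Z T g f; apply: addmap_ext => h /=; rewrite compA.
- by move=> Y Z f g; apply: addmap_ext => h /=; rewrite compDl.
Defined.

Definition hom_to_l : functor C (op (Ab homs_to)).
Proof.
refine (@Functor C (op (Ab homs_to)) Datatypes.inl
  (fun Y Z (f : Hom Y Z) =>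
     @AddMap (Hom Z X) (Hom Y X) (fun h => h ∘ f) (fun h h' => compDl h h' f)) _ _ _).
- by move=> Y; apply: addmap_ext => h /=; rewrite compm1.
- by move=> Y Z T g f; apply: addmap_ext => h /=; rewrite compA.
- by move=> Y Z f g; apply: addmap_ext => h /=; rewrite compDr.
Defined.

Definition hom_to_r : functor D (op (Ab homs_to)).
Proof.
refine (@Functor D (op (Ab homs_to)) Datatypes.inr
  (fun Y Z (f : Hom Y Z) =>
     @AddMap (Hom Z X') (Hom Y X') (fun h => h ∘ f) (fun h h' => compDl h h' f)) _ _ _).
- by move=> Y; apply: addmap_ext => h /=; rewrite compm1.
- by move=> Y Z T g f; apply: addmap_ext => h /=; rewrite compA.
- by move=> Y Z f g; apply: addmap_ext => h /=; rewrite compDr.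
Defined.

End HomFunctors.

Section HomBijections.
Variable C : preadditive.

Definition post_bij (A X Y : C) (s : Hom X Y) : Prop :=
  (forall x : Hom A X, s ∘ x = 0 -> x = 0) /\
  (forall y : Hom A Y, exists x : Hom A X, s ∘ x = y).

Definition pre_bij (A X Y : C) (s : Hom X Y) : Prop :=
  (forall y : Hom Y A, y ∘ s = 0 -> y = 0) /\
  (forall x : Hom X A, exists y : Hom Y A, y ∘ s = x).

Lemma post_bij_iso (D : preadditive) (A' : D) (A X Y : C) (s : Hom X Y) :
  post_bij A s -> is_iso (fmap (hom_from_l A A') s).
Proof.
move=> [inj surj].
pose t (y : Hom A Y) : Hom A X := sval (cid (surj y)).
have st y : s ∘ t y = y by rewrite /t; case: cid.
have tU x y : s ∘ x = y -> x = t y.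
  by move=> e; apply/eqP; rewrite -subr_eq0; apply/eqP/inj; rewrite compDr compmN e st subrr.
have tD y y' : t (y + y') = t y + t y' by apply/esym/tU; rewrite compDr !st.
exists (@AddMap (Hom A Y) (Hom A X) t tD).
by split; apply: addmap_ext => x //=; apply/esym/tU.
Qed.

Lemma pre_bij_iso (D : preadditive) (A' : D) (A X Y : C) (s : Hom X Y) :
  pre_bij A s -> is_iso (fmap (hom_to_l A A') s).
Proof.
move=> [inj surj].
pose t (x : Hom X A) : Hom Y A := sval (cid (surj x)).
have st y : t y ∘ s = y by rewrite /t; case: cid.
have tU x y : x ∘ s = y -> x = t y.
  by move=> e; apply/eqP; rewrite -subr_eq0; apply/eqP/inj; rewrite compDl compNm e st subrr.
have tD y y' : t (y + y') = t y + t y' by apply/esym/tU; rewrite compDl !st.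
exists (@AddMap (Hom X A) (Hom Y A) t tD).
by split; apply: addmap_ext => x //=; apply/esym/tU.
Qed.

End HomBijections.

(** * Fully faithful functors and their quasi-inverses *)

Section FullyFaithful.

Lemma fully_faithfulP (C D : preadditive) (F : functor C D) :
  (forall X Y (f : Hom X Y), fmap F f = 0 -> f = 0) ->
  (forall X Y (g : Hom (F X) (F Y)), exists f, fmap F f = g) -> fully_faithful F.
Proof.
move=> inj surj X Y; apply: inj_surj_bijective => [f g /= e|g].
  by apply/eqP; rewrite -subr_eq0; apply/eqP/inj; rewrite fmapD fmapN e subrr.
by have [f <-] := surj _ _ g; exists f.
Qed.

Lemma ff_inj (C D : preadditive) (F : functor C D) (X Y : C) (f g : Hom X Y) :
  fully_faithful F -> fmap F f = fmap F g -> f = g.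
Proof. by move=> ffF /(bij_inj (ffF X Y)). Qed.

Lemma ff_surj (C D : preadditive) (F : functor C D) (X Y : C) (g : Hom (F X) (F Y)) :
  fully_faithful F -> exists f, fmap F f = g.
Proof. by move=> ffF; have [h _ hK] := ffF X Y; exists (h g); rewrite hK. Qed.

Lemma ff_iso (C D : preadditive) (F : functor C D) (X Y : C) (f : Hom X Y) :
  fully_faithful F -> is_iso (fmap F f) -> is_iso f.
Proof.
move=> ffF [g [gf fg]]; have [h hg] := ff_surj g ffF; exists h.
by split; apply: (ff_inj ffF); rewrite fmapM hg fmap1.
Qed.

Lemma ff_op (C D : preadditive) (F : functor C D) :
  fully_faithful (op_functor F) -> fully_faithful F.
Proof. by move=> ffF X Y; apply: (ffF Y X). Qed.

(** Faithful because [n] identifies [L I] with the identity. Full because naturality of [e] at a map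
    between objects of the image, where [e] is [fmap I n], recovers that map from its image under
    [I L]. *)
Lemma ff_unit (A D : preadditive) (I : functor A D) (L : functor D A)
    (n : forall X : A, Hom X (L (I X))) (e : forall Y : D, Hom Y (I (L Y))) :
  (forall X, is_iso (n X)) ->
  (forall X Y (f : Hom X Y), n Y ∘ f = fmap L (fmap I f) ∘ n X) ->
  (forall X Y (f : Hom X Y), e Y ∘ f = fmap I (fmap L f) ∘ e X) ->
  (forall X, e (I X) = fmap I (n X)) ->
  fully_faithful I.
Proof.
move=> n_iso n_nat e_nat en; apply: fully_faithfulP => X Y f.
  move=> If0; have [m [mn _]] := n_iso Y.
  by rewrite -(comp1m f) -mn -compA n_nat If0 fmap0 comp0m compm0.
have [m [mn nm]] := n_iso Y.
exists (m ∘ fmap L f ∘ n X).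
rewrite !fmapM -compA -en -e_nat en compA -fmapM mn fmap1 comp1m //.
Qed.

End FullyFaithful.

Section EquivalenceInverse.
Variables (C D : preadditive) (F : functor C D).
Hypotheses (ffF : fully_faithful F) (esF : forall Y, ess_image F Y).

Let G0 (Y : D) : C := sval (cid (esF Y)).
Let c (Y : D) : Hom (F (G0 Y)) Y := sval (cid (svalP (cid (esF Y)))).
Let c_iso Y : is_iso (c Y) := svalP (cid (svalP (cid (esF Y)))).
Let c' (Y : D) : Hom Y (F (G0 Y)) := sval (cid (c_iso Y)).
Let c'c Y : c' Y ∘ c Y = idm _ := proj1 (svalP (cid (c_iso Y))).
Let cc' Y : c Y ∘ c' Y = idm _ := proj2 (svalP (cid (c_iso Y))).
Let G1 (X Y : D) (f : Hom X Y) : Hom (G0 X) (G0 Y) :=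
  sval (cid (ff_surj (c' Y ∘ f ∘ c X) ffF)).
Let FG1 X Y (f : Hom X Y) : fmap F (G1 f) = c' Y ∘ f ∘ c X :=
  svalP (cid (ff_surj (c' Y ∘ f ∘ c X) ffF)).

Definition ff_inverse : functor D C.
Proof.
refine (@Functor D C G0 G1 _ _ _).
- by move=> X; apply: (ff_inj ffF); rewrite FG1 compm1 c'c fmap1.
- move=> X Y Z g f; apply: (ff_inj ffF); rewrite fmapM !FG1.
  by rewrite !compA -(compA (_ ∘ g) (c Y)) cc' compm1.
- by move=> X Y f g; apply: (ff_inj ffF); rewrite fmapD !FG1 compDr compDl.
Defined.

Definition ff_counit (Y : D) : Hom (F (ff_inverse Y)) Y := c Y.

Lemma ff_counit_iso Y : is_iso (ff_counit Y). Proof. exact: c_iso. Qed.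

Lemma ff_counit_nat (X Y : D) (f : Hom X Y) :
  ff_counit Y ∘ fmap F (fmap ff_inverse f) = f ∘ ff_counit X.
Proof. by rewrite [fmap ff_inverse f]/= FG1 !compA cc' comp1m. Qed.

Lemma ff_unit_ex (X : C) : exists u : Hom (ff_inverse (F X)) X,
  is_iso u /\ fmap F u = ff_counit (F X).
Proof.
have [u uE] := ff_surj (ff_counit (F X)) ffF; exists u; split=> //.
by apply: (ff_iso ffF); rewrite uE; apply: ff_counit_iso.
Qed.

Lemma ff_inverse_equivalence : is_equivalence ff_inverse.
Proof.
exists F; split; first by exists ff_counit; split;
  [exact: ff_counit_iso | move=> X Y f; rewrite ff_counit_nat].
exists (fun X => sval (cid (ff_unit_ex X))); split=> [X|X Y f].
  by case: cid => u [].
case: cid => v [/= _ vE]; case: cid => u [/= _ uE].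
by apply: (ff_inj ffF); rewrite !fmapM uE vE ff_counit_nat.
Qed.

Lemma ff_equivalence : is_equivalence F.
Proof.
have [F' [a b]] := ff_inverse_equivalence; exists ff_inverse; split.
  exists (fun X => sval (cid (ff_unit_ex X))); split=> [X|X Y f].
    by case: cid => u [].
  case: cid => v [/= _ vE]; case: cid => u [/= _ uE].
  by apply: (ff_inj ffF); rewrite !fmapM uE vE ff_counit_nat.
by exists ff_counit; split; [exact: ff_counit_iso | move=> X Y f; rewrite ff_counit_nat].
Qed.

End EquivalenceInverse.

(** * Isomorphisms of triangles and inverses of triangle functors *)

Section TriIso.
Variables (C : preadditive) (S : functor C C).

Lemma is_iso_inv (D : preadditive) (X Y : D) (f : Hom X Y) (g : Hom Y X) :
  g ∘ f = idm X -> f ∘ g = idm Y -> is_iso g.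
Proof. by exists f. Qed.

Lemma tri_iso_refl (X Y Z : C) (u : Hom X Y) (v : Hom Y Z) (w : Hom Z (S X)) :
  tri_iso u v w u v w.
Proof.
exists (idm X), (idm Y), (idm Z); split; first by split; apply: is_iso_id.
by rewrite fmap1 !comp1m !compm1.
Qed.

Lemma tri_iso_trans (X Y Z : C) (u : Hom X Y) (v : Hom Y Z) (w : Hom Z (S X))
    (X' Y' Z' : C) (u' : Hom X' Y') (v' : Hom Y' Z') (w' : Hom Z' (S X'))
    (X'' Y'' Z'' : C) (u'' : Hom X'' Y'') (v'' : Hom Y'' Z'') (w'' : Hom Z'' (S X'')) :
  tri_iso u v w u' v' w' -> tri_iso u' v' w' u'' v'' w'' -> tri_iso u v w u'' v'' w''.
Proof.
move=> [a [b [c [[ia ib ic] [e1 e2 e3]]]]] [a' [b' [c' [[ia' ib' ic'] [e1' e2' e3']]]]].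
exists (a' ∘ a), (b' ∘ b), (c' ∘ c); split; first by split; apply: is_iso_comp.
split.
- by rewrite -compA e1 compA e1' compA.
- by rewrite -compA e2 compA e2' compA.
- by rewrite fmapM -compA e3 compA e3' compA.
Qed.

Lemma tri_iso_sym (X Y Z : C) (u : Hom X Y) (v : Hom Y Z) (w : Hom Z (S X))
    (X' Y' Z' : C) (u' : Hom X' Y') (v' : Hom Y' Z') (w' : Hom Z' (S X')) :
  tri_iso u v w u' v' w' -> tri_iso u' v' w' u v w.
Proof.
move=> [a [b [c [[ia ib ic] [e1 e2 e3]]]]].
have [a' [a'a aa']] := ia; have [b' [b'b bb']] := ib; have [c' [c'c cc']] := ic.
exists a', b', c'; split; first by split; [exists a|exists b|exists c].
split.
- by rewrite -[u']compm1 -aa' (compA u') -e1 !compA b'b comp1m.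
- by rewrite -[v']compm1 -bb' (compA v') -e2 !compA c'c comp1m.
- by rewrite -[w']compm1 -cc' (compA w') -e3 !compA -fmapM a'a fmap1 comp1m.
Qed.

End TriIso.

(** Not a field of the axiom-free record; it allows a triangle to be recognised from an isomorphic
    distinguished one. *)
Definition iso_closed (T : triangulation) : Prop :=
  forall (X Y Z X' Y' Z' : T) (u : Hom X Y) (v : Hom Y Z) (w : Hom Z (Sig X))
    (u' : Hom X' Y') (v' : Hom Y' Z') (w' : Hom Z' (Sig X')),
  tri_iso u v w u' v' w' -> dist u' v' w' -> dist u v w.

Section TriFunctorTheory.
Variables T T' T'' : triangulation.

Definition triFunctor_comp (G : triFunctor T' T'') (F : triFunctor T T') :
  triFunctor T T''.
Proof.
refine (@TriFunctor T T'' (functor_comp G F)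
  (fun X => trif_shift G (F X) ∘ fmap G (trif_shift F X)) _ _ _).
- by move=> X; apply: is_iso_comp; [|apply: fmap_iso]; apply: trif_shift_iso.
- move=> X Y f /=; rewrite -compA -fmapM trif_shift_nat fmapM !compA.
  by rewrite trif_shift_nat.
- by move=> X Y Z u v w /(trif_dist F)/(trif_dist G) /=; rewrite fmapM compA.
Defined.

Lemma triangle_equivalent_trans :
  triangle_equivalent T T' -> triangle_equivalent T' T'' -> triangle_equivalent T T''.
Proof.
move=> [F [F' [[a [ai an]] [b [bi bn]]]]] [G [G' [[c [ci cn]] [d [di dn]]]]].
exists (triFunctor_comp G F), (functor_comp F' G'); split.
  exists (fun X => a X ∘ fmap F' (c (F X))); split=> [X|X Y f].
    by apply: is_iso_comp; [apply: ai | apply: (fmap_iso F'); apply: ci].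
  by rewrite /= compA -(an _ _ f) -!compA -!fmapM; rewrite /= -(cn _ _ (fmap F f)).
exists (fun X => d X ∘ fmap G (b (G' X))); split=> [X|X Y f].
  by apply: is_iso_comp; [apply: di | apply: (fmap_iso G); apply: bi].
by rewrite /= compA -(dn _ _ f) -!compA -!fmapM; rewrite /= -(bn _ _ (fmap G' f)).
Qed.

End TriFunctorTheory.

Section TriangleInverse.
Variables (T T' : triangulation) (F : triFunctor T T').
Hypotheses (ffF : fully_faithful F) (esF : forall Y, ess_image F Y).
Hypothesis T_iso : iso_closed T.
(** Verdier's axioms would give this by completing a lift of [u] to a triangle and applying the five
    lemma. Here it is supplied by hand, in [TmW_dist] and [TpW_dist]. *)
Hypothesis F_dist : forall (X Y Z : T') (u : Hom X Y) (v : Hom Y Z) (w : Hom Z (Sig X)),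
  dist u v w -> exists (X' Y' Z' : T) (u' : Hom X' Y') (v' : Hom Y' Z') (w' : Hom Z' (Sig X')),
    dist u' v' w' /\
    tri_iso u v w (fmap F u') (fmap F v') (trif_shift F X' ∘ fmap F w').

Local Notation G := (ff_inverse ffF esF).
Local Notation c := (ff_counit ffF esF).

(** Compatibility with the counit forces the shift isomorphism of the inverse: solve the equation
    for [fmap F s], then descend by full faithfulness. *)
Lemma inverse_shift_ex (Y : T') : exists s : Hom (G (Sig Y)) (Sig (G Y)),
  fmap Sig (c Y) ∘ (trif_shift F (G Y) ∘ fmap F s) = c (Sig Y).
Proof.
have [p [pc cp]] : is_iso (fmap Sig (c Y)) by apply/fmap_iso/ff_counit_iso.
have [q [qs sq]] := trif_shift_iso F (G Y).
have [s sE] := ff_surj (q ∘ p ∘ c (Sig Y)) ffF.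
by exists s; rewrite sE !compA -(compA _ _ q) sq compm1 cp comp1m.
Qed.

Definition inverse_shift Y := sval (cid (inverse_shift_ex Y)).

Lemma inverse_shiftE Y :
  fmap Sig (c Y) ∘ (trif_shift F (G Y) ∘ fmap F (inverse_shift Y)) = c (Sig Y).
Proof. by rewrite /inverse_shift; case: cid. Qed.

Lemma inverse_shift_iso Y : is_iso (inverse_shift Y).
Proof.
have [p [pc cp]] : is_iso (fmap Sig (c Y)) by apply/fmap_iso/ff_counit_iso.
have [q [qs sq]] := trif_shift_iso F (G Y).
apply: (ff_iso ffF); have := inverse_shiftE Y => e.
have -> : fmap F (inverse_shift Y) = q ∘ (p ∘ c (Sig Y)).
  by rewrite -e (compA p) pc comp1m compA qs comp1m.
apply: is_iso_comp; first exact: is_iso_inv qs sq.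
by apply: is_iso_comp; [exact: is_iso_inv pc cp | apply: ff_counit_iso].
Qed.

Lemma iso_cancel_l (D : preadditive) (X Y Z : D) (f g : Hom X Y) (s : Hom Y Z) :
  is_iso s -> s ∘ f = s ∘ g -> f = g.
Proof. by move=> [t [ts _]] e; rewrite -(comp1m f) -(comp1m g) -ts -!compA e. Qed.

Lemma inverse_shift_nat (X Y : T') (f : Hom X Y) :
  inverse_shift Y ∘ fmap G (fmap Sig f) = fmap Sig (fmap G f) ∘ inverse_shift X.
Proof.
apply: (ff_inj ffF); apply: (iso_cancel_l (trif_shift_iso F (G Y))).
apply: (@iso_cancel_l _ _ _ _ _ _ (fmap Sig (c Y))).
  exact/fmap_iso/ff_counit_iso.
rewrite !fmapM (compA (trif_shift F _)) (compA (fmap Sig (c Y))) inverse_shiftE.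
rewrite ff_counit_nat (compA (trif_shift F _)) trif_shift_nat -(compA (fmap Sig _)).
by rewrite (compA (fmap Sig (c Y))) -fmapM ff_counit_nat fmapM -(compA (fmap Sig f)) inverse_shiftE.
Qed.

(** Through the counit, [F G] of the triangle is isomorphic to the triangle itself, hence by
    [F_dist] to the image of a distinguished triangle of [T]. Full faithfulness lifts that
    isomorphism to [T]. *)
Lemma inverse_dist (X Y Z : T') (u : Hom X Y) (v : Hom Y Z) (w : Hom Z (Sig X)) :
  dist u v w -> dist (fmap G u) (fmap G v) (inverse_shift X ∘ fmap G w).
Proof.
move=> /F_dist [X' [Y' [Z' [u' [v' [w' [d t]]]]]]]; apply: T_iso d.
have {t} : tri_iso (fmap F (fmap G u)) (fmap F (fmap G v))
    (trif_shift F (G X) ∘ fmap F (inverse_shift X ∘ fmap G w))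
    (fmap F u') (fmap F v') (trif_shift F X' ∘ fmap F w').
  apply: tri_iso_trans t; exists (c X), (c Y), (c Z); split.
    by split; apply: ff_counit_iso.
  split; rewrite ?ff_counit_nat //.
  by rewrite fmapM !compA -(compA (fmap Sig _)) inverse_shiftE ff_counit_nat.
move=> [a [b [d [[ia ib id] [e1 e2 e3]]]]].
have [a' aE] := ff_surj a ffF; have [b' bE] := ff_surj b ffF; have [d' dE] := ff_surj d ffF.
move: ia ib id e1 e2 e3; rewrite -{}aE -{}bE -{}dE => ia ib id e1 e2 e3.
exists a', b', d'; split; first by split; apply: (ff_iso ffF).
split; try by apply: (ff_inj ffF); rewrite !fmapM.
apply: (ff_inj ffF); apply: (iso_cancel_l (trif_shift_iso F X')).
by rewrite fmapM compA trif_shift_nat -compA e3 -compA -fmapM.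
Qed.

Definition inverse_triFunctor : triFunctor T' T :=
  @TriFunctor T' T G inverse_shift inverse_shift_iso inverse_shift_nat inverse_dist.

Lemma triangle_equivalent_inverse : triangle_equivalent T' T.
Proof. by exists inverse_triFunctor; apply: ff_inverse_equivalence. Qed.

Lemma triangle_equivalent_direct : triangle_equivalent T T'.
Proof. by exists F; apply: ff_equivalence. Qed.

End TriangleInverse.

(** * Hom groups of a Verdier quotient *)

Section VerdierNatural.
Variables (T : triangulation) (S : T -> Prop).
Local Notation Q := (vquot S).
Local Notation V := (verdier_cat S).

(** Induction on the word that represents [f]. Only a formal inverse needs an idea: its square is
    the square of [s] conjugated by the images of the inverse. *)
Lemma verdier_natural (C : preadditive) (L M : functor V C)
    (a : forall X : V, Hom (L X) (M X)) :
  (forall (X Y : T) (f : Hom X Y), a Y ∘ fmap L (fmap Q f) = fmap M (fmap Q f) ∘ a X) ->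
  forall (X Y : V) (f : Hom X Y), a Y ∘ fmap L f = fmap M f ∘ a X.
Proof.
move=> aQ X Y; elim/clsW=> f; elim: f => {X Y}.
- by move=> X Y f; apply: aQ.
- move=> X Y s hs.
  have e1 : (cls (FInv hs) : @Hom V _ _) ∘ fmap Q s = idm (X : V).
    by rewrite [LHS]vcompE; apply/vhomP; constructor.
  have e2 : fmap Q s ∘ (cls (FInv hs) : @Hom V _ _) = idm (Y : V).
    by rewrite [LHS]vcompE; apply/vhomP; constructor.
  have := congr1 (fun z => fmap M (cls (FInv hs) : @Hom V _ _) ∘
    (z ∘ fmap L (cls (FInv hs) : @Hom V _ _))) (aQ _ _ s).
  rewrite -!compA -fmapM e2 fmap1 compm1 => ->.
  by rewrite !compA -fmapM e1 fmap1 comp1m.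
- move=> X Y Z f IHf g IHg; have -> : cls (FComp f g) = (cls f : @Hom V _ _) ∘ cls g.
    by rewrite [RHS]vcompE.
  by rewrite !fmapM compA IHf -compA IHg compA.
- move=> X Y f IHf g IHg; rewrite -cls_add (fmapD L (cls f : @Hom V _ _)).
  by rewrite (fmapD M (cls f : @Hom V _ _)) compDr compDl IHf IHg.
- move=> X Y f IHf; rewrite -voppE.
  have -> : vopp (cls f) = - (cls f : @Hom V _ _) by [].
  by rewrite !fmapN compmN compNm IHf.
Qed.

(** Yoneda: Hom(X, -) inverts the maps with cone in [S], so it lifts to the quotient. Evaluating the
    lift at the identity of [X] gives a retraction of the quotient map on Hom groups, whence
    injectivity. *)
Lemma local_to_bijective (X : T) :
  (forall (Y Z : T) (s : Hom Y Z), cone_in S s -> post_bij X s) ->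
  forall Y : T, (forall f : Hom X Y, fmap Q f = 0 -> f = 0) /\
    (forall g : @Hom V X Y, exists f : Hom X Y, fmap Q f = g).
Proof.
move=> loc Y.
have G_iso Z Z' (s : Hom Z Z') : cone_in S s -> is_iso (fmap (hom_from_l X (X : V)) s).
  by move=> /loc h; apply: post_bij_iso.
pose G := verdier_lift G_iso.
have GE Z Z' (f : Hom Z Z') : fmap G (fmap Q f) = fmap (hom_from_l X (X : V)) f.
  exact: verdier_lift_quot.
split=> [f Qf0|g].
  have := GE _ _ f; rewrite Qf0 fmap0 => /(congr1 (fun a : addmap _ _ => a (idm X))) /=.
  by rewrite compm1.
(* [a] compares the lifted functor with the Hom functor of the quotient; its naturality at [g],
   evaluated at the identity, exhibits a preimage of [g]. *)
pose a (Z : V) : Hom (G Z) (hom_from_r X (X : V) Z) :=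
  @AddMap (@Hom T X Z) (@Hom V X Z) (fun f => fmap Q f) (fun f f' => fmapD Q f f').
have aQ Z Z' (f : @Hom T Z Z') :
    a Z' ∘ fmap G (fmap Q f) = fmap (hom_from_r X (X : V)) (fmap Q f) ∘ a Z.
  by rewrite GE; apply: addmap_ext => h; rewrite /= -clsM.
have := verdier_natural aQ g => /(congr1 (fun b : addmap _ _ => b (idm X))) /= e.
by exists ((fmap G g : addmap _ _) (idm X)); rewrite [LHS]e; apply: (compm1 (g : @Hom V X Y)).
Qed.

Lemma local_from_bijective (X : T) :
  (forall (Y Z : T) (s : Hom Y Z), cone_in S s -> pre_bij X s) ->
  forall Y : T, (forall f : Hom Y X, fmap Q f = 0 -> f = 0) /\
    (forall g : @Hom V Y X, exists f : Hom Y X, fmap Q f = g).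
Proof.
move=> loc Y.
have G_iso Z Z' (s : Hom Z Z') : cone_in S s -> is_iso (fmap (hom_to_l X (X : V)) s).
  by move=> /loc h; apply: pre_bij_iso.
pose G := verdier_lift G_iso.
have GE Z Z' (f : Hom Z Z') : fmap G (fmap Q f) = fmap (hom_to_l X (X : V)) f.
  exact: verdier_lift_quot.
split=> [f Qf0|g].
  have := GE _ _ f; rewrite Qf0 fmap0 => /(congr1 (fun a : addmap _ _ => a (idm X))) /=.
  by rewrite comp1m.
pose a (Z : V) : Hom (hom_to_r X (X : V) Z) (G Z) :=
  @AddMap (@Hom T Z X) (@Hom V Z X) (fun f => fmap Q f) (fun f f' => fmapD Q f f').
have aQ Z Z' (f : @Hom T Z Z') :
    a Z' ∘ fmap (hom_to_r X (X : V)) (fmap Q f) = fmap G (fmap Q f) ∘ a Z.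
  by rewrite GE; apply: addmap_ext => h; rewrite /= -clsM.
have := verdier_natural aQ g => /(congr1 (fun b : addmap _ _ => b (idm X))) /= e.
by exists ((fmap G g : addmap _ _) (idm X)); rewrite -[LHS]e; apply: (comp1m (g : @Hom V Y X)).
Qed.

End VerdierNatural.

(** * Mapping cones in the homotopy category *)

Lemma succ_ind (P : int -> Prop) : (forall j, P (j + 1)) -> forall i, P i.
Proof. by move=> h i; rewrite -(subrK 1 i). Qed.

(** Equations for homotopies are available only in degrees [i + 1], while a map needs a component in
    every degree. The cast along [i - 1 + 1 = i] becomes trivial at [j + 1] by proof irrelevance. *)
Lemma succ_fun (B : int -> Type) (h : forall j, B (j + 1)) :
  exists g : forall i, B i, forall j, g (j + 1) = h j.
Proof.
exists (fun i => eq_rect _ B (h (i - 1)) i (subrK 1 i)) => j.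
have : forall k (e : k + 1 = j + 1), k = j -> eq_rect _ B (h k) (j + 1) e = h j.
  by move=> k e kj; move: e; rewrite kj => e; rewrite (Prop_irrelevance e erefl).
by apply; rewrite addrK.
Qed.

Section Reassoc.
Variable C : preadditive.

Lemma reassoc (X Y Z : C) (a : Hom Y Z) (b : Hom X Y) c :
  a ∘ b = c -> forall T (f : Hom T X), a ∘ (b ∘ f) = c ∘ f.
Proof. by move=> e T f; rewrite compA e. Qed.

Lemma reassoc0 (X Y Z : C) (a : Hom Y Z) (b : Hom X Y) :
  a ∘ b = 0 -> forall T (f : Hom T X), a ∘ (b ∘ f) = 0.
Proof. by move=> e T f; rewrite compA e comp0m. Qed.

End Reassoc.

Section Bip.
Variable A : additive.

Lemma prl_inlK (X Y T : A) (f : Hom T X) : prl X Y ∘ (inl X Y ∘ f) = f.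
Proof. by rewrite compA prl_inl comp1m. Qed.
Lemma prr_inrK (X Y T : A) (f : Hom T Y) : prr X Y ∘ (inr X Y ∘ f) = f.
Proof. by rewrite compA prr_inr comp1m. Qed.
Lemma prl_inrK (X Y T : A) (f : Hom T Y) : prl X Y ∘ (inr X Y ∘ f) = 0.
Proof. by rewrite compA prl_inr comp0m. Qed.
Lemma prr_inlK (X Y T : A) (f : Hom T X) : prr X Y ∘ (inl X Y ∘ f) = 0.
Proof. by rewrite compA prr_inl comp0m. Qed.

Lemma bip_ext_in (Z X Y : A) (a b : Hom (bip X Y) Z) :
  a ∘ inl X Y = b ∘ inl X Y -> a ∘ inr X Y = b ∘ inr X Y -> a = b.
Proof.
move=> e1 e2; rewrite -(compm1 a) -(compm1 b) -bip_id !compDr !compA.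
by rewrite e1 e2.
Qed.

Section ConeRules.
Variables (X Y : complex A) (f : cmap X Y).

Lemma prl_cone_difK i T (g : Hom T (cone f i)) :
  prl _ _ ∘ (cone_dif f i ∘ g) = - (dif X (i + 1) ∘ (prl _ _ ∘ g)).
Proof. by rewrite [LHS](reassoc (prl_cone_dif f i)) compNm compNm -compA. Qed.

Lemma prr_cone_difK i T (g : Hom T (cone f i)) :
  prr _ _ ∘ (cone_dif f i ∘ g) = f (i + 1) ∘ (prl _ _ ∘ g) + dif Y i ∘ (prr _ _ ∘ g).
Proof. by rewrite [LHS](reassoc (prr_cone_dif f i)) compDl -!compA. Qed.

End ConeRules.
End Bip.

(** Normalizes to sums of right-associated words; the rules ending in [K] fire inside such a
    word. *)
Ltac cat_simpl := repeat progress (rewrite /= ?(compDl, compDr, compNm, compmN, comp0m, compm0,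
  comp1m, compm1, opprD, opprK, oppr0, addr0, add0r,
  prl_inl, prr_inr, prl_inr, prr_inl, prl_inlK, prr_inrK, prl_inrK, prr_inlK,
  prl_cone_difK, prr_cone_difK, prl_cone_dif, prr_cone_dif)
  -?compA).

Section ConeRules2.
Variables (A : additive) (X Y : complex A) (f : cmap X Y).

Lemma cone_dif_inl i :
  cone_dif f i ∘ inl _ _ = inr _ _ ∘ f (i + 1) - inl _ _ ∘ dif X (i + 1).
Proof. by apply: bip_ext; cat_simpl. Qed.

End ConeRules2.

Section Homotopy.
Variable A : additive.
Implicit Types X Y Z T : complex A.

Lemma null_eq0 X Y (f : cmap X Y) : kcls f = 0 <-> null_homotopic f.
Proof.
have -> : (0 : khom X Y) = kcls 0 by rewrite -(subrr (kcls 0)) -kclsN -kclsD subrr.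
by rewrite kclsP subr0.
Qed.

Lemma null_by X Y (f : cmap X Y) (s : forall i, Hom (X (i + 1)) (Y i)) :
  (forall i, f (i + 1) = dif Y i ∘ s i + s (i + 1) ∘ dif X (i + 1)) -> kcls f = 0.
Proof. by move=> h; apply/null_eq0; exists s. Qed.

Lemma kcls_eq_by X Y (f g : cmap X Y) (s : forall i, Hom (X (i + 1)) (Y i)) :
  (forall i, f (i + 1) = g (i + 1) + (dif Y i ∘ s i + s (i + 1) ∘ dif X (i + 1))) ->
  kcls f = kcls g.
Proof.
by move=> h; apply/kclsP; exists s => i; rewrite cmap_addE cmap_oppE h; zmod.
Qed.

Lemma kcomp_kcls X Y Z (g : cmap Y Z) (f : cmap X Y) :
  (kcls g : @Hom (homotopy_cat A) Y Z) ∘ (kcls f : @Hom (homotopy_cat A) X Y) =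
  kcls (cmap_comp g f).
Proof. exact: kcompE. Qed.

Lemma kSig_kcls X Y (f : cmap X Y) :
  fmap (kSig A) (kcls f : @Hom (homotopy_cat A) X Y) = kcls (cmap_shift f).
Proof. exact: kshiftE. Qed.

Lemma cmap_succ X Y (h : forall j, Hom (X (j + 1)) (Y (j + 1))) :
  (forall j, h (j + 1) ∘ dif X (j + 1) = dif Y (j + 1) ∘ h j) ->
  exists g : cmap X Y, forall j, g (j + 1) = h j.
Proof.
move=> hd; have [g gh] := @succ_fun (fun i => Hom (X i) (Y i)) h.
have gd i : g (i + 1) ∘ dif X i = dif Y i ∘ g i.
  by elim/succ_ind: i => j; rewrite !gh hd.
by exists (CMap gd).
Qed.

Lemma kshift_inj X Y (a : khom X Y) : kshift a = 0 -> a = 0.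
Proof.
elim/kclsW: a => f; rewrite kshiftE => /null_eq0 [s fs].
have [t tE] := @succ_fun (fun i => Hom (X (i + 1)) (Y i)) (fun j => - s j).
apply: (@null_by _ _ _ t); elim/succ_ind => i; rewrite !tE.
by have /= -> := fs i; rewrite !(compNm, compmN).
Qed.

Lemma kshift_surj X Y (b : khom (shift X) (shift Y)) : exists a, kshift a = b.
Proof.
elim/kclsW: b => f.
have [j|g gf] := @cmap_succ X Y (fun j => f j).
  by have := cmap_dif f j; rewrite /= compmN compNm => /oppr_inj.
exists (kcls g); rewrite kshiftE; congr kcls.
by apply: cmap_ext => j; rewrite /= gf.
Qed.

Section ConeExact.
Variables (X Y T : complex A) (f : cmap X Y).
Local Notation K := (homotopy_cat A).
Local Notation "[ 'k' g ]" := (kcls g : @Hom K _ _) (format "[ 'k'  g ]").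

(** A null homotopy of [cone_inr f] after [g] has two components: the one in [X] is a chain map, the
    lift; the one in [Y] is a homotopy from [g] to [f] after the lift. *)
Lemma cone_exact1 (g : @Hom K T Y) :
  [k cone_inr f] ∘ g = 0 -> exists h : @Hom K T X, [k f] ∘ h = g.
Proof.
elim/kclsW: g => g; rewrite kcomp_kcls => /null_eq0 [s gs].
have [j|h hE] := @cmap_succ T X (fun j => prl _ _ ∘ s j).
  have := congr1 (fun z => prl _ _ ∘ z) (gs j); cat_simpl => /esym e.
  by apply: (zmod_from e); zmod.
exists (kcls h); rewrite kcomp_kcls; apply/esym.
apply: (@kcls_eq_by _ _ _ _ (fun i => prr _ _ ∘ s i)) => i.
have := congr1 (fun z => prr _ _ ∘ z) (gs i); cat_simpl => ->.
by rewrite hE; cat_simpl; zmod.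
Qed.

(** A null homotopy [s] of [g] after [f] is exactly what makes the row (s, g) a chain map on the
    cone. *)
Lemma cone_coexact1 (g : @Hom K Y T) :
  g ∘ [k f] = 0 -> exists h : @Hom K (cone f) T, h ∘ [k cone_inr f] = g.
Proof.
elim/kclsW: g => g; rewrite kcomp_kcls => /null_eq0 [s gs].
pose h i : Hom (cone f i) (T i) := s i ∘ prl _ _ + g i ∘ prr _ _.
have hd i : h (i + 1) ∘ dif (cone f) i = dif T i ∘ h i.
  have /= e := gs i; apply: bip_ext_in; rewrite /h; cat_simpl.
    by rewrite e; cat_simpl; zmod.
  by rewrite (cmap_dif g i).
exists (kcls (CMap hd)); rewrite kcomp_kcls; congr kcls.
by apply: cmap_ext => i; rewrite /= /h; cat_simpl.
Qed.

End ConeExact.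

Local Notation K := (homotopy_cat A).
Local Notation "[ 'k' g ]" := (kcls g : @Hom K _ _) (format "[ 'k'  g ]").

Section ConeMap.
Variables (X Y X' Y' : complex A) (f : cmap X Y) (f' : cmap X' Y').

(** The homotopy [s] filling the square is the off-diagonal entry of the matrix (a, 0; s, b). *)
Lemma cone_map_ex (a : @Hom K X X') (b : @Hom K Y Y') :
  b ∘ [k f] = [k f'] ∘ a ->
  exists c : @Hom K (cone f) (cone f'),
    c ∘ [k cone_inr f] = [k cone_inr f'] ∘ b /\
    fmap (kSig A) a ∘ [k cone_prl f] = [k cone_prl f'] ∘ c.
Proof.
elim/kclsW: a => a; elim/kclsW: b => b; rewrite kSig_kcls !kcomp_kcls.
move=> /kclsP [s fs].
have {}fs i : b (i + 1) ∘ f (i + 1) =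
    f' (i + 1) ∘ a (i + 1) + (dif Y' i ∘ s i + s (i + 1) ∘ dif X (i + 1)).
  by rewrite -(fs i) cmap_addE cmap_oppE /=; zmod.
pose c i : Hom (cone f i) (cone f' i) :=
  inl _ _ ∘ a (i + 1) ∘ prl _ _ + inr _ _ ∘ (b i ∘ prr _ _ + s i ∘ prl _ _).
have cd i : c (i + 1) ∘ dif (cone f) i = dif (cone f') i ∘ c i.
  apply: bip_ext; rewrite /c; cat_simpl.
    by rewrite (reassoc (cmap_dif a _)) -compA.
  rewrite (reassoc (fs i)) (reassoc (cmap_dif b _)); cat_simpl.
  by zmod.
by exists (kcls (CMap cd)); rewrite !kcomp_kcls; split; congr kcls; apply: cmap_ext => i;
  rewrite /= /c; cat_simpl.
Qed.

End ConeMap.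

Section Rotation.
Variables (X Y : complex A) (f : cmap X Y).

(** The inclusion of X^{i+1} into the double cone is not a chain map; the component [- f] cancels
    what the differential sends to [Y]. *)
Definition cone_rot i : Hom (shift X i) (cone (cone_inr f) i) :=
  inr _ _ ∘ inl _ _ - inl _ _ ∘ f (i + 1).

Lemma cone_rot_dif i :
  cone_rot (i + 1) ∘ dif (shift X) i = dif (cone (cone_inr f)) i ∘ cone_rot i.
Proof.
apply: bip_ext; rewrite /cone_rot; cat_simpl; first by rewrite cmap_dif.
by zmod.
Qed.

Definition cmap_rot : cmap (shift X) (cone (cone_inr f)) := CMap cone_rot_dif.

Definition cone_unrot i : Hom (cone (cone_inr f) i) (shift X i) := prl _ _ ∘ prr _ _.

Lemma cone_unrot_dif i :
  cone_unrot (i + 1) ∘ dif (cone (cone_inr f)) i = dif (shift X) i ∘ cone_unrot i.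
Proof. by rewrite /cone_unrot; cat_simpl. Qed.

Definition cmap_unrot : cmap (cone (cone_inr f)) (shift X) := CMap cone_unrot_dif.

Lemma cmap_rotK : [k cmap_unrot] ∘ [k cmap_rot] = idm _.
Proof.
rewrite kcomp_kcls; congr kcls; apply: cmap_ext => i.
by rewrite /= /cone_unrot /cone_rot; cat_simpl.
Qed.

Lemma cmap_unrotK : [k cmap_rot] ∘ [k cmap_unrot] = idm _.
Proof.
rewrite kcomp_kcls.
(* The homotopy contracts the two copies of [Y] in the double cone against each other. *)
pose s i : Hom (cone (cone_inr f) (i + 1)) (cone (cone_inr f) i) :=
  - (inl (Y (i + 1)) (cone f i) ∘
     (prr (X (i + 1 + 1)) (Y (i + 1)) ∘ prr (Y (i + 1 + 1)) (cone f (i + 1)))).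
apply: (@kcls_eq_by _ _ _ _ s) => i; rewrite {}/s.
rewrite /= /cone_unrot /cone_rot; apply: bip_ext; cat_simpl.
  by zmod.
apply: bip_ext; cat_simpl; by zmod.
Qed.

End Rotation.

End Homotopy.

(** * Long exact sequences *)

(* The consequences of the axioms of triangulated categories that are used; they
   avoid the octahedral axiom. *)
Record exact_triangulation (T : triangulation) : Prop := ExactTriangulation {
  sig_inj : forall (X Y : T) (f : Hom X Y), fmap Sig f = 0 -> f = 0;
  sig_surj : forall (X Y : T) (g : Hom (Sig X) (Sig Y)), exists f, fmap Sig f = g;
  tri_iso_dist : iso_closed T;
  tri_rot : forall (X Y Z : T) (u : Hom X Y) (v : Hom Y Z) (w : Hom Z (Sig X)),
    dist u v w -> dist v w (- fmap Sig u);
  tri_map : forall (X Y Z : T) (u : Hom X Y) (v : Hom Y Z) (w : Hom Z (Sig X))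
      (X' Y' Z' : T) (u' : Hom X' Y') (v' : Hom Y' Z') (w' : Hom Z' (Sig X'))
      (a : Hom X X') (b : Hom Y Y'),
    dist u v w -> dist u' v' w' -> b ∘ u = u' ∘ a ->
    exists c : Hom Z Z', c ∘ v = v' ∘ b /\ fmap Sig a ∘ w = w' ∘ c;
  tri_vu : forall (X Y Z : T) (u : Hom X Y) (v : Hom Y Z) (w : Hom Z (Sig X)),
    dist u v w -> v ∘ u = 0;
  tri_ex1 : forall (X Y Z : T) (u : Hom X Y) (v : Hom Y Z) (w : Hom Z (Sig X)) A (g : Hom A Y),
    dist u v w -> v ∘ g = 0 -> exists h, u ∘ h = g;
  tri_coex1 : forall (X Y Z : T) (u : Hom X Y) (v : Hom Y Z) (w : Hom Z (Sig X)) A (g : Hom Y A),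
    dist u v w -> g ∘ u = 0 -> exists h, h ∘ v = g }.

Lemma iso_cancel_r (D : preadditive) (X Y Z : D) (f g : Hom Y Z) (s : Hom X Y) :
  is_iso s -> f ∘ s = g ∘ s -> f = g.
Proof. by move=> [t [_ st]] e; rewrite -(compm1 f) -(compm1 g) -st !compA e. Qed.

Lemma iso_inverse (D : preadditive) (X Y : D) (s : Hom X Y) :
  is_iso s -> exists t : Hom Y X, [/\ is_iso t, t ∘ s = idm X & s ∘ t = idm Y].
Proof. by move=> [t [ts st]]; exists t; split=> //; exists s. Qed.

Lemma zero_iso_id (D : preadditive) (X Y : D) : is_zero X -> is_zero Y -> is_iso (0 : Hom X Y).
Proof. by move=> X0 Y0; exists 0; rewrite X0 Y0 !comp0m. Qed.

Section ExactTheory.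
Variables (T : triangulation) (TE : exact_triangulation T).

Section Triangle.
Variables (X Y Z : T) (u : Hom X Y) (v : Hom Y Z) (w : Hom Z (Sig X)).
Hypothesis uvw : dist u v w.

Lemma tri_uw : fmap Sig u ∘ w = 0.
Proof.
apply: oppr_inj; rewrite oppr0 -compNm.
exact: (tri_vu TE (tri_rot TE (tri_rot TE uvw))).
Qed.

Lemma tri_ex2 A (g : Hom A Z) : w ∘ g = 0 -> exists h, v ∘ h = g.
Proof. exact: (tri_ex1 TE (tri_rot TE uvw)). Qed.

Lemma tri_ex3 A (g : Hom A (Sig X)) : fmap Sig u ∘ g = 0 -> exists h, w ∘ h = g.
Proof.
move=> ug; apply: (tri_ex1 TE (tri_rot TE (tri_rot TE uvw))).
by rewrite compNm ug oppr0.
Qed.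

Lemma tri_coex2 A (g : Hom Z A) : g ∘ v = 0 -> exists h, h ∘ w = g.
Proof. exact: (tri_coex1 TE (tri_rot TE uvw)). Qed.

Lemma tri_coex3 A (g : Hom (Sig X) A) : g ∘ w = 0 -> exists h, h ∘ fmap Sig u = g.
Proof.
move=> gw; have [h e] := tri_coex1 TE (tri_rot TE (tri_rot TE uvw)) gw.
by exists (- h); rewrite compNm -compmN.
Qed.

End Triangle.

(** An endomorphism [c] of a triangle that is the identity on the first two terms is invertible:
    [c - 1] factors through [w1] and is killed by [w1], so its square is zero and [2 - c] is the
    inverse. This applies to both composites of a completion of (a, b) with a completion of the
    inverses. *)
Lemma tri_map_iso (X Y Z : T) (u : Hom X Y) (v : Hom Y Z) (w : Hom Z (Sig X))
    (X' Y' Z' : T) (u' : Hom X' Y') (v' : Hom Y' Z') (w' : Hom Z' (Sig X'))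
    (a : Hom X X') (b : Hom Y Y') :
  dist u v w -> dist u' v' w' -> is_iso a -> is_iso b -> b ∘ u = u' ∘ a ->
  tri_iso u v w u' v' w'.
Proof.
have unip (X1 Y1 Z1 : T) (u1 : Hom X1 Y1) (v1 : Hom Y1 Z1) (w1 : Hom Z1 (Sig X1)) (c : Hom Z1 Z1) :
    dist u1 v1 w1 -> c ∘ v1 = v1 -> w1 ∘ c = w1 -> is_iso c.
  move=> d cv wc; have [h hw] : exists h, h ∘ w1 = c - idm _.
    by apply: (tri_coex2 d); rewrite compDl compNm cv comp1m subrr.
  have n2 : (c - idm _) ∘ (c - idm _) = 0.
    by rewrite -{1}hw -compA compDr compmN wc compm1 subrr compm0.
  have cc : c ∘ (c - idm _) = c - idm _.
    by rewrite -[c in c ∘ _](subrK (idm Z1)) compDl n2 comp1m add0r.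
  have {}cc : c ∘ c = c + c - idm _.
    by move: cc; rewrite compDr compmN compm1 => cc; apply: (zmod_from cc); zmod.
  exists (idm _ + idm _ - c).
  by rewrite !(compDl, compDr, compmN, compNm) !comp1m compm1 cc; split; zmod.
move=> d d' ia ib e; have [c [cv wc]] := tri_map TE d d' e.
have [a' [ia' a'a aa']] := iso_inverse ia; have [b' [ib' b'b bb']] := iso_inverse ib.
have [|c' [cv' wc']] := tri_map TE d' d (_ : b' ∘ u' = u ∘ a').
  by rewrite -[u']compm1 -aa' (compA u') -e !compA b'b comp1m.
have i1 : is_iso (c' ∘ c).
  apply: (unip _ _ _ _ _ _ _ d); first by rewrite -compA cv compA cv' -compA b'b compm1.
  by rewrite compA -wc' -compA -wc compA -fmapM a'a fmap1 comp1m.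
have i2 : is_iso (c ∘ c').
  apply: (unip _ _ _ _ _ _ _ d'); first by rewrite -compA cv' compA cv -compA bb' compm1.
  by rewrite compA -wc -compA -wc' compA -fmapM aa' fmap1 comp1m.
exists a, b, c; split=> //; split=> //.
(* [x ∘ c'] is a left inverse of [c] and [c' ∘ y] a right inverse; [e1] identifies the two. *)
have [x [x1 _]] := i1; have [y [_ y2]] := i2.
exists (x ∘ c'); split; first by rewrite -compA.
have x1' : x ∘ c' ∘ c = idm _ by rewrite -compA.
have e1 : x ∘ c' = c' ∘ y by rewrite -[x ∘ c']compm1 -y2 !compA x1' comp1m.
by rewrite e1 compA.
Qed.

Section FiveLemma.
Variables (X Y Z : T) (u : Hom X Y) (v : Hom Y Z) (w : Hom Z (Sig X))
  (X' Y' Z' : T) (u' : Hom X' Y') (v' : Hom Y' Z') (w' : Hom Z' (Sig X'))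
  (a : Hom X X') (b : Hom Y Y') (c : Hom Z Z').
Hypotheses (d : dist u v w) (d' : dist u' v' w').
Hypotheses (e1 : b ∘ u = u' ∘ a) (e2 : c ∘ v = v' ∘ b) (e3 : fmap Sig a ∘ w = w' ∘ c).

(** Five lemma for the long exact sequence of Hom(A, -), with the connecting terms expressed by
    [Sig] on the targets. *)
Lemma post_bij_cone (A : T) : post_bij A a -> post_bij A b -> post_bij A (fmap Sig a) ->
  post_bij A (fmap Sig b) -> post_bij A c.
Proof.
move=> [a_inj a_surj] [b_inj b_surj] [Sa_inj Sa_surj] [Sb_inj _]; split=> [z cz|z'].
  have [y vy] : exists y, v ∘ y = z.
    by apply: (tri_ex2 d); apply: Sa_inj; rewrite compA e3 -compA cz compm0.
  have [x' ux'] : exists x', u' ∘ x' = b ∘ y.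
    by apply: (tri_ex1 TE d'); rewrite compA -e2 -compA vy.
  have [x ax] := a_surj x'.
  have uxy : u ∘ x = y.
    apply/eqP; rewrite -subr_eq0; apply/eqP/b_inj.
    by rewrite compDr compmN compA e1 -compA ax ux' subrr.
  by rewrite -vy -uxy compA (tri_vu TE d) comp0m.
have [x ax] := Sa_surj (w' ∘ z').
have [z wz] : exists z, w ∘ z = x.
  apply: (tri_ex3 d); apply: Sb_inj.
  by rewrite compA -fmapM e1 fmapM -compA ax compA (tri_uw d') comp0m.
have [y' vy'] : exists y', v' ∘ y' = z' - c ∘ z.
  by apply: (tri_ex2 d'); rewrite compDr compmN compA -e3 -compA wz ax subrr.
have [y by'] := b_surj y'.
by exists (v ∘ y + z); rewrite compDr compA e2 -compA by' vy' subrK.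
Qed.

Lemma pre_bij_cone (A : T) : pre_bij A a -> pre_bij A b -> pre_bij A (fmap Sig a) ->
  pre_bij A (fmap Sig b) -> pre_bij A c.
Proof.
move=> [a_inj _] [b_inj b_surj] [Sa_inj Sa_surj] [Sb_inj Sb_surj]; split=> [z cz|z].
  have [x wx] : exists x, x ∘ w' = z.
    by apply: (tri_coex2 d'); apply: b_inj; rewrite -compA -e2 compA cz comp0m.
  have [y uy] : exists y, y ∘ fmap Sig u = x ∘ fmap Sig a.
    by apply: (tri_coex3 d); rewrite -compA e3 compA wx.
  have [y' by'] := Sb_surj y.
  have uxy : y' ∘ fmap Sig u' = x.
    apply/eqP; rewrite -subr_eq0; apply/eqP/Sa_inj.
    by rewrite compDl compNm -compA -fmapM -e1 fmapM compA by' uy subrr.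
  by rewrite -wx -uxy -compA (tri_uw d') compm0.
have [y by'] := b_surj (z ∘ v).
have [z' vz'] : exists z', z' ∘ v' = y.
  apply: (tri_coex1 TE d'); apply: a_inj.
  by rewrite -compA -e1 compA by' -compA (tri_vu TE d) compm0.
have [x wx] : exists x, x ∘ w = z - z' ∘ c.
  by apply: (tri_coex2 d); rewrite compDl compNm -compA e2 compA vz' by' subrr.
have [x' ax] := Sa_surj x.
by exists (x' ∘ w' + z'); rewrite compDl -compA -e3 compA ax wx subrK.
Qed.

End FiveLemma.

Section ConeVanishing.
Variables (X Y Z : T) (u : Hom X Y) (v : Hom Y Z) (w : Hom Z (Sig X)).
Hypothesis d : dist u v w.

(** Injectivity would ask for the vanishing of Hom from [A] to the desuspension of [Z]. Suspending
    [x] first turns this into maps from [Sig A] to [Z]. *)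
Lemma post_bij_of_cone A : (forall f : Hom A Z, f = 0) -> (forall f : Hom (Sig A) Z, f = 0) ->
  post_bij A u.
Proof.
move=> AZ SAZ; split=> [x ux|y]; last by apply: (tri_ex1 TE d); apply: AZ.
apply: (sig_inj TE); have [h <-] : exists h, w ∘ h = fmap Sig x.
  by apply: (tri_ex3 d); rewrite -fmapM ux fmap0.
by rewrite (SAZ h) compm0.
Qed.

Lemma pre_bij_of_cone A : (forall f : Hom Z A, f = 0) -> (forall f : Hom Z (Sig A), f = 0) ->
  pre_bij A u.
Proof.
move=> ZA ZSA; split=> [y yu|x].
  by have [h <-] := tri_coex1 TE d yu; rewrite (ZA h) comp0m.
have [h he] := tri_coex3 d (ZSA (fmap Sig x ∘ w)).
have [y ye] := sig_surj TE h; exists y.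
apply/eqP; rewrite -subr_eq0; apply/eqP/(sig_inj TE).
by rewrite fmapD fmapN fmapM ye he subrr.
Qed.

Lemma cone_post_zero A : post_bij A u -> post_bij A (fmap Sig u) -> forall f : Hom A Z, f = 0.
Proof.
move=> [_ surj] [Sinj _] f; have [y vy] : exists y, v ∘ y = f.
  by apply: (tri_ex2 d); apply: Sinj; rewrite compA (tri_uw d) comp0m.
by have [x ux] := surj y; rewrite -vy -ux compA (tri_vu TE d) comp0m.
Qed.

Lemma cone_pre_zero A : pre_bij A u -> pre_bij A (fmap Sig u) -> forall f : Hom Z A, f = 0.
Proof.
move=> [inj _] [_ Ssurj] f; have [x wx] : exists x, x ∘ w = f.
  by apply: (tri_coex2 d); apply: inj; rewrite -compA (tri_vu TE d) compm0.
by have [y yu] := Ssurj x; rewrite -wx -yu -compA (tri_uw d) compm0.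
Qed.

(** As [u = 0], the map [w] has a section, which lies in Hom(Sig X, Z) = 0. So [Sig X] and [w]
    vanish, and [v] is invertible by exactness on both sides. *)
Lemma tri_iso_right : (forall f : Hom (Sig X) Z, f = 0) -> u = 0 -> is_iso v.
Proof.
move=> SXZ u0; have [t wt] : exists t, w ∘ t = idm (Sig X).
  by apply: (tri_ex3 d); rewrite u0 fmap0 comp0m.
have SX0 : idm (Sig X) = 0 by rewrite -wt (SXZ t) compm0.
have w0 : w = 0 by rewrite -[w]comp1m SX0 comp0m.
have [r vr] : exists r, v ∘ r = idm Z by apply: (tri_ex2 d); rewrite w0 comp0m.
have [r' r'v] : exists r', r' ∘ v = idm Y by apply: (tri_coex1 TE d); rewrite u0 compm0.
exists r; split=> //; rewrite -r'v; congr (_ ∘ _).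
by rewrite -[r]comp1m -r'v -compA vr compm1.
Qed.

Lemma tri_iso_left : (forall f : Hom (Sig X) Z, f = 0) -> v = 0 -> is_iso u.
Proof.
move=> SXZ v0; have [t tw] : exists t, t ∘ w = idm Z.
  by apply: (tri_coex2 d); rewrite v0 compm0.
have Z0 : idm Z = 0 by rewrite -tw (SXZ t) comp0m.
have w0 : w = 0 by rewrite -[w]compm1 Z0 compm0.
have [r ur] : exists r, u ∘ r = idm Y by apply: (tri_ex1 TE d); rewrite v0 comp0m.
have [r' r'u] : exists r', r' ∘ fmap Sig u = idm _ by apply: (tri_coex3 d); rewrite w0 compm0.
exists r; split=> //; apply/eqP; rewrite -subr_eq0; apply/eqP/(sig_inj TE).
rewrite fmapD fmapN fmapM fmap1 -[fmap Sig r]comp1m -r'u -!compA -!fmapM (compA u) ur comp1m r'u.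
by rewrite subrr.
Qed.

End ConeVanishing.

End ExactTheory.

Section HomotopyExact.
Variable A : additive.
Local Notation K := (homotopy_cat A).
Local Notation "[ 'k' g ]" := (kcls g : @Hom K _ _) (format "[ 'k'  g ]").

Lemma kdist_cone (X Y : complex A) (f : cmap X Y) :
  kdist [k f] [k cone_inr f] [k cone_prl f].
Proof. by exists X, Y, f; apply: tri_iso_refl. Qed.

Lemma kdist_iso : iso_closed (homotopyCategory A).
Proof.
move=> X Y Z X' Y' Z' u v w u' v' w' t [X'' [Y'' [f t']]].
by exists X'', Y'', f; apply: tri_iso_trans t t'.
Qed.

(** A distinguished triangle is only isomorphic to a standard one: conjugate the square to the
    standard cones, complete it there by [cone_map_ex], and conjugate back. *)
Lemma kdist_map (X Y Z : K) (u : Hom X Y) (v : Hom Y Z) (w : Hom Z (kSig A X))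
      (X' Y' Z' : K) (u' : Hom X' Y') (v' : Hom Y' Z') (w' : Hom Z' (kSig A X'))
      (a : Hom X X') (b : Hom Y Y') :
    kdist u v w -> kdist u' v' w' -> b ∘ u = u' ∘ a ->
    exists c : Hom Z Z', c ∘ v = v' ∘ b /\ fmap (kSig A) a ∘ w = w' ∘ c.
Proof.
move=> [X1 [Y1 [f [p [q [r [[ip iq ir] [e1 e2 e3]]]]]]]].
move=> [X2 [Y2 [f' /tri_iso_sym [p' [q' [r' [[ip' iq' ir'] [e1' e2' e3']]]]]]]] e.
have [p1 [ip1 p1p pp1]] := iso_inverse ip; have [q1 [iq1 q1q qq1]] := iso_inverse iq.
have [r1 [ir1 r1r rr1]] := iso_inverse ir.
have [p2 [ip2 p2p pp2]] := iso_inverse ip'; have [q2 [iq2 q2q qq2]] := iso_inverse iq'.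
have h : (q2 ∘ b ∘ q1) ∘ [k f] = [k f'] ∘ (p2 ∘ a ∘ p1).
  have -> : [k f] = q ∘ u ∘ p1 by rewrite e1 -compA pp1 compm1.
  have -> : [k f'] = q2 ∘ u' ∘ p' by rewrite -compA -e1' compA q2q comp1m.
  by rewrite -!compA (compA q1) q1q comp1m (compA p') pp2 comp1m (compA b) e !compA.
have [c [c1 c2]] := cone_map_ex h.
exists (r' ∘ c ∘ r); split.
  rewrite -compA e2 (compA _ _ q) -(compA r') c1 -!compA q1q compm1 (compA r') e2'.
  by rewrite -compA (compA q') qq2 comp1m.
have ea : a = p' ∘ (p2 ∘ a ∘ p1) ∘ p by rewrite !compA pp2 comp1m -compA p1p compm1.
rewrite {}[in LHS]ea; set m := p2 ∘ a ∘ p1 in c2 *; clearbody m.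
rewrite !fmapM -!compA e3 (compA (fmap _ m)) c2 -!compA (compA (fmap _ p')) e3'.
by rewrite !compA.
Qed.

Lemma kdist_rot (X Y Z : K) (u : Hom X Y) (v : Hom Y Z) (w : Hom Z (kSig A X)) :
  kdist u v w -> kdist v w (- fmap (kSig A) u).
Proof.
move=> [X1 [Y1 [f [p [q [r [[ip iq ir] [e1 e2 e3]]]]]]]].
exists Y1, (cone f), (cone_inr f).
have t1 : @tri_iso K (kSig A) _ _ _ v w (- fmap (kSig A) u) Y1 (cone f) (shift X1)
    [k cone_inr f] [k cone_prl f] (- fmap (kSig A) [k f]).
  exists q, r, (fmap (kSig A) p); split; first by split=> //; apply: fmap_iso.
  by split=> //; rewrite compmN compNm -!fmapM e1.
apply: tri_iso_trans t1 _.
have ei : is_iso [k cmap_rot f].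
  by exists [k cmap_unrot f]; rewrite cmap_rotK cmap_unrotK.
exists (idm _), (idm _), [k cmap_rot f]; split; first by split=> //; apply: is_iso_id.
split; first by rewrite comp1m compm1.
  rewrite compm1; have -> : [k cone_prl f] = [k cmap_unrot f] ∘ [k cone_inr (cone_inr f)].
    rewrite kcomp_kcls; congr kcls; apply: cmap_ext => i /=.
    by rewrite /cone_unrot -compA prr_inr compm1.
  by rewrite compA cmap_unrotK comp1m.
rewrite fmap1 comp1m kSig_kcls -kclsN kcomp_kcls; congr kcls; apply: cmap_ext => i /=.
by rewrite /cone_rot compDr compmN !compA prl_inr prl_inl comp0m comp1m add0r.
Qed.

Lemma homotopy_exact : exact_triangulation (homotopyCategory A).
Proof.
split.
- by move=> X Y f /kshift_inj.
- by move=> X Y g; have [f] := kshift_surj g; exists f.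
- exact: kdist_iso.
- exact: kdist_rot.
- exact: kdist_map.
- move=> X Y Z u v w [X1 [Y1 [f [p [q [r [[ip iq ir] [e1 e2 e3]]]]]]]].
  apply: (iso_cancel_l ir); rewrite compm0 compA e2 -compA e1 compA.
  rewrite (_ : [k cone_inr f] ∘ [k f] = 0) ?comp0m // kcomp_kcls.
  pose s i : Hom (X1 (i + 1)) (cone f i) := inl _ _.
  apply: (@null_by _ _ _ _ s) => i; rewrite /s /=.
  by rewrite (cone_dif_inl f i) subrK.
- move=> X Y Z u v w B g [X1 [Y1 [f [p [q [r [[ip iq ir] [e1 e2 e3]]]]]]]] vg.
  have [h he] : exists h, [k f] ∘ h = q ∘ g.
    by apply: cone_exact1; rewrite compA -e2 -compA vg compm0.
  have [p1 [ip1 p1p pp1]] := iso_inverse ip.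
  exists (p1 ∘ h); apply: (iso_cancel_l iq).
  by rewrite compA e1 -compA (compA p) pp1 comp1m.
- move=> X Y Z u v w B g [X1 [Y1 [f [p [q [r [[ip iq ir] [e1 e2 e3]]]]]]]] gu.
  have [q1 [iq1 q1q qq1]] := iso_inverse iq.
  have [h he] : exists h, h ∘ [k cone_inr f] = g ∘ q1.
    apply: cone_coexact1; apply: (iso_cancel_r ip).
    by rewrite -!compA -e1 (compA q1) q1q comp1m gu comp0m.
  by exists (h ∘ r); rewrite -compA e2 compA he -compA q1q compm1.
Qed.

End HomotopyExact.

(** * Brutal truncations *)

Lemma reassoc0_4 (C : preadditive) (X Y Z U V : C) (a : Hom U V) (b : Hom Z U) (c : Hom Y Z)
    (d : Hom X Y) : a ∘ (b ∘ (c ∘ d)) = 0 ->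
  forall T (f : Hom T X), a ∘ (b ∘ (c ∘ (d ∘ f))) = 0.
Proof. by move=> e T f; rewrite !compA -(compA a) -(compA a) -(compA b) e comp0m. Qed.

(* Gaussian elimination: the part of a map of complexes on which it is invertible
   (with inverse [G]) can be removed from its cone. *)
Section ConeReduction.
Variables (A : additive) (X Y X' Y' : complex A) (s : cmap X Y) (s' : cmap X' Y').
Variables (iX : forall i, Hom (X' i) (X i)) (pX : forall i, Hom (X i) (X' i))
  (iY : forall i, Hom (Y' i) (Y i)) (pY : forall i, Hom (Y i) (Y' i))
  (G : forall i, Hom (Y i) (X i)).
Hypotheses (pXi : forall i, pX i ∘ iX i = idm _) (pYi : forall i, pY i ∘ iY i = idm _).
Hypotheses (pG : forall i, pX i ∘ G i = 0) (Gi : forall i, G i ∘ iY i = 0).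
Hypotheses (sG : forall i, s i ∘ G i = idm _ - iY i ∘ pY i)
  (Gs : forall i, G i ∘ s i = idm _ - iX i ∘ pX i).
Hypotheses (dX' : forall i, dif X' i = pX (i + 1) ∘ dif X i ∘ iX i)
  (dY' : forall i, dif Y' i = pY (i + 1) ∘ dif Y i ∘ iY i).
Hypothesis s'E : forall i, s' i = pY i ∘ s i ∘ iX i.
Hypotheses (ddX : forall i, dif X (i + 1) ∘ (iX (i + 1) ∘ (pX (i + 1) ∘ dif X i)) = 0)
  (ddY : forall i, dif Y (i + 1) ∘ (iY (i + 1) ∘ (pY (i + 1) ∘ dif Y i)) = 0).
Hypotheses (pdGd : forall i, pX (i + 1 + 1) ∘ (dif X (i + 1) ∘ (G (i + 1) ∘ dif Y i)) = 0)
  (dGdi : forall i, dif X (i + 1) ∘ (G (i + 1) ∘ (dif Y i ∘ iY i)) = 0).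

Lemma red_si i : s i ∘ iX i = iY i ∘ s' i.
Proof.
have e : s i = s i ∘ G i ∘ s i + iY i ∘ pY i ∘ s i.
  by rewrite sG -compDl subrK comp1m.
by rewrite e -compA Gs s'E !(compDl, compDr, compNm, compmN, compm1) -!compA pXi compm1 subrr add0r.
Qed.

Lemma red_ps i : pY i ∘ s i = s' i ∘ pX i.
Proof.
have e : s i = s i ∘ G i ∘ s i + s i ∘ iX i ∘ pX i.
  by rewrite -!compA -compDr Gs subrK compm1.
by rewrite e sG s'E !(compDl, compDr, compNm, compmN, comp1m) !compA pYi comp1m subrr add0r.
Qed.

(** Projecting both components is not a chain map. The term [dif X i ∘ G i] is the correction along
    the inverse of the eliminated block, as in a Schur complement; [red_t] carries the mirror
    term. *)
Definition red_r i : Hom (cone s i) (cone s' i) :=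
  inl _ _ ∘ (pX (i + 1) ∘ (prl _ _ + dif X i ∘ (G i ∘ prr _ _))) + inr _ _ ∘ (pY i ∘ prr _ _).

Definition red_t i : Hom (cone s' i) (cone s i) :=
  inl _ _ ∘ (iX (i + 1) ∘ prl _ _ - G (i + 1) ∘ (dif Y i ∘ (iY i ∘ prr _ _)))
  + inr _ _ ∘ (iY i ∘ prr _ _).

Let prl_r i : prl _ _ ∘ red_r i = pX (i + 1) ∘ (prl _ _ + dif X i ∘ (G i ∘ prr _ _)).
Proof. by rewrite /red_r [LHS]compDr prl_inlK prl_inrK addr0. Qed.
Let prr_r i : prr _ _ ∘ red_r i = pY i ∘ prr _ _.
Proof. by rewrite /red_r [LHS]compDr prr_inlK prr_inrK add0r. Qed.
Let prl_t i : prl _ _ ∘ red_t i =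
  iX (i + 1) ∘ prl _ _ - G (i + 1) ∘ (dif Y i ∘ (iY i ∘ prr _ _)).
Proof. by rewrite /red_t [LHS]compDr prl_inlK prl_inrK addr0. Qed.
Let prr_t i : prr _ _ ∘ red_t i = iY i ∘ prr _ _.
Proof. by rewrite /red_t [LHS]compDr prr_inlK prr_inrK add0r. Qed.

Lemma red_r_dif i : red_r (i + 1) ∘ dif (cone s) i = dif (cone s') i ∘ red_r i.
Proof.
rewrite /=; apply: bip_ext; rewrite !compA ?prl_r ?prr_r ?prl_cone_dif ?prr_cone_dif.
  move: (cone_dif s i) (prl_cone_dif s i) (prr_cone_dif s i) => D pD rD.
  rewrite -[RHS]compA prl_r dX'.
  rewrite !(compDl, compDr, compNm, compmN) -!compA pD rD.
  rewrite !(compDl, compDr, compNm, compmN) (reassoc (Gs _)).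
  rewrite !(compDl, compDr, compNm, compmN) !comp1m -!compA.
  by rewrite (reassoc0_4 (ddX i)) (reassoc0_4 (pdGd i)) !compm0; zmod.
move: (cone_dif s i) (prl_cone_dif s i) (prr_cone_dif s i) => D pD rD.
rewrite -compA rD [RHS]compDl -!compA prl_r prr_r.
rewrite !(compDl, compDr) (reassoc (red_ps _)) dY' !compA -red_ps -!compA.
rewrite (reassoc (cmap_dif s i)) -!compA (reassoc (sG i)).
by rewrite !(compDl, compDr, compNm, compmN) !comp1m -!compA; zmod.
Qed.

Lemma red_t_dif i : red_t (i + 1) ∘ dif (cone s') i = dif (cone s) i ∘ red_t i.
Proof.
rewrite /=; apply: bip_ext; rewrite !compA ?prl_t ?prr_t ?prl_cone_dif ?prr_cone_dif.
  move: (cone_dif s' i) (prl_cone_dif s' i) (prr_cone_dif s' i) => D pD rD.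
  rewrite -[RHS]compA prl_t.
  rewrite !(compDl, compDr, compNm, compmN) -!compA pD rD.
  rewrite !(compDl, compDr, compNm, compmN) !opprK.
  rewrite (reassoc0_4 (dGdi i)).
  have -> : iY (i + 1) ∘ (s' (i + 1) ∘ prl (X' (i + 1)) (Y' i)) =
    s (i + 1) ∘ (iX (i + 1) ∘ prl _ _) by rewrite !compA red_si.
  rewrite (reassoc (esym (cmap_dif s (i + 1)))) -!compA (reassoc (Gs _)).
  rewrite dX' dY' -!compA (reassoc0_4 (ddY i)) compm0.
  by rewrite !(compDl, compDr, compNm, compmN) !comp1m -!compA; zmod.
move: (cone_dif s' i) (prl_cone_dif s' i) (prr_cone_dif s' i) => D pD rD.
rewrite -compA rD [RHS]compDl -!compA prl_t prr_t.
rewrite !(compDl, compDr, compNm, compmN) (reassoc (sG _)) dY'.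
rewrite !(compDl, compDr, compNm, compmN) !comp1m -!compA (reassoc (red_si _)) -!compA.
by zmod.
Qed.

Lemma cone_reduction : @isomorphic (homotopy_cat A) (cone s) (cone s').
Proof.
exists (kcls (CMap red_r_dif)), (kcls (CMap red_t_dif)); split; rewrite kcomp_kcls; last first.
  congr kcls; apply: cmap_ext => i /=; apply: bip_ext; rewrite compA compm1 ?prl_r ?prr_r.
    move: (red_t i) (prl_t i) (prr_t i) => t pt rt.
    rewrite -compA !(compDl, compDr) -!compA pt rt.
    rewrite !(compDl, compDr, compNm, compmN) (reassoc0 (Gi _)) !compm0 addr0.
    by rewrite (reassoc (pXi _)) (reassoc0 (pG _)) comp1m subr0.
  by rewrite -compA prr_t (reassoc (pYi _)) comp1m.
(* The other composite was the identity on the nose; this one is so up to the homotopy [G], which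
   contracts the eliminated block. *)
apply/esym; pose h i : Hom (cone s (i + 1)) (cone s i) :=
  inl (X (i + 1)) (Y i) ∘ (G (i + 1) ∘ prr (X (i + 1 + 1)) (Y (i + 1))).
apply: (@kcls_eq_by _ _ _ _ _ h) => i; rewrite /h /=.
move: (red_r (i + 1)) (prl_r (i + 1)) (prr_r (i + 1)) => r pr rr.
move: (red_t (i + 1)) (prl_t (i + 1)) (prr_t (i + 1)) => t pt rt.
move: (cone_dif s i) (prl_cone_dif s i) (prr_cone_dif s i) => D pD rD.
move: (cone_dif s (i + 1)) (prl_cone_dif s (i + 1)) (prr_cone_dif s (i + 1)) => D' pD' rD'.
apply: bip_ext; rewrite compm1 !compDr -!compA.
  rewrite (reassoc pt) (reassoc pD) prl_inlK !(compDl, compNm) -!compA pr rr prl_inlK rD'.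
  rewrite !compDr (reassoc (Gs _)) !(compDl, compNm) comp1m -!compA.
  have e : (idm _ - iX (i + 1 + 1) ∘ pX (i + 1 + 1)) ∘ dif X (i + 1) ∘ G (i + 1) =
      G (i + 1 + 1) ∘ dif Y (i + 1) ∘ (idm _ - iY (i + 1) ∘ pY (i + 1)).
    by rewrite -Gs -sG -!compA (reassoc (cmap_dif s (i + 1))) -!compA.
  have := congr1 (fun z => z ∘ prr (X (i + 1 + 1)) (Y (i + 1))) e.
  rewrite !(compDl, compDr, compNm, compmN) !comp1m !compm1 -!compA => {}e.
  by apply: (zmod_from e); zmod.
rewrite (reassoc rt) -compA rr prr_inlK addr0 (reassoc rD) compDl -!compA.
rewrite prl_inlK prr_inlK compm0 addr0 (reassoc (sG _)) compDl compNm comp1m -!compA.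
by zmod.
Qed.

End ConeReduction.

(** * Comparison maps for brutal truncations *)

Section Truncation.
Variable A : additive.
Implicit Types (X Y Z : complex A) (p q : pred int).

Definition sel_map (b c : bool) (X Y : A) (f : Hom X Y) :
    Hom (if b then X else zero A) (if c then Y else zero A) :=
  match b as b', c as c' return Hom (if b' then X else zero A) (if c' then Y else zero A) with
  | true, true => f
  | _, _ => 0
  end.

(** A composite through a discarded term is zero, so the middle term has to be kept whenever both
    ends are. *)
Lemma sel_mapM (b c d : bool) (X Y Z : A) (g : Hom Y Z) (f : Hom X Y) :
  (b -> d -> c) -> sel_map c d g ∘ sel_map b c f = sel_map b d (g ∘ f).
Proof. by case: b c d => [] [] [] // h; rewrite /= ?comp0m ?compm0 //; move: (h isT isT). Qed.

Lemma sel_map1 (b : bool) (X : A) : sel_map b b (idm X) = idm _.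
Proof. by case: b => //=; apply/esym/zero_is_zero. Qed.

Lemma sel_mapD (b c : bool) (X Y : A) (f g : Hom X Y) :
  sel_map b c (f + g) = sel_map b c f + sel_map b c g.
Proof. by case: b; case: c; rewrite //= addr0. Qed.

Lemma sel_map_zero (b c : bool) (X Y : A) : sel_map b c (0 : Hom X Y) = 0.
Proof. by case: b; case: c. Qed.

Lemma trunc_difE p X i : dif (trunc p X) i = sel_map (p i) (p (i + 1)) (dif X i).
Proof. by []. Qed.

Lemma trunc_map_dif p X Y (f : cmap X Y) i :
  sel_map (p (i + 1)) (p (i + 1)) (f (i + 1)) ∘ dif (trunc p X) i =
  dif (trunc p Y) i ∘ sel_map (p i) (p i) (f i).
Proof.
rewrite !trunc_difE /= /trunc_ob; have := cmap_dif f i.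
by case: (p i); case: (p (i + 1)) => //= e; rewrite ?compm0 ?comp0m.
Qed.

Definition trunc_map p X Y (f : cmap X Y) : cmap (trunc p X) (trunc p Y) :=
  @CMap A (trunc p X) (trunc p Y) (fun i => sel_map (p i) (p i) (f i)) (trunc_map_dif p f).

Lemma trunc_map_comp p X Y Z (g : cmap Y Z) (f : cmap X Y) :
  trunc_map p (cmap_comp g f) = cmap_comp (trunc_map p g) (trunc_map p f).
Proof. by apply: cmap_ext => i /=; rewrite sel_mapM. Qed.

Section Closed.
Variable p : pred int.

Section Down.
Hypothesis p_down : forall i, p (i + 1) -> p i.

Lemma to_trunc_dif X i : sel_map true (p (i + 1)) (idm (X (i + 1))) ∘ dif X i =
  dif (trunc p X) i ∘ sel_map true (p i) (idm (X i)).
Proof.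
rewrite trunc_difE /= /trunc_ob; have := @p_down i; case: (p i); case: (p (i + 1)) => //= h;
  rewrite ?(comp1m, compm1, comp0m, compm0) //; by have := h isT.
Qed.

Definition to_trunc X : cmap X (trunc p X) :=
  @CMap A X (trunc p X) (fun i => sel_map true (p i) (idm (X i))) (to_trunc_dif X).

Lemma to_trunc_nat X Y (f : cmap X Y) :
  cmap_comp (to_trunc Y) f = cmap_comp (trunc_map p f) (to_trunc X).
Proof.
by apply: cmap_ext => i; rewrite /= /trunc_ob; case: (p i);
  rewrite /= ?(comp1m, compm1, comp0m, compm0).
Qed.

Lemma to_trunc_iso X i : p i -> is_iso (to_trunc X i).
Proof. by rewrite /= /trunc_ob; case: (p i) => // _; apply: is_iso_id. Qed.

Section Factor.
Variables (X Y : complex A) (f : cmap X Y).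
Hypothesis f0 : forall i, ~~ p i -> f i = 0.

Lemma from_trunc_factor_dif i : sel_map (p (i + 1)) true (f (i + 1)) ∘ dif (trunc p X) i =
  dif Y i ∘ sel_map (p i) true (f i).
Proof.
rewrite trunc_difE /= /trunc_ob; have := @p_down i; have := @f0 (i + 1); have := cmap_dif f i.
case: (p i); case: (p (i + 1)) => //= e h k; rewrite ?(compm0, comp0m) //.
by rewrite -e h // comp0m.
Qed.

Lemma null_factor_to_trunc : exists g : cmap (trunc p X) Y, f = cmap_comp g (to_trunc X).
Proof.
exists (@CMap A (trunc p X) Y (fun i => sel_map (p i) true (f i)) from_trunc_factor_dif).
apply: cmap_ext => i; rewrite /= /trunc_ob; have := @f0 i.
by case: (p i) => /= [_|->//]; rewrite ?compm1 ?compm0.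
Qed.

End Factor.
End Down.

Section Up.
Hypothesis p_up : forall i, p i -> p (i + 1).

Lemma from_trunc_dif X i : sel_map (p (i + 1)) true (idm (X (i + 1))) ∘ dif (trunc p X) i =
  dif X i ∘ sel_map (p i) true (idm (X i)).
Proof.
rewrite trunc_difE /= /trunc_ob; have := @p_up i; case: (p i); case: (p (i + 1)) => //= h;
  rewrite ?(comp1m, compm1, comp0m, compm0) //; by have := h isT.
Qed.

Definition from_trunc X : cmap (trunc p X) X :=
  @CMap A (trunc p X) X (fun i => sel_map (p i) true (idm (X i))) (from_trunc_dif X).

Lemma from_trunc_nat X Y (f : cmap X Y) :
  cmap_comp f (from_trunc X) = cmap_comp (from_trunc Y) (trunc_map p f).
Proof.
by apply: cmap_ext => i; rewrite /= /trunc_ob; case: (p i);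
  rewrite /= ?(comp1m, compm1, comp0m, compm0).
Qed.

Lemma from_trunc_iso X i : p i -> is_iso (from_trunc X i).
Proof. by rewrite /= /trunc_ob; case: (p i) => // _; apply: is_iso_id. Qed.

Section Factor.
Variables (X Y : complex A) (f : cmap X Y).
Hypothesis f0 : forall i, ~~ p i -> f i = 0.

Lemma to_trunc_factor_dif i : sel_map true (p (i + 1)) (f (i + 1)) ∘ dif X i =
  dif (trunc p Y) i ∘ sel_map true (p i) (f i).
Proof.
rewrite trunc_difE /= /trunc_ob; have := @p_up i; have := @f0 i; have := cmap_dif f i.
case: (p i); case: (p (i + 1)) => //= e h k; rewrite ?(compm0, comp0m) //.
by rewrite e h // compm0.
Qed.

Lemma null_factor_from_trunc : exists g : cmap X (trunc p Y), f = cmap_comp (from_trunc Y) g.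
Proof.
exists (@CMap A X (trunc p Y) (fun i => sel_map true (p i) (f i)) to_trunc_factor_dif).
apply: cmap_ext => i; rewrite /= /trunc_ob; have := @f0 i.
by case: (p i) => /= [_|->//]; rewrite ?comp1m ?comp0m.
Qed.

End Factor.
End Up.
End Closed.

Section ShiftTrunc.
Variable p : pred int.

Lemma trunc_shift_dif X i :
  sel_map (p (i + 1)) (p (i + 1 + 1)) (idm (X (i + 1 + 1))) ∘ dif (trunc p (shift X)) i =
  dif (shift (trunc p X)) i ∘ sel_map (p i) (p (i + 1)) (idm (X (i + 1))).
Proof.
rewrite trunc_difE /= [trunc_dif _ _ _]trunc_difE /trunc_ob.
by case: (p i); case: (p (i + 1)); case: (p (i + 1 + 1)) => /=;
  rewrite ?(compm0, comp0m, comp1m, compm1, compNm, compmN, oppr0).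
Qed.

(** The left side selects X^{i+1} by [p i], the right side by [p (i + 1)]. For a half-line these
    disagree in one degree only. *)
Definition trunc_shift X : cmap (trunc p (shift X)) (shift (trunc p X)) :=
  @CMap A (trunc p (shift X)) (shift (trunc p X))
    (fun i => sel_map (p i) (p (i + 1)) (idm (X (i + 1)))) (trunc_shift_dif X).

Lemma trunc_shift_nat X Y (f : cmap X Y) :
  cmap_comp (trunc_shift Y) (trunc_map p (cmap_shift f)) =
  cmap_comp (cmap_shift (trunc_map p f)) (trunc_shift X).
Proof.
apply: cmap_ext => i; rewrite /= /trunc_ob; case: (p i); case: (p (i + 1)) => /=;
  by rewrite ?(compm0, comp0m, comp1m, compm1).
Qed.

Lemma trunc_shift_isoP X i : p i -> p (i + 1) -> is_iso (trunc_shift X i).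
Proof. by rewrite /= /trunc_ob; case: (p i); case: (p (i + 1)) => // _ _; apply: is_iso_id. Qed.

Variables (X Y : complex A) (f : cmap X Y).

(** The same discrepancy as for the shift: the summand X^{i+1} of the cone is selected by [p i] on
    one side and by [p (i + 1)] on the other. *)
Definition trunc_cone_fun i : Hom (trunc p (cone f) i) (cone (trunc_map p f) i) :=
  inl _ _ ∘ sel_map (p i) (p (i + 1)) (prl (X (i + 1)) (Y i)) +
  inr _ _ ∘ sel_map (p i) (p i) (prr (X (i + 1)) (Y i)).

Lemma prl_trunc_cone i :
  prl _ _ ∘ trunc_cone_fun i = sel_map (p i) (p (i + 1)) (prl (X (i + 1)) (Y i)).
Proof. by rewrite /trunc_cone_fun [LHS]compDr prl_inlK prl_inrK addr0. Qed.

Lemma prr_trunc_cone i :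
  prr _ _ ∘ trunc_cone_fun i = sel_map (p i) (p i) (prr (X (i + 1)) (Y i)).
Proof. by rewrite /trunc_cone_fun [LHS]compDr prr_inlK prr_inrK add0r. Qed.

Lemma trunc_cone_dif i : trunc_cone_fun (i + 1) ∘ dif (trunc p (cone f)) i =
  dif (cone (trunc_map p f)) i ∘ trunc_cone_fun i.
Proof.
rewrite trunc_difE /=.
have e1 := prl_cone_dif f i; have e2 := prr_cone_dif f i.
apply: bip_ext; rewrite !compA ?prl_trunc_cone ?prr_trunc_cone ?prl_cone_dif ?prr_cone_dif.
  rewrite -[RHS]compA prl_trunc_cone /= [trunc_dif _ _ _]trunc_difE /trunc_ob.
  move: (cone_dif f i) e1 {e2} => D e1.
  by case: (p i); case: (p (i + 1)); case: (p (i + 1 + 1)) => /=;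
    rewrite ?(compm0, comp0m, compNm, oppr0) // e1 compNm.
rewrite [RHS]compDl -!compA prl_trunc_cone prr_trunc_cone /= [trunc_dif _ _ _]trunc_difE /trunc_ob.
move: (cone_dif f i) {e1} e2 => D e2.
by case: (p i); case: (p (i + 1)) => /=; rewrite ?(compm0, comp0m, addr0) // e2.
Qed.

Definition trunc_cone : cmap (trunc p (cone f)) (cone (trunc_map p f)) :=
  @CMap A (trunc p (cone f)) (cone (trunc_map p f)) trunc_cone_fun trunc_cone_dif.

Lemma trunc_cone_iso i : p i -> p (i + 1) -> is_iso (trunc_cone i).
Proof.
rewrite /= /trunc_cone_fun /cone_ob /= /trunc_ob; case: (p i); case: (p (i + 1)) => //= _ _.
by rewrite bip_id; apply: is_iso_id.
Qed.

Lemma trunc_cone_inr :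
  cmap_comp trunc_cone (trunc_map p (cone_inr f)) = cone_inr (trunc_map p f).
Proof.
apply: cmap_ext => i /=; apply: bip_ext.
  by rewrite compA prl_trunc_cone [RHS]prl_inr [LHS]sel_mapM // prl_inr sel_map_zero.
by rewrite compA prr_trunc_cone [RHS]prr_inr [LHS]sel_mapM // prr_inr sel_map1.
Qed.

Lemma trunc_cone_prl :
  cmap_comp (cone_prl (trunc_map p f)) trunc_cone =
  cmap_comp (trunc_shift X) (trunc_map p (cone_prl f)).
Proof.
by apply: cmap_ext => i /=; rewrite prl_trunc_cone [RHS]sel_mapM ?comp1m // => ->.
Qed.

End ShiftTrunc.

(** Gaussian elimination, with [G] the inverse of [s] on [p] and zero elsewhere. Excluding isolated
    degrees of [p] makes the zigzag d G d vanish; it would otherwise leave an entry from [Y] to [X],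
    which no mapping cone has. *)
Lemma cone_trunc (p : pred int) X Y (s : cmap X Y) :
  (forall i, p i -> is_iso (s i)) -> (forall i, p (i + 1) -> p i || p (i + 1 + 1)) ->
  @isomorphic (homotopy_cat A) (cone s) (cone (trunc_map (fun i => ~~ p i) s)).
Proof.
move=> s_iso p_next.
have [G GP] : exists G : forall i, Hom (Y i) (X i), forall i,
    if p i then G i ∘ s i = idm _ /\ s i ∘ G i = idm _ else G i = 0.
  have h i : exists g : Hom (Y i) (X i),
      if p i then g ∘ s i = idm _ /\ s i ∘ g = idm _ else g = 0.
    case pi: (p i); last by exists 0.
    by have [g gP] := s_iso i pi; exists g.
  by exists (fun i => sval (cid (h i))) => i; exact: svalP (cid (h i)).
have dG i : p i -> p (i + 1) -> dif X i ∘ G i = G (i + 1) ∘ dif Y i.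
  move=> pi pi1; have := GP i; have := GP (i + 1); rewrite pi pi1 => -[g1 _] [_ g2].
  by rewrite -[LHS]comp1m -g1 -!compA (reassoc (cmap_dif s i)) -!compA g2 compm1.
pose q i := ~~ p i.
apply: (@cone_reduction _ _ _ _ _ s (trunc_map (fun i => ~~ p i) s)
  (fun i => sel_map (q i) true (idm (X i))) (fun i => sel_map true (q i) (idm (X i)))
  (fun i => sel_map (q i) true (idm (Y i))) (fun i => sel_map true (q i) (idm (Y i))) G).
- by move=> i; rewrite /q /= /trunc_ob; case: (p i) => /=;
    rewrite ?comp1m // compm0; apply/esym/zero_is_zero.
- by move=> i; rewrite /q /= /trunc_ob; case: (p i) => /=;
    rewrite ?comp1m // compm0; apply/esym/zero_is_zero.
- by move=> i; have := GP i; rewrite /q /= /trunc_ob; case: (p i) => /= [_|->]; rewrite ?comp0m ?compm0.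
- by move=> i; have := GP i; rewrite /q /= /trunc_ob; case: (p i) => /= [_|->]; rewrite ?comp0m ?compm0.
- by move=> i; have := GP i; rewrite /q /= /trunc_ob; case: (p i) => /= [[_ ->]|->];
    rewrite ?comp0m ?compm0 ?comp1m ?subrr ?subr0.
- by move=> i; have := GP i; rewrite /q /= /trunc_ob; case: (p i) => /= [[-> _]|->];
    rewrite ?comp0m ?compm0 ?comp1m ?subrr ?subr0.
- by move=> i; rewrite trunc_difE /q /= /trunc_ob; case: (p i); case: (p (i + 1)) => /=;
    rewrite ?(comp0m, compm0, comp1m, compm1).
- by move=> i; rewrite trunc_difE /q /= /trunc_ob; case: (p i); case: (p (i + 1)) => /=;
    rewrite ?(comp0m, compm0, comp1m, compm1).
- by move=> i; rewrite /q /= /trunc_ob; case: (p i) => /=; rewrite ?(comp0m, compm0, comp1m, compm1).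
- by move=> i; rewrite /q /= /trunc_ob; case: (p (i + 1)) => /=;
    rewrite ?(comp0m, compm0, comp1m, compm1) // dif_dif.
- by move=> i; rewrite /q /= /trunc_ob; case: (p (i + 1)) => /=;
    rewrite ?(comp0m, compm0, comp1m, compm1) // dif_dif.
(* If degree [i] is also in [p], then [G] commutes with d there and d d = 0 concludes. If degree
   [i + 1 + 1] is, the outer projection is zero. The next case is the mirror image. *)
- move=> i; case p1: (p (i + 1)); last by have := GP (i + 1); rewrite p1 => ->; rewrite comp0m !compm0.
  have := p_next i p1; case pi: (p i) => /= p2.
    by rewrite -(dG i pi p1) (reassoc0 (dif_dif X i)) compm0.
  have e : sel_map true (q (i + 1 + 1)) (idm (X (i + 1 + 1))) = 0.
    by rewrite /q p2.
  exact: etrans (congr1 (fun z => z ∘ _) e) (comp0m _ _).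
- move=> i; case p1: (p (i + 1)); last by have := GP (i + 1); rewrite p1 => ->; rewrite comp0m !compm0.
  have := p_next i p1; case pi: (p i) => /= p2.
    have e : sel_map (q i) true (idm (Y i)) = 0 by rewrite /q pi.
    apply: etrans (congr1 (fun z => dif X (i + 1) ∘ (G (i + 1) ∘ (dif Y i ∘ z))) e) _.
    by rewrite !compm0.
  by rewrite (reassoc (dG _ p1 p2)) -compA (reassoc0 (dif_dif Y i)) compm0.
Qed.

End Truncation.

(** * Maps from and to acyclic complexes *)

Section IntRecursion.
Variable H : int -> Type.

(** Injectivity of [c] makes the index of a degree unique, so the cast of the chosen value is
    trivial at [c n]. *)
Lemma fill_sequence (c : nat -> int) (G : forall n, H (c n)) (g0 : forall i, H i) :
  injective c -> exists g : forall i, H i,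
    (forall n, g (c n) = G n) /\ (forall i, (forall n, c n <> i) -> g i = g0 i).
Proof.
move=> c_inj.
exists (fun i => match pselect (exists n, c n = i) with
  | left e => eq_rect _ H (G (proj1_sig (cid e))) i (proj2_sig (cid e))
  | right _ => g0 i end); split=> [n|i ne].
  case: pselect => [e|[]]; last by exists n.
  case: (cid e) => k /= ek; have kn := c_inj _ _ ek; move: ek; rewrite kn => ek.
  by rewrite (Prop_irrelevance ek erefl).
case: pselect => // e; exfalso; case: e => n cn; exact: ne cn.
Qed.

Variables (Q : forall i, H i -> Prop) (R : forall i, H i -> H (i + 1) -> Prop).
Variables (m : int) (g0 : forall i, H i).
Hypothesis Qm : Q (g0 m).

(** [Q] is the invariant that makes the next choice possible. The relation [S] takes two free
    degrees because successive values of [c] need not be convertible to [i] and [i + 1]. *)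
Lemma dependent_choice_seq (c : nat -> int) (S : forall i j, H i -> H j -> Prop) :
  injective c -> c 0 = m ->
  (forall n x, Q x -> exists y : H (c n.+1), Q y /\ S (c n) (c n.+1) x y) ->
  exists g : forall i, H i, [/\ g m = g0 m, (forall i, (forall n, c n <> i) -> g i = g0 i) &
    forall n, S (c n) (c n.+1) (g (c n)) (g (c n.+1))].
Proof.
move=> c_inj c0 step.
have Q0 : Q (g0 (c 0)) by rewrite c0.
pose next n (x : {x : H (c n) | Q x}) : {x : H (c n.+1) | Q x} :=
  let y := cid (step n (sval x) (svalP x)) in exist _ (sval y) (svalP y).1.
pose G := nat_rect (fun n => {x : H (c n) | Q x}) (exist _ _ Q0) next.
have [g [gG g'] ] := fill_sequence (fun n => sval (G n)) g0 c_inj.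
exists g; split=> // [|n]; first by rewrite -c0 gG.
by rewrite !gG /= /next; exact: (svalP (cid (step n (sval (G n)) (svalP (G n))))).2.
Qed.

Lemma int_up :
  (forall i x, m <= i -> Q x -> exists y : H (i + 1), Q y /\ R x y) ->
  exists g : forall i, H i, (forall i, i <= m -> g i = g0 i) /\
    forall i, m <= i -> R (g i) (g (i + 1)).
Proof.
(* Iteration, unlike [m + n], makes [c n.+1] convertible to [c n + 1], so the cast at the end is
   [erefl]. *)
move=> step; pose c n := iter n (fun i : int => i + 1) m.
have cE n : c n = m + n%:Z by elim: n => [|n IHn]; rewrite /= ?addr0 // /c /= -/(c n) IHn; lia.
have c_inj : injective c by move=> a b; rewrite !cE => /addrI [].
have [n x Qx|g [gm g' gR]] := @dependent_choice_seq c
    (fun i j x y => forall e : i + 1 = j, R x (eq_rect_r H y e)) c_inj erefl.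
  have mc : m <= c n by rewrite cE; lia.
  have [y [Qy Ry]] := step (c n) x mc Qx.
  by exists y; split=> // e; rewrite (Prop_irrelevance e erefl).
exists g; split=> [i|i mi].
  rewrite le_eqVlt => /predU1P[->//|im]; apply: g' => n e.
  by move: im; rewrite -e cE; lia.
have [n ->] : exists n, i = c n by exists `|i - m|%N; rewrite cE; lia.
exact: gR n erefl.
Qed.

Lemma int_down :
  (forall i (y : H (i + 1)), i < m -> Q y -> exists x : H i, Q x /\ R x y) ->
  exists g : forall i, H i, (forall i, m <= i -> g i = g0 i) /\
    forall i, i < m -> R (g i) (g (i + 1)).
Proof.
move=> step; pose c n := m - n%:Z.
have c_inj : injective c by move=> a b /addrI /oppr_inj [].
(* Going down, [c n.+1 + 1] and [c n] are equal only by a proof; the step is first stated for any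
   degree [j] equal to [i + 1]. *)
have step' i j (e : i + 1 = j) (y : H j) : i < m -> Q y ->
    exists x : H i, Q x /\ forall e' : i + 1 = j, R x (eq_rect_r H y e').
  case: j / e y => y im Qy; have [x [Qx Rx]] := step i y im Qy.
  by exists x; split=> // e; rewrite (Prop_irrelevance e erefl).
have [n x Qx|g [gm g' gR]] := @dependent_choice_seq c
    (fun j i y x => forall e : i + 1 = j, R x (eq_rect_r H y e)) c_inj (subr0 m).
  by apply: (step' (c n.+1) (c n)) => //; rewrite /c; lia.
exists g; split=> [i|i mi].
  rewrite le_eqVlt => /predU1P[<-//|im]; apply: g' => n e.
  by move: im; rewrite -e /c; lia.
have : forall k j n, k = c n.+1 -> j = c n -> forall e : k + 1 = j, R (g k) (eq_rect_r H (g j) e).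
  by move=> k j n -> ->; apply: gR.
move=> h; pose n := absz (m - (i + 1)%R).
have e1 : i = c n.+1 by rewrite /c /n; lia.
have e2 : i + 1 = c n by rewrite /c /n; lia.
exact: (@h i (i + 1) n e1 e2 erefl).
Qed.

End IntRecursion.

Section ConflationTheory.
Variable E : exactCategory.

Lemma conflation_epi (X Y Z T : E) (f : Hom X Y) (g : Hom Y Z) (a b : Hom Z T) :
  conflation f g -> a ∘ g = b ∘ g -> a = b.
Proof.
move=> /conflation_coker [gf uniq] e.
have [|h [_ hU]] := uniq T (a ∘ g); first by rewrite -compA gf compm0.
by rewrite -(hU a) // -(hU b).
Qed.

Lemma kernel_mono (X Y Z T : E) (f : Hom X Y) (g : Hom Y Z) (a b : Hom T X) :
  is_kernel f g -> f ∘ a = f ∘ b -> a = b.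
Proof.
move=> [gf uniq] e.
have [|h [_ hU]] := uniq T (f ∘ a); first by rewrite compA gf comp0m.
by rewrite -(hU a) // -(hU b).
Qed.

Lemma kernel_factor (X Y Z T : E) (f : Hom X Y) (g : Hom Y Z) (h : Hom T Y) :
  is_kernel f g -> g ∘ h = 0 -> exists h', f ∘ h' = h.
Proof. by move=> [_ uniq] /uniq [h' [e _]]; exists h'. Qed.

Lemma conflation_factor (X Y Z T : E) (f : Hom X Y) (g : Hom Y Z) (h : Hom Y T) :
  conflation f g -> h ∘ f = 0 -> exists h', h' ∘ g = h.
Proof. by move=> /conflation_coker [_ uniq] /uniq [h' [e _]]; exists h'. Qed.

End ConflationTheory.

(** * Extending maps and homotopies degree by degree *)

Section Extension.
Variable F : frobeniusCategory.
Local Notation P := (projectives F).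
Implicit Types A B : complex P.

Lemma P_injective (X : P) : injective_object (sval X).
Proof. by apply/frob_proj_inj; case: X. Qed.

Lemma P_projective (X : P) : projective (sval X).
Proof. by case: X. Qed.

Section Acyclic.
Variables (A : complex P) (Z : int -> F) (k : forall i, Hom (Z i) (sval (A i)))
  (p : forall i, Hom (sval (A i)) (Z (i + 1))).
Hypotheses (k_ker : forall i, @is_kernel F _ _ _ (k i) (dif A i))
  (kp : forall i, k (i + 1) ∘ p i = (dif A i : @Hom F _ _))
  (kp_conf : forall i, conflation (k i) (p i)).

(** A map that kills the cycles factors through Z^{i+1}, and then extends along the inflation of
    Z^{i+1} into A^{i+1} because [B] is injective. *)
Lemma acyclic_extend i (B : P) (x : Hom (A i) B) :
  (x : @Hom F _ _) ∘ k i = 0 -> exists y : Hom (A (i + 1)) B, y ∘ dif A i = x.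
Proof.
move=> xk; have [h hp] := conflation_factor (kp_conf i) xk.
have [|y yk] := P_injective (X := B) (f := k (i + 1)) h.
  by exists (Z (i + 1 + 1)), (p (i + 1)).
exists y; rewrite -[RHS]hp -[h]yk; rewrite [RHS](esym (compA _ _ _)).
by rewrite kp.
Qed.

(** The map lands in the cycles Z^{i+1}, onto which A^i is a deflation; projectivity of [B] lifts
    it. *)
Lemma acyclic_lift i (B : P) (y : Hom B (A (i + 1))) :
  dif A (i + 1) ∘ y = 0 -> exists x : Hom B (A i), dif A i ∘ x = y.
Proof.
move=> dy; have [h kh] := kernel_factor (k_ker (i + 1)) dy.
have [|x px] := @P_projective B _ _ (p i) h.
  by exists (Z i), (k i).
by exists x; rewrite -[RHS]kh -px [RHS]compA kp.
Qed.

(** Cycles come from Z^{i+1}, and the map of A^i to Z^{i+1} is epi: what kills boundaries kills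
    cycles. *)
Lemma acyclic_cycle i (T : F) (B : P) (x : Hom (A (i + 1)) B) (t : Hom T (sval (A (i + 1)))) :
  x ∘ dif A i = 0 -> (dif A (i + 1) : @Hom F _ _) ∘ t = 0 -> (x : @Hom F _ _) ∘ t = 0.
Proof.
move=> xd dt; have [t' <-] := kernel_factor (k_ker (i + 1)) dt.
apply: (@reassoc0 F); apply: (conflation_epi (kp_conf i)).
by rewrite comp0m -compA kp.
Qed.

End Acyclic.

(** The test objects range over all of F: the cycle objects to which it is applied need not be
    projective. *)
Definition kills_cycles (X X' Y Y' : F) (d : Hom X X') (x : Hom X Y) (d' : Hom Y Y') : Prop :=
  forall T (t : Hom T X), d ∘ t = 0 -> d' ∘ (x ∘ t) = 0.

Lemma sel_map_ex (C : additive) (b : bool) (X Y : C)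
    (y : Hom (if b then X else zero C) (if b then Y else zero C)) :
  exists x : Hom X Y, sel_map b b x = y.
Proof.
case: b y => y; [by exists y | exists 0].
by rewrite /= -[y]compm1 (_ : idm (zero C) = 0) ?compm0 //; apply: zero_is_zero.
Qed.

Lemma sel_map_cond (C : additive) (b : bool) (X Y : C) (f g : Hom X Y) :
  (b -> f = g) -> sel_map b b f = sel_map b b g.
Proof. by case: b => // ->. Qed.

Lemma trunc_components (A B : complex P) (q : pred int) (f : cmap (trunc q A) (trunc q B)) :
  exists g0 : forall i, Hom (A i) (B i),
    (forall i, q i -> q (i + 1) -> g0 (i + 1) ∘ dif A i = dif B i ∘ g0 i) /\
    forall g : cmap A B, (forall i, q i -> g i = g0 i) -> trunc_map q g = f.
Proof.
pose g0 i : Hom (A i) (B i) := sval (cid (sel_map_ex (f i))).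
have g0E i : sel_map (q i) (q i) (g0 i) = f i := svalP (cid (sel_map_ex (f i))).
exists g0; split=> [i qi qi1|g gg0].
  have := cmap_dif f i; rewrite -!g0E !trunc_difE /= /trunc_ob.
  by rewrite qi qi1.
apply: cmap_ext => i; rewrite -g0E.
exact: (@sel_map_cond P (q i) _ _ (g i) (g0 i) (@gg0 i)).
Qed.

(* Extending to the right uses that the terms of [B] are injective; extending to the
   left uses that the terms of [A] are projective. *)
Lemma extend_right (A B : complex P) m (f : cmap (trunc_le m A) (trunc_le m B)) :
  acyclic A -> exists g : cmap A B, trunc_map (fun i => i <= m) g = f.
Proof.
move=> [Z [k [p h]]].
have k_ker i : @is_kernel F _ _ _ (k i) (dif A i) by case: (h i).
have kp i : k (i + 1) ∘ p i = (dif A i : @Hom F _ _) by case: (h i).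
have kp_conf i : conflation (k i) (p i) by case: (h i).
have [g0 [g0_dif g0_trunc]] := trunc_components f.
pose Q i (x : Hom (A i) (B i)) :=
  @kills_cycles (sval (A i)) (sval (A (i + 1))) (sval (B i)) (sval (B (i + 1)))
    (dif A i) x (dif B i).
have Q_next i (x : Hom (A i) (B i)) (y : Hom (A (i + 1)) (B (i + 1))) :
    y ∘ dif A i = dif B i ∘ x -> @Q _ y.
  move=> yx T t dt; rewrite [LHS](@compA F).
  apply: (acyclic_cycle k_ker kp kp_conf (x := dif B (i + 1) ∘ y)) => //.
  by rewrite -compA yx compA dif_dif comp0m.
(* The invariant at the starting degree comes from the square between [m - 1] and [m], which still
   lies inside the truncation. *)
have Qm : @Q m (g0 m).
  have [j mj] : exists j, m = j + 1 by exists (m - 1); lia.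
  move: g0_dif; rewrite {}mj => g0_dif; apply: (@Q_next j (g0 j)).
  by apply: g0_dif; lia.
have [i x mi Qx|g [gm gR]] := int_up (R := fun i x y => y ∘ dif A i = dif B i ∘ x) Qm.
  have [|y yx] := acyclic_extend kp kp_conf (x := dif B i ∘ x).
    by rewrite -[LHS](@compA F); apply: Qx; case: (k_ker i).
  by exists y; split=> //; apply: Q_next yx.
have gd i : g (i + 1) ∘ dif A i = dif B i ∘ g i.
  have [/gR //|im] := leP m i.
  by rewrite !gm ?g0_dif //; lia.
by exists (CMap gd); apply: g0_trunc.
Qed.

Lemma extend_left (A B : complex P) n (f : cmap (trunc_ge n A) (trunc_ge n B)) :
  acyclic B -> exists g : cmap A B, trunc_map (fun i => n <= i) g = f.
Proof.
move=> [Z [k [p h]]].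
have k_ker i : @is_kernel F _ _ _ (k i) (dif B i) by case: (h i).
have kp i : k (i + 1) ∘ p i = (dif B i : @Hom F _ _) by case: (h i).
have kp_conf i : conflation (k i) (p i) by case: (h i).
have [g0 [g0_dif g0_trunc]] := trunc_components f.
pose Q i (x : Hom (A i) (B i)) := forall (T : P) (t : Hom T (A i)),
  dif A i ∘ t = 0 -> dif B i ∘ (x ∘ t) = 0.
have Qn : @Q n (g0 n).
  by move=> T t dt; rewrite compA -g0_dif -?compA ?dt ?compm0 //; lia.
have [i y ni Qy|g [gn gR]] := int_down (R := fun i x y => y ∘ dif A i = dif B i ∘ x) Qn.
  have [x xy] := acyclic_lift k_ker kp kp_conf (Qy _ _ (dif_dif A i)).
  by exists x; split=> // T t dt; rewrite compA xy -compA dt compm0.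
have gd i : g (i + 1) ∘ dif A i = dif B i ∘ g i.
  have [ni|/gR //] := leP n i.
  by rewrite !gn ?g0_dif //; lia.
by exists (CMap gd); apply: g0_trunc.
Qed.

(** The homotopy is zero far to the left and is built upwards by injectivity of the terms of [B];
    the invariant says that the remaining error kills the cycles of [A]. *)
Lemma acyclic_to_bounded_below (A B : complex P) (f : cmap A B) :
  acyclic A -> bounded_below B -> kcls f = 0.
Proof.
move=> [Z [k [p h]]] [n B0].
have k_ker i : @is_kernel F _ _ _ (k i) (dif A i) by case: (h i).
have kp i : k (i + 1) ∘ p i = (dif A i : @Hom F _ _) by case: (h i).
have kp_conf i : conflation (k i) (p i) by case: (h i).
have B0' i T (x y : Hom T (B i)) : i < n -> x = y.
  by move=> /B0 Bi; rewrite -[x]comp1m -[y]comp1m Bi !comp0m.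
(* Two below the bound: the error in [Q m] is a map into [B (m + 1)], which is [B (n - 1)] and hence
   zero. *)
pose m := n - 2.
pose Q i (s : Hom (A (i + 1)) (B i)) := forall T (t : @Hom F T (sval (A (i + 1)))),
  (dif A (i + 1) : @Hom F _ _) ∘ t = 0 -> (f (i + 1) - dif B i ∘ s : @Hom F _ _) ∘ t = 0.
have Q0 : @Q m 0.
  move=> T t _; have -> : f (m + 1) - dif B m ∘ 0 = 0 by apply: B0'; rewrite /m; lia.
  exact: (@comp0m F).
have [i s mi Qs|s [sm sR]] := int_up (H := fun i => Hom (A (i + 1)) (B i))
  (R := fun i s s' => f (i + 1) = dif B i ∘ s + s' ∘ dif A (i + 1)) (g0 := fun=> 0) Q0.
  have [|s' s'E] := acyclic_extend kp kp_conf (x := f (i + 1) - dif B i ∘ s).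
    by apply: Qs; case: (k_ker (i + 1)).
  exists s'; split; last by rewrite s'E; zmod.
  move=> T t dt.
  apply: (acyclic_cycle k_ker kp kp_conf (x := f (i + 1 + 1) - dif B (i + 1) ∘ s')) => //.
  rewrite compDl compNm -compA s'E compDr compmN compA dif_dif comp0m cmap_dif.
  by zmod.
apply: (@null_by _ _ _ _ s) => i.
have [/sR //|im] := leP m i.
by apply: B0'; move: im; rewrite /m; lia.
Qed.

(** Built downwards from zero by projectivity of the terms of [A]; the invariant says that the error
    lands in the cycles of [B]. *)
Lemma bounded_above_to_acyclic (A B : complex P) (f : cmap A B) :
  bounded_above A -> acyclic B -> kcls f = 0.
Proof.
move=> [n A0] [Z [k [p h]]].
have k_ker i : @is_kernel F _ _ _ (k i) (dif B i) by case: (h i).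
have kp i : k (i + 1) ∘ p i = (dif B i : @Hom F _ _) by case: (h i).
have kp_conf i : conflation (k i) (p i) by case: (h i).
have A0' i T (x y : Hom (A i) T) : n < i -> x = y.
  by move=> /A0 Ai; rewrite -[x]compm1 -[y]compm1 Ai !compm0.
pose Q i (s : Hom (A (i + 1)) (B i)) := dif B i ∘ (f i - s ∘ dif A i) = 0.
have Q0 : @Q (n + 1) 0 by apply: A0'; lia.
have [i s ni Qs|s [sn sR]] := int_down (H := fun i => Hom (A (i + 1)) (B i))
  (R := fun i s s' => f (i + 1) = dif B i ∘ s + s' ∘ dif A (i + 1)) (g0 := fun=> 0) Q0.
  have [s' s'E] := acyclic_lift k_ker kp kp_conf Qs.
  exists s'; split; last by rewrite s'E; zmod.
  by rewrite /Q compDr compmN compA s'E compDl compNm -compA dif_dif compm0 cmap_dif; zmod.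
apply: (@null_by _ _ _ _ s) => i.
have [ni|/sR //] := leP (n + 1) i.
by apply: A0'; lia.
Qed.

End Extension.

(** * Cones of complexes that are exact far away *)

Section ComplexEquality.
Variable A : preadditive.

(** [infty_b] compares truncations by equality of complexes, so differentials between
    propositionally equal terms have to be compared through casts. *)
Definition hcast (X X' Y Y' : A) (a : X = X') (b : Y = Y') (f : Hom X Y) : Hom X' Y' :=
  match a in _ = X1, b in _ = Y1 return Hom X1 Y1 with erefl, erefl => f end.

Lemma hcast_id (X Y : A) (a : X = X) (b : Y = Y) (f : Hom X Y) : hcast a b f = f.
Proof. by rewrite (Prop_irrelevance a erefl) (Prop_irrelevance b erefl). Qed.

Lemma hcastN (X X' Y Y' : A) (a : X = X') (b : Y = Y') (f : Hom X Y) :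
  hcast a b (- f) = - hcast a b f.
Proof. by case: X' / a; case: Y' / b. Qed.

Lemma complex_eq (X X' : complex A) : (forall i, X i = X' i) ->
  (forall i (a : X i = X' i) (b : X (i + 1) = X' (i + 1)), hcast a b (dif X i) = dif X' i) ->
  X = X'.
Proof.
case: X X' => [o d dd] [o' d' dd'] /= e; have {}e : o = o' by apply: funext.
case: o' / e d' dd' => d' dd' dE; apply: complex_ext => i.
by rewrite -(dE i erefl erefl).
Qed.

Lemma complex_eq_dif (X X' : complex A) i (a : X i = X' i) (b : X (i + 1) = X' (i + 1)) :
  X = X' -> hcast a b (dif X i) = dif X' i.
Proof. by move=> e; case: X' / e a b => a b; rewrite hcast_id. Qed.

Lemma shift_inj : injective (@shift A).
Proof.
move=> X Y e; apply: complex_eq => [|].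
  by elim/succ_ind => i; exact: (congr1 (fun Z : complex A => Z i) e).
elim/succ_ind => i a b; apply: oppr_inj; rewrite -hcastN.
exact: (complex_eq_dif (X := shift X) (X' := shift Y) a b e).
Qed.

(** On the nose, not only up to isomorphism. Replacing the family of objects by [o' (i + 1)] through
    function extensionality avoids casting the differentials. *)
Lemma shift_surj (X : complex A) : exists X', shift X' = X.
Proof.
case: X => o d dd.
pose o' i := o (i - 1).
have oE : (fun i => o' (i + 1)) = o by apply: funext => i; rewrite /o' addrK.
clearbody o'; case: o / oE d dd => d dd.
have [d' dE] := @succ_fun (fun i => Hom (o' i) (o' (i + 1))) (fun i => - d i).
have dd' i : d' (i + 1) ∘ d' i = 0.
  by elim/succ_ind: i => i; rewrite !dE compNm compmN opprK dd.
exists (Complex dd'); apply: (@complex_ext A (fun i => o' (i + 1))) => i /=.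
by rewrite dE opprK.
Qed.

End ComplexEquality.

Section TruncEquality.
Variable A : additive.
Implicit Types X Y : complex A.

Lemma trunc_trunc (p q : pred int) X :
  trunc p (trunc q X) = trunc (fun i => p i && q i) X.
Proof.
apply: complex_eq => [i|i]; first by rewrite /= /trunc_ob /= /trunc_ob; case: (p i).
rewrite /= /trunc_dif /trunc_ob /= /trunc_dif /trunc_ob.
by case: (p i); case: (p (i + 1)); case: (q i); case: (q (i + 1)) => /= a b; rewrite hcast_id.
Qed.

Lemma trunc_sub (p q : pred int) X Y : (forall i, p i -> q i) ->
  trunc q X = trunc q Y -> trunc p X = trunc p Y.
Proof.
move=> pq e; have pE : p = (fun i => p i && q i).
  by apply: funext => i; have := pq i; case: (p i) => // ->.
by rewrite pE -trunc_trunc e trunc_trunc.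
Qed.

(** Degree [i] of a cone reads X^{i+1} and Y^i, hence the two degrees demanded of [q]. *)
Lemma trunc_cone_eq (p q : pred int) X Y (f : cmap X Y) :
  (forall i, p i -> q i /\ q (i + 1)) ->
  trunc p (cone f) = trunc p (cone (trunc_map q f)).
Proof.
move=> pq; apply: complex_eq => [i|i].
  rewrite /= /trunc_ob /= /cone_ob /= /trunc_ob; have := pq i.
  by case: (p i) => // /(_ isT) [-> ->].
rewrite /= /trunc_dif /trunc_ob /= /cone_dif /cone_ob /= /trunc_dif /trunc_ob.
have := pq i; have := pq (i + 1).
case: (p i); case: (p (i + 1)); case: (q i); case: (q (i + 1)); case: (q (i + 1 + 1)) => /=
  h1 h2 a b; rewrite ?hcast_id //;
  by [case: (h1 isT) | case: (h2 isT)].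
Qed.

End TruncEquality.

(** * Cycles of a mapping cone *)

Section CyclesOfCones.
Variable F : frobeniusCategory.
Local Notation P := (projectives F).
Implicit Types X Y : complex P.

Section Exact.
Variable E : exactCategory.

Lemma kernel_iso (X X' Y Z : E) (k : Hom X Y) (k' : Hom X' Y) (g : Hom Y Z) :
  is_kernel k g -> is_kernel k' g -> exists a : Hom X X', is_iso a /\ k' ∘ a = k.
Proof.
move=> kg kg'; have [a ka] := kernel_factor kg' kg.1; have [b kb] := kernel_factor kg kg'.1.
exists a; split=> //; exists b; split.
  by apply: (kernel_mono kg); rewrite compA kb ka compm1.
by apply: (kernel_mono kg'); rewrite compA ka kb compm1.
Qed.

Lemma conflation_of_kernel (X X' Y Z : E) (k : Hom X Y) (k' : Hom X' Y) (g : Hom Y Z) :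
  conflation k g -> is_kernel k' g -> conflation k' g.
Proof.
move=> c kg'; have [a [ia ka]] := kernel_iso (conflation_ker c) kg'.
apply: (conflation_iso (a := a) (b := idm Y) (c := idm Z)) c => //; try exact: is_iso_id.
  by rewrite comp1m ka.
by rewrite comp1m compm1.
Qed.

Lemma deflation_iso_comp (X Y Z : E) (g : Hom Y Z) (s : Hom X Y) :
  is_iso s -> deflation g -> deflation (g ∘ s).
Proof.
move=> [t [ts st]] [X0 [k c]]; exists X0, (t ∘ k).
apply: (conflation_iso (a := idm _) (b := t) (c := idm Z)) c; try exact: is_iso_id.
- by exists s.
- by rewrite compm1.
- by rewrite comp1m -compA st compm1.
Qed.

Lemma deflationN (Y Z : E) (g : Hom Y Z) : deflation g -> deflation (- g).
Proof.
move=> [X0 [k c]]; exists X0, k.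
apply: (conflation_iso (a := idm _) (b := idm _) (c := - idm Z)) c; try exact: is_iso_id.
- by exists (- idm Z); rewrite compNm compmN opprK comp1m.
- by rewrite compm1 comp1m.
- by rewrite compNm comp1m compm1.
Qed.

Lemma pullback_ext (X Y X' Y' T : E) (f : Hom X Y) (a : Hom X X') (b : Hom Y Y')
    (f' : Hom X' Y') (w w' : Hom T X) :
  is_pullback f a b f' -> f ∘ w = f ∘ w' -> a ∘ w = a ∘ w' -> w = w'.
Proof.
move=> [e univ] fw aw; have [|v [_ vU]] := univ T (f ∘ w') (a ∘ w').
  by rewrite !compA e.
by rewrite -(vU w) // -(vU w').
Qed.

Lemma kernel_of_comp (X Y Z T : E) (k : Hom X Y) (g : Hom Y Z) (h : Hom Z T) :
  is_kernel k (h ∘ g) -> g ∘ k = 0 -> is_kernel k g.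
Proof. by move=> [_ univ] gk; split=> // S t gt; apply: univ; rewrite -compA gt compm0. Qed.

(** The axiom provides one pullback with a deflation; any other pullback of the same data differs
    from it by an isomorphism. *)
Lemma deflation_of_pullback (X Y X' Y' : E) (f : Hom X Y) (a : Hom X X')
    (b : Hom Y Y') (f' : Hom X' Y') :
  is_pullback f a b f' -> deflation f' -> deflation f.
Proof.
move=> [e univ] /(deflation_pullback b) [X0 [f0 [a0 [[e0 univ0] df0]]]].
have [s [[fs as_] _]] := univ0 _ _ _ e; have [t [[ft at_] _]] := univ _ _ _ e0.
rewrite -fs; apply: deflation_iso_comp => //; exists t; split.
  have [w [_ wU]] := univ _ _ _ e.
  by rewrite -(wU (idm X)) ?compm1 // (wU (t ∘ s)) // !compA ft at_.
have [w [_ wU]] := univ0 _ _ _ e0.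
by rewrite -(wU (idm X0)) ?compm1 // (wU (s ∘ t)) // !compA fs as_.
Qed.

(* In matrix form: [X1 (+) Y0 -> X2 (+) Y1 -> X3 (+) Y2] is a piece of the cone of
   [f]. Its cycles are the pullbacks of the cycles of [X] and of the deflations of
   the components of [Y] onto the cycles of [Y]. *)
Section ConePiece.
Variables (X1 X2 X3 Y0 Y1 Y2 Y3 : E) (dx1 : Hom X1 X2) (dx2 : Hom X2 X3)
  (dy0 : Hom Y0 Y1) (dy1 : Hom Y1 Y2) (dy2 : Hom Y2 Y3)
  (f1 : Hom X1 Y1) (f2 : Hom X2 Y2) (f3 : Hom X3 Y3).
Hypotheses (e1 : f2 ∘ dx1 = dy1 ∘ f1) (e2 : f3 ∘ dx2 = dy2 ∘ f2).
Variables (D0 : Hom (bip X1 Y0) (bip X2 Y1)) (D1 : Hom (bip X2 Y1) (bip X3 Y2)).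
Hypotheses (pD0 : prl _ _ ∘ D0 = - dx1 ∘ prl _ _)
  (rD0 : prr _ _ ∘ D0 = f1 ∘ prl _ _ + dy0 ∘ prr _ _)
  (pD1 : prl _ _ ∘ D1 = - dx2 ∘ prl _ _)
  (rD1 : prr _ _ ∘ D1 = f2 ∘ prl _ _ + dy1 ∘ prr _ _).
Variables (Z Z1 W1 W2 : E) (k : Hom Z X1) (k1 : Hom Z1 X2) (p : Hom X1 Z1)
  (q : Hom Y0 W1) (l1 : Hom W1 Y1) (q1 : Hom Y1 W2) (l2 : Hom W2 Y2).
Hypotheses (kK : is_kernel k dx1) (k1K : is_kernel k1 dx2) (k1p : k1 ∘ p = dx1)
  (kp : conflation k p).
Hypotheses (l1K : is_kernel l1 dy1) (l2K : is_kernel l2 dy2) (l1q : l1 ∘ q = dy0)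
  (l2q1 : l2 ∘ q1 = dy1) (q_defl : deflation q) (q1_defl : deflation q1).

(** A pair (x, y) is a cycle when x = [k0 ∘ c] and d y = - g x. As [l] is mono, the second equation
    reads [q0 ∘ y = - z ∘ c], which explains the sign in the pullback. *)
Lemma cone_kernel (X X' Y Y' Z0 W T : E) (dx : Hom X X') (dy : Hom Y' W) (d : Hom Y Y')
    (g : Hom X Y') (D : Hom (bip X Y) (bip X' Y')) (k0 : Hom Z0 X) (l : Hom T Y')
    (q0 : Hom Y T) (z : Hom Z0 T) (E0 : E) (a : Hom E0 Z0) (b : Hom E0 Y) :
  prl _ _ ∘ D = - dx ∘ prl _ _ -> prr _ _ ∘ D = g ∘ prl _ _ + d ∘ prr _ _ ->
  is_kernel k0 dx -> is_kernel l dy -> l ∘ q0 = d -> l ∘ z = g ∘ k0 ->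
  is_pullback a b (- z) q0 ->
  is_kernel (inl _ _ ∘ (k0 ∘ a) + inr _ _ ∘ b) D.
Proof.
move=> pD rD k0K lK lq lz [zq univ]; split.
  apply: bip_ext; rewrite compm0 compA ?pD ?rD.
    rewrite -compA [X in _ ∘ X]compDr prl_inlK prl_inrK addr0.
    by rewrite compNm (reassoc0 k0K.1) oppr0.
  rewrite compDl -!compA !compDr prl_inlK prl_inrK prr_inlK prr_inrK !compm0 addr0 add0r.
  by rewrite compA -lz -lq -!compA -zq compNm compmN subrr.
move=> S h Dh.
have xh : dx ∘ (prl _ _ ∘ h) = 0.
  by apply: oppr_inj; rewrite oppr0 -compNm compA -pD -compA Dh compm0.
have [c kc] := kernel_factor k0K xh.
have yh : q0 ∘ (prr _ _ ∘ h) = - z ∘ c.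
  apply: (kernel_mono lK); rewrite compA lq compNm compmN (reassoc lz) -compA kc.
  have : prr _ _ ∘ (D ∘ h) = 0 by rewrite Dh compm0.
  by rewrite compA rD compDl -!compA => e; apply: (zmod_from e); zmod.
have [w [[aw bw] wU]] := univ _ _ _ (esym yh).
exists w; split; first by apply: bip_ext; rewrite compDl compDr -!compA
  ?(prl_inlK, prl_inrK, prr_inlK, prr_inrK) ?addr0 ?add0r ?aw ?bw.
move=> w' ew'; apply: wU; split.
  apply: (kernel_mono k0K); rewrite kc -ew' compDl compDr -!compA prl_inlK prl_inrK.
  by rewrite addr0.
by rewrite -ew' compDl compDr -!compA prr_inlK prr_inrK add0r.
Qed.

(** The differential factors through the cycles [E1] as [m ∘ n]. Here [n] replaces [Y0] by the
    cycles [W1] along the deflation [q], and [m] is a pullback of [- p]. Both are deflations, hence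
    so is the composite. *)
Lemma cone_piece : exists (E0 E1 : E) (e : Hom E0 (bip X1 Y0)) (e' : Hom E1 (bip X2 Y1))
    (r : Hom (bip X1 Y0) E1),
  [/\ is_kernel e D0, is_kernel e' D1, e' ∘ r = D0 & conflation e r].
Proof.
have [z lz] : exists z, l1 ∘ z = f1 ∘ k.
  by apply: (kernel_factor l1K); rewrite compA -e1 -compA kK.1 compm0.
have [z1 lz1] : exists z1, l2 ∘ z1 = f2 ∘ k1.
  by apply: (kernel_factor l2K); rewrite compA -e2 -compA k1K.1 compm0.
have z1p : z1 ∘ p = q1 ∘ f1.
  by apply: (kernel_mono l2K); rewrite compA lz1 -compA k1p e1 compA l2q1.
have q1l1 : q1 ∘ l1 = 0.
  by apply: (kernel_mono l2K); rewrite compA l2q1 l1K.1 compm0.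
have [E0 [a [b [pb a_defl]]]] := deflation_pullback (- z) q_defl.
have [E1 [a1 [b1 [pb1 a1_defl]]]] := deflation_pullback (- z1) q1_defl.
have e0K := cone_kernel pD0 rD0 kK l1K l1q lz pb.
have e1K := cone_kernel pD1 rD1 k1K l2K l2q1 lz1 pb1.
have [m [[am bm] _]] : exists! m : Hom (bip X1 W1) E1,
    a1 ∘ m = - p ∘ prl _ _ /\ b1 ∘ m = f1 ∘ prl _ _ + l1 ∘ prr _ _.
  apply: pb1.2; rewrite !compNm compmN opprK compA z1p compDr !compA q1l1.
  by rewrite comp0m addr0.
(* Given a cycle and a lift of its [X]-part along [- p], the rest of its [Y]-part is a cycle, so
   comes from a unique map to [W1]. *)
have m_defl : deflation m.
  apply: (@deflation_of_pullback _ _ _ _ m (prl _ _) a1 (- p)); last first.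
    by apply: deflationN; exists Z, k.
  split=> // T u v uv.
  have [w2 lw2] : exists w2, l1 ∘ w2 = b1 ∘ u - f1 ∘ v.
    have q1K : is_kernel l1 q1 by apply: (kernel_of_comp (h := l2)); rewrite ?l2q1.
    apply: (kernel_factor q1K); rewrite compDr compmN !compA -pb1.1 -z1p -!compA uv.
    by rewrite compNm compNm compmN opprK subrr.
  exists (inl _ _ ∘ v + inr _ _ ∘ w2); split.
    split; last by rewrite compDr prl_inlK prl_inrK addr0.
    apply: (pullback_ext pb1); rewrite compA ?am ?bm.
      by rewrite compDr -!compA prl_inlK prl_inrK compm0 addr0 uv.
    rewrite compDl -!compA !compDr prl_inlK prl_inrK prr_inlK prr_inrK !compm0 addr0 add0r.
    by rewrite lw2 addrC subrK.
  move=> w [mw pw]; apply: bip_ext; rewrite compDr ?prl_inlK ?prl_inrK ?prr_inlK ?prr_inrK.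
    by rewrite addr0 pw.
  rewrite add0r; apply: (kernel_mono l1K); rewrite lw2 -mw compA bm compDl -!compA pw.
  by zmod.
pose n : Hom (bip X1 Y0) (bip X1 W1) := inl _ _ ∘ prl _ _ + inr _ _ ∘ (q ∘ prr _ _).
have pn : prl _ _ ∘ n = prl _ _ by rewrite compDr prl_inlK prl_inrK addr0.
have rn : prr _ _ ∘ n = q ∘ prr _ _ by rewrite compDr prr_inlK prr_inrK add0r.
have n_defl : deflation n.
  apply: (@deflation_of_pullback _ _ _ _ n (prr _ _) (prr _ _) q) => //; split=> // T u v uv.
  exists (inl _ _ ∘ (prl _ _ ∘ u) + inr _ _ ∘ v); split.
    split; last by rewrite compDr prr_inlK prr_inrK add0r.
    apply: bip_ext; rewrite compA ?pn ?rn -?compA compDr ?prl_inlK ?prl_inrK ?prr_inlK ?prr_inrK.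
      by rewrite addr0.
    by rewrite add0r uv.
  move=> w [nw rw]; apply: bip_ext; rewrite compDr ?prl_inlK ?prl_inrK ?prr_inlK ?prr_inrK.
    by rewrite addr0 -nw compA pn.
  by rewrite add0r rw.
have er : (inl _ _ ∘ (k1 ∘ a1) + inr _ _ ∘ b1) ∘ (m ∘ n) = D0.
  apply: bip_ext; rewrite compA compDr ?prl_inlK ?prl_inrK ?prr_inlK ?prr_inrK.
    by rewrite addr0 pD0 -!compA (reassoc am) -compA pn compA compmN k1p.
  by rewrite add0r rD0 (reassoc bm) compDl -!compA pn rn (reassoc l1q).
have [X0 [x0 c0]] := deflation_comp m_defl n_defl.
exists E0, E1, (inl _ _ ∘ (k ∘ a) + inr _ _ ∘ b).
exists (inl _ _ ∘ (k1 ∘ a1) + inr _ _ ∘ b1), (m ∘ n).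
split=> //; apply: (conflation_of_kernel c0); split.
  by apply: (kernel_mono e1K); rewrite compm0 compA er e0K.1.
move=> T h rh; apply: e0K.2; by rewrite -er -compA rh compm0.
Qed.

End ConePiece.
End Exact.

Local Notation "d[ X , i ]" := (dif X i : @Hom F (sval (X i)) (sval (X (i + 1))))
  (at level 0, format "d[ X ,  i ]").

(** Kernels are chosen independently in each degree, so a cone can be treated one degree at a time;
    [acyclicP] makes the choices coherent. *)
Definition acyclic_at X i : Prop :=
  exists (Z Z' : F) (k : Hom Z (sval (X i))) (k' : Hom Z' (sval (X (i + 1))))
    (p : Hom (sval (X i)) Z'),
    [/\ is_kernel k d[X, i], is_kernel k' d[X, i + 1], k' ∘ p = d[X, i] & conflation k p].

Lemma acyclicP X : acyclic X <-> forall i, acyclic_at X i.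
Proof.
split=> [[Z [k [p h]]] i|h].
  by exists (Z i), (Z (i + 1)), (k i), (k (i + 1)), (p i); case: (h i); case: (h (i + 1)).
have hk i : exists Z : F, exists k : Hom Z (sval (X i)), is_kernel k d[X, i].
  by have [Z [Z' [k [k' [p [? _ _ _]]]]]] := h i; exists Z, k.
pose Z i := sval (cid (hk i)).
pose k i : Hom (Z i) (sval (X i)) := sval (cid (svalP (cid (hk i)))).
have kP i : is_kernel (k i) d[X, i] := svalP (cid (svalP (cid (hk i)))).
have hp i : exists p : Hom (sval (X i)) (Z (i + 1)),
    k (i + 1) ∘ p = d[X, i] /\ conflation (k i) p.
  have [Z0 [Z1 [k0 [k1 [p [k0P k1P e c]]]]]] := h i.
  have [a [ia ka]] := kernel_iso k0P (kP i).
  have [b [ib kb]] := kernel_iso k1P (kP (i + 1)).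
  exists (b ∘ p); split; first by rewrite compA kb.
  apply: (conflation_iso (a := a) (b := idm _) (c := b)) c => //; try exact: is_iso_id.
    by rewrite comp1m ka.
  by rewrite compm1.
exists Z, k, (fun i => sval (cid (hp i))) => d i; have [e c] := svalP (cid (hp i)).
by split.
Qed.

Lemma acyclic_at_cone X Y (f : cmap X Y) i :
  acyclic_at X (i + 1) -> acyclic_at Y i -> acyclic_at Y (i + 1) -> acyclic_at (cone f) i.
Proof.
move=> [Z [Z1 [k [k1 [p [kK k1K k1p kp]]]]]] [W [W1 [l [l1 [q [lK l1K l1q lq]]]]]].
move=> [W1' [W2 [l1' [l2 [q1 [l1K' l2K l2q1 lq1]]]]]].
have [E0 [E1 [e [e' [r [h1 h2 h3 h4]]]]]] := @cone_piece F
  (sval (X (i + 1))) (sval (X (i + 1 + 1))) (sval (X (i + 1 + 1 + 1)))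
  (sval (Y i)) (sval (Y (i + 1))) (sval (Y (i + 1 + 1))) (sval (Y (i + 1 + 1 + 1)))
  (dif X (i + 1)) (dif X (i + 1 + 1)) (dif Y i) (dif Y (i + 1)) (dif Y (i + 1 + 1))
  (f (i + 1)) (f (i + 1 + 1)) (f (i + 1 + 1 + 1))
  (cmap_dif f (i + 1)) (cmap_dif f (i + 1 + 1))
  (dif (cone f) i) (dif (cone f) (i + 1))
  (prl_cone_dif f i) (prr_cone_dif f i) (prl_cone_dif f (i + 1)) (prr_cone_dif f (i + 1))
  Z Z1 W1 W2 k k1 p q l1 q1 l2 kK k1K k1p kp l1K l2K l1q l2q1
  (ex_intro _ W (ex_intro _ l lq)) (ex_intro _ W1' (ex_intro _ l1' lq1)).
by exists E0, E1, e, e', r.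
Qed.

Lemma acyclic_cone X Y (f : cmap X Y) : acyclic X -> acyclic Y -> acyclic (cone f).
Proof. by move=> /acyclicP aX /acyclicP aY; apply/acyclicP => i; apply: acyclic_at_cone. Qed.

Lemma acyclic_zero X : (forall i, is_zero (X i)) -> acyclic X.
Proof.
move=> X0.
(* A conflation of zero objects: the identity of the zero object is an inflation, and its cokernel
   is zero. *)
have [Z [g c]] : inflation (idm (zero F)) by apply: inflation_id.
have z0 (U V : F) (a b : Hom U V) : is_zero U \/ is_zero V -> a = b.
  by case=> h; [rewrite -[a]compm1 -[b]compm1 h !compm0 | rewrite -[a]comp1m -[b]comp1m h !comp0m].
have Z0 : is_zero Z.
  apply: (conflation_epi c); apply: z0; left; apply: zero_is_zero.
have iso0 (U V : F) : is_zero U -> is_zero V -> is_iso (0 : Hom U V).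
  by move=> U0 V0; exists 0; split; apply: z0; left.
have XF i : @is_zero F (sval (X i)) by apply: X0.
have ker0 i : is_kernel (0 : @Hom F (zero F) (sval (X i))) (dif X i).
  split; first by apply: z0; left; apply: zero_is_zero.
  move=> T h _; exists 0; split; first by apply: z0; right; apply: XF.
  by move=> h' _; apply: z0; right; apply: zero_is_zero.
exists (fun=> zero F), (fun=> 0), (fun=> 0) => d i; split; first exact: ker0.
  by apply: z0; left; apply: XF.
apply: (conflation_iso (a := 0) (b := 0) (c := 0)) c; try (by apply: iso0; first
  [apply: zero_is_zero | apply: XF | apply: Z0]);
  by apply: z0; left; apply: zero_is_zero.
Qed.

(** * Complexes that are acyclic far to one side *)

Section InftyB.
Let le (n : int) := fun i : int => i <= n.
Let ge (n : int) := fun i : int => n <= i.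

Definition left_acyclic X := exists m Y, acyclic Y /\ trunc_le m X = trunc_le m Y.
Definition right_acyclic X := exists n Y, acyclic Y /\ trunc_ge n X = trunc_ge n Y.

Lemma trunc_le_le m m' X Y : m' <= m -> trunc_le m X = trunc_le m Y ->
  trunc_le m' X = trunc_le m' Y.
Proof. by move=> mm; apply: trunc_sub => i; lia. Qed.

Lemma trunc_ge_ge m m' X Y : m <= m' -> trunc_ge m X = trunc_ge m Y ->
  trunc_ge m' X = trunc_ge m' Y.
Proof. by move=> mm; apply: trunc_sub => i; lia. Qed.

Lemma infty_bP X : infty_b X <-> left_acyclic X /\ right_acyclic X.
Proof.
split=> [[m [n [_ [Y [Y' [aY aY' e e']]]]]]|[[m [Y [aY e]]] [n [Y' [aY' e']]]]].
  by split; [exists m, Y | exists n, Y'].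
exists (Num.min m n), n; split; first by rewrite ge_min lexx orbT.
exists Y, Y'; split=> //; apply: trunc_le_le e.
by rewrite ge_min lexx.
Qed.

(** On a common truncation [f] is a map between truncated acyclic complexes, which [extend_right]
    extends to acyclic complexes. The bound drops by one since degree [i] of the cone reads
    X^{i+1}. *)
Lemma left_acyclic_cone X Y (f : cmap X Y) :
  left_acyclic X -> left_acyclic Y -> left_acyclic (cone f).
Proof.
move=> [m [X' [aX eX]]] [m' [Y' [aY eY]]].
pose n := Num.min m m'.
have {eX} eX : trunc_le n X = trunc_le n X' by apply: trunc_le_le eX; rewrite ge_min lexx.
have {eY} eY : trunc_le n Y = trunc_le n Y' by apply: trunc_le_le eY; rewrite ge_min lexx orbT.
(* The truncated complexes are generalized so that the equations between them can be substituted. *)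
have ext C D (eC : C = trunc_le n X') (eD : D = trunc_le n Y') (h : cmap C D) :
    exists g : cmap X' Y', trunc_le (n - 1) (cone h) = trunc_le (n - 1) (cone g).
  subst C; subst D.
  have [g gh] := extend_right h aX; exists g.
  rewrite [RHS](@trunc_cone_eq _ _ (le n)); first by rewrite -gh.
  by move=> i; rewrite /le; split; lia.
have [g gE] := ext _ _ eX eY (trunc_map (le n) f).
exists (n - 1), (cone g); split; first exact: acyclic_cone.
rewrite -gE; apply: trunc_cone_eq => i.
by rewrite /le; split; lia.
Qed.

Lemma right_acyclic_cone X Y (f : cmap X Y) :
  right_acyclic X -> right_acyclic Y -> right_acyclic (cone f).
Proof.
move=> [m [X' [aX eX]]] [m' [Y' [aY eY]]].
pose n := Num.max m m'.
have {eX} eX : trunc_ge n X = trunc_ge n X' by apply: trunc_ge_ge eX; rewrite le_max lexx.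
have {eY} eY : trunc_ge n Y = trunc_ge n Y' by apply: trunc_ge_ge eY; rewrite le_max lexx orbT.
have ext C D (eC : C = trunc_ge n X') (eD : D = trunc_ge n Y') (h : cmap C D) :
    exists g : cmap X' Y', trunc_ge n (cone h) = trunc_ge n (cone g).
  subst C; subst D.
  have [g gh] := extend_left h aY; exists g.
  rewrite [RHS](@trunc_cone_eq _ _ (ge n)); first by rewrite -gh.
  by move=> i; rewrite /ge; split; lia.
have [g gE] := ext _ _ eX eY (trunc_map (ge n) f).
exists n, (cone g); split; first exact: acyclic_cone.
rewrite -gE; apply: trunc_cone_eq => i.
by rewrite /ge; split; lia.
Qed.

Lemma infty_b_cone X Y (f : cmap X Y) : infty_b X -> infty_b Y -> infty_b (cone f).
Proof.
move=> /infty_bP [lX rX] /infty_bP [lY rY]; apply/infty_bP.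
by split; [apply: left_acyclic_cone | apply: right_acyclic_cone].
Qed.

Lemma is_zero_bip (A B : P) : is_zero A -> is_zero B -> is_zero (bip A B).
Proof.
move=> A0 B0; rewrite /is_zero -bip_id -[prl A B]comp1m A0 -[prr A B]comp1m B0.
by rewrite !comp0m !compm0 addr0.
Qed.

Lemma bounded_below_cone X Y (f : cmap X Y) :
  bounded_below X -> bounded_below Y -> bounded_below (cone f).
Proof.
move=> [n X0] [m Y0]; exists (Num.min n m - 1) => i im.
by apply: is_zero_bip; [apply: X0 | apply: Y0]; lia.
Qed.

Lemma bounded_above_cone X Y (f : cmap X Y) :
  bounded_above X -> bounded_above Y -> bounded_above (cone f).
Proof.
move=> [n X0] [m Y0]; exists (Num.max n m) => i im.
by apply: is_zero_bip; [apply: X0 | apply: Y0]; lia.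
Qed.

Lemma plus_b_cone X Y (f : cmap X Y) : plus_b X -> plus_b Y -> plus_b (cone f).
Proof.
by move=> [bX iX] [bY iY]; split; [apply: bounded_below_cone | apply: infty_b_cone].
Qed.

Lemma minus_b_cone X Y (f : cmap X Y) : minus_b X -> minus_b Y -> minus_b (cone f).
Proof.
by move=> [bX iX] [bY iY]; split; [apply: bounded_above_cone | apply: infty_b_cone].
Qed.

Lemma trunc_zero (p : pred int) X i : ~~ p i || `[< is_zero (X i) >] -> is_zero (trunc p X i).
Proof.
rewrite /= /trunc_ob; case: (p i) => /= [/asboolP //|_].
exact: (zero_is_zero P).
Qed.

Lemma trunc_le_bounded_above n X : bounded_above (trunc_le n X).
Proof. by exists n => i ni; apply: trunc_zero; rewrite -ltNge ni. Qed.

Lemma trunc_ge_bounded_below n X : bounded_below (trunc_ge n X).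
Proof. by exists n => i ni; apply: trunc_zero; rewrite -ltNge ni. Qed.

Lemma trunc_bounded_above p X : bounded_above X -> bounded_above (trunc p X).
Proof. by move=> [n X0]; exists n => i /X0 h; apply: trunc_zero; apply/orP; right; apply/asboolP. Qed.

Lemma trunc_bounded_below p X : bounded_below X -> bounded_below (trunc p X).
Proof. by move=> [n X0]; exists n => i /X0 h; apply: trunc_zero; apply/orP; right; apply/asboolP. Qed.

Lemma trunc_infty_b p X n : (p = le n \/ p = ge n) -> infty_b X -> infty_b (trunc p X).
Proof.
(* On the side cut off by [p], the truncation agrees with this zero complex, which is acyclic. *)
pose Z := trunc xpred0 X.
have aZ : acyclic Z by apply: acyclic_zero => i; apply: (zero_is_zero P).
have e0 (q : pred int) : (forall i, ~~ (p i && q i)) -> trunc q (trunc p X) = trunc q Z.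
  move=> pq; rewrite !trunc_trunc; congr (trunc _ X); apply: funext => i.
  by rewrite andbF andbC; apply/negbTE.
have e1 (q : pred int) : (forall i, q i -> p i) -> trunc q (trunc p X) = trunc q X.
  move=> qp; rewrite trunc_trunc; congr (trunc _ X); apply: funext => i.
  by have := qp i; case: (q i) => // ->.
move=> pn /infty_bP [[m [Y [aY e]]] [m' [Y' [aY' e']]]]; apply/infty_bP.
case: pn => pE; split.
- exists (Num.min m n), Y; split=> //; rewrite -(trunc_le_le (m := m) _ e); last by lia.
  by apply: e1 => i; rewrite pE /le; lia.
- by exists (n + 1), Z; split=> //; apply: e0 => i; rewrite pE /le; lia.
- by exists (n - 1), Z; split=> //; apply: e0 => i; rewrite pE /ge; lia.
- exists (Num.max m' n), Y'; split=> //; rewrite -(trunc_ge_ge (m := m') _ e'); last by lia.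
  by apply: e1 => i; rewrite pE /ge; lia.
Qed.

End InftyB.

Lemma acyclic_unshift X : acyclic (shift X) -> acyclic X.
Proof.
move=> /acyclicP h; apply/acyclicP; elim/succ_ind => i.
have [U [U' [k [k' [p [kK kK' kp c]]]]]] := h i.
have kerN (A B C : F) (a : Hom A B) (b : Hom B C) : is_kernel a (- b) -> is_kernel a b.
  move=> [ba univ]; split; first by apply: oppr_inj; rewrite oppr0 -compNm.
  by move=> T t bt; apply: univ; rewrite compNm bt oppr0.
exists U, U', k, k', (- p); split; try exact: kerN.
  by rewrite compmN kp; exact: opprK.
apply: (conflation_iso (a := idm _) (b := idm _) (c := - idm _)) c;
  rewrite ?(comp1m, compm1, compNm) //; try exact: is_iso_id.
by exists (- idm _); rewrite compNm compmN opprK comp1m.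
Qed.

Lemma infty_b_unshift X : infty_b (shift X) -> infty_b X.
Proof.
move=> /infty_bP [[m [Y [aY e]]] [n [Y' [aY' e']]]]; apply/infty_bP.
have [Y1 eY1] := shift_surj Y; have [Y2 eY2] := shift_surj Y'.
move: aY aY'; rewrite -eY1 -eY2 => /acyclic_unshift aY1 /acyclic_unshift aY2; split.
  exists (m + 1), Y1; split=> //; apply: shift_inj; rewrite -!shift_trunc_le.
  by rewrite addrK eY1.
exists (n + 1), Y2; split=> //; apply: shift_inj; rewrite -!shift_trunc_ge.
by rewrite addrK eY2.
Qed.

Lemma bounded_below_unshift X : bounded_below (shift X) -> bounded_below X.
Proof. by move=> [n X0]; exists (n + 1) => i ni; rewrite -(subrK 1 i); apply: X0; lia. Qed.

Lemma bounded_above_unshift X : bounded_above (shift X) -> bounded_above X.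
Proof. by move=> [n X0]; exists (n + 1) => i ni; rewrite -(subrK 1 i); apply: X0; lia. Qed.

Lemma plus_b_unshift X : plus_b (shift X) -> plus_b X.
Proof. by move=> [b i]; split; [apply: bounded_below_unshift | apply: infty_b_unshift]. Qed.

Lemma minus_b_unshift X : minus_b (shift X) -> minus_b X.
Proof. by move=> [b i]; split; [apply: bounded_above_unshift | apply: infty_b_unshift]. Qed.

End CyclesOfCones.

(** * Truncation as a functor on Verdier quotients *)

Section FunctorTriIso.
Variables (C D : preadditive) (S : functor C C) (S' : functor D D) (F : functor C D).
Variable sh : forall X, Hom (F (S X)) (S' (F X)).
Hypothesis sh_nat : forall X Y (f : Hom X Y),
  sh Y ∘ fmap F (fmap S f) = fmap S' (fmap F f) ∘ sh X.

Lemma functor_tri_iso (X Y Z X' Y' Z' : C)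
    (u : Hom X Y) (v : Hom Y Z) (w : Hom Z (S X))
    (u' : Hom X' Y') (v' : Hom Y' Z') (w' : Hom Z' (S X')) :
  tri_iso u v w u' v' w' ->
  tri_iso (fmap F u) (fmap F v) (sh X ∘ fmap F w)
          (fmap F u') (fmap F v') (sh X' ∘ fmap F w').
Proof.
move=> [a [b [c [[ia ib ic] [e1 e2 e3]]]]].
exists (fmap F a), (fmap F b), (fmap F c); split; first by split; apply: fmap_iso.
split; rewrite -?fmapM ?e1 ?e2 //.
by rewrite compA -sh_nat -!compA -!fmapM e3.
Qed.

End FunctorTriIso.

Section VerdierTheory.
Variables (T : triangulation) (S : T -> Prop) (hS : forall X, S X -> S (Sig X)).

Lemma vdist_iso : iso_closed (verdier hS).
Proof.
move=> X Y Z X' Y' Z' u v w u' v' w' t [X1 [Y1 [Z1 [u1 [v1 [w1 [d t1]]]]]]].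
by exists X1, Y1, Z1, u1, v1, w1; split=> //; apply: tri_iso_trans t t1.
Qed.

End VerdierTheory.

Section Quotients.
Variable F : frobeniusCategory.
Local Notation P := (projectives F).
Local Notation K := (homotopyCategory P).
Implicit Types X Y Z : complex P.
Local Notation "[ 'k' g ]" := (kcls g : @Hom K _ _) (format "[ 'k'  g ]").

Lemma bounded_infty_b X : bounded X -> infty_b X.
Proof.
move=> [[n Xn] [m Xm]]; apply/infty_bP; split.
  exists (n - 1), (trunc_le (n - 1) X); split; last first.
    by rewrite /trunc_le trunc_trunc; congr (trunc _ X); apply: funext => i; rewrite andbb.
  apply: acyclic_zero => i; apply: trunc_zero.
  have [im|] := leP i (n - 1); last by [].
  by apply/orP; right; apply/asboolP/Xn; lia.
exists (m + 1), (trunc_ge (m + 1) X); split; last first.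
  by rewrite /trunc_ge trunc_trunc; congr (trunc _ X); apply: funext => i; rewrite andbb.
apply: acyclic_zero => i; apply: trunc_zero.
have [im|] := leP (m + 1) i; last by [].
by apply/orP; right; apply/asboolP/Xm; lia.
Qed.

Lemma bounded_plus_b X : bounded X -> plus_b X.
Proof. by move=> bX; split; [case: bX | apply: bounded_infty_b]. Qed.

Lemma bounded_minus_b X : bounded X -> minus_b X.
Proof. by move=> bX; split; [case: bX | apply: bounded_infty_b]. Qed.

Lemma kdist_replace X Y Z (f : cmap X Y) :
  @isomorphic K (cone f) Z -> exists (v : @Hom K Y Z) (w : @Hom K Z (shift X)), kdist [k f] v w.
Proof.
move=> [c ic]; have [c' [ic' c'c cc']] := iso_inverse ic.
exists (c ∘ [k cone_inr f]), ([k cone_prl f] ∘ c'); exists X, Y, f.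
exists (idm _), (idm _), c'; split; first by split=> //; apply: is_iso_id.
split; first by rewrite comp1m compm1.
  by rewrite compA c'c comp1m compm1.
by rewrite fmap1 comp1m.
Qed.

Section Generic.
Variables (S : complex P -> Prop) (hS : forall X, S X -> S (shift X)).
Hypothesis S_bounded : forall X, bounded X -> S X.
Hypothesis S_cone : forall X Y (f : cmap X Y), S X -> S Y -> S (cone f).

Local Notation KS := (@full_tri K S hS).
Local Notation V := (@modKb F S hS).
Local Notation Q := (vquot (@Kb F S hS)).
Local Notation kb := (@Kb F S hS).

Definition kmor (X Y : KS) (f : cmap (sval X) (sval Y)) : @Hom KS X Y := [k f].

Lemma quot_kmor_comp (X Y Z : KS) (g : cmap (sval Y) (sval Z)) (f : cmap (sval X) (sval Y)) :
  fmap Q (kmor g) ∘ fmap Q (kmor f) = fmap Q (@kmor X Z (cmap_comp g f)).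
Proof.
apply: etrans (esym (fmapM Q (kmor g) (kmor f))) _; congr (fmap Q _).
exact: (kcomp_kcls g f).
Qed.

Lemma cone_in_trunc (X Y : KS) (f : cmap (sval X) (sval Y)) (r : pred int) :
  (forall i, r i -> is_iso (f i)) -> (forall i, r (i + 1) -> r i || r (i + 1 + 1)) ->
  bounded (cone (trunc_map (fun i => ~~ r i) f)) -> cone_in kb (kmor f).
Proof.
move=> fi rn b; have [v [w d]] := kdist_replace (cone_trunc fi rn).
by exists (exist S _ (S_bounded b)), v, w.
Qed.

(** The zero endomorphism has bounded cone, so it becomes invertible in the quotient. *)
Lemma bounded_quot_zero (X : KS) : bounded (sval X) -> is_zero (X : V).
Proof.
move=> bX.
have ci : cone_in kb (0 : Hom X X).
  have b0 : bounded (cone (0 : cmap (sval X) (sval X))).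
    by case: bX => b a; split; [apply: bounded_below_cone | apply: bounded_above_cone].
  exists (exist S _ (S_bounded b0)), [k cone_inr _], [k cone_prl _]; split=> //.
  have -> : (0 : @Hom KS X X) = [k (0 : cmap (sval X) (sval X))].
    rewrite (_ : [k _] = 0) //; apply: (@null_by _ _ _ _ (fun=> 0)) => i.
    by rewrite compm0 comp0m addr0.
  exact: kdist_cone.
have [t [t0 _]] := vquot_iso ci.
by rewrite /is_zero -[idm _]t0 fmap0 compm0.
Qed.

Lemma factor_quot_zero (X Y Z : KS) (f : cmap (sval X) (sval Y))
    (a : cmap (sval Z) (sval Y)) (b : cmap (sval X) (sval Z)) :
  bounded (sval Z) -> f = cmap_comp a b -> fmap Q (kmor f) = 0.
Proof.
move=> bZ fE; have -> : kmor f = kmor a ∘ kmor b.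
  by rewrite /kmor fE; apply/esym; apply: (kcomp_kcls a b).
by rewrite fmapM -[fmap Q (kmor b)]comp1m (bounded_quot_zero bZ) comp0m compm0.
Qed.

Variable p : pred int.
Hypothesis S_trunc : forall X, infty_b X -> S (trunc p X).
(** Away from 0 a half-line contains the neighbours of each of its degrees, so truncation fails to
    respect homotopies, shifts and cones only in a bounded range. The next two hypotheses say that
    errors of bounded range disappear in the quotient. *)
Hypothesis p_next : forall j, p (j + 1) -> 1 < `|j + 1| -> p j && p (j + 1 + 1).
Hypothesis far_iso : forall (X Y : KS) (f : cmap (sval X) (sval Y)) (n : int),
  (forall i, p i -> n < `|i| -> is_iso (f i)) -> cone_in kb (kmor f).
Hypothesis far_zero : forall (X Y : KS) (f : cmap (sval X) (sval Y)) (n : int),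
  (forall i, p i -> n < `|i| -> f i = 0) -> fmap Q (kmor f) = 0.

Local Notation KI := (K_infty_b F).

Definition T_ob (X : KI) : KS := exist S (trunc p (sval X)) (S_trunc (svalP X)).

Definition T_cmap (X Y : KI) (f : cmap (sval X) (sval Y)) : @Hom V (T_ob X) (T_ob Y) :=
  fmap Q (@kmor (T_ob X) (T_ob Y) (trunc_map p f)).

Lemma T_cmapD (X Y : KI) (f g : cmap (sval X) (sval Y)) : T_cmap (f + g) = T_cmap f + T_cmap g.
Proof.
apply: etrans (fmapD Q _ _); congr (fmap Q _); apply: etrans (kclsD _ _); congr kcls.
by apply: cmap_ext => i /=; rewrite sel_mapD.
Qed.

Lemma T_cmapN (X Y : KI) (f : cmap (sval X) (sval Y)) : T_cmap (- f) = - T_cmap f.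
Proof.
apply/eqP; rewrite -subr_eq0 opprK -T_cmapD; apply/eqP.
rewrite /T_cmap; have -> : trunc_map p (- f + f) = 0.
  by apply: cmap_ext => i /=; rewrite addNr sel_map_zero.
apply: (@far_zero _ _ _ 0) => //.
Qed.

(* A truncated homotopy is a homotopy up to a map concentrated in degrees -1, 0, 1. *)
Lemma T_cmap_null (X Y : KI) (f : cmap (sval X) (sval Y)) :
  null_homotopic f -> T_cmap f = 0.
Proof.
move: X Y f => [X SX] [Y SY] /= f [s fs].
pose s' i : Hom (trunc p X (i + 1)) (trunc p Y i) := @sel_map P (p (i + 1)) (p i) _ _ (s i).
have [j|n nE] := @cmap_succ _ (trunc p X) (trunc p Y)
    (fun j => dif (trunc p Y) j ∘ s' j + s' (j + 1) ∘ dif (trunc p X) (j + 1)).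
  by rewrite compDl compDr -!compA dif_dif !compA dif_dif comp0m compm0; zmod.
have -> : T_cmap (X := exist _ X SX) (Y := exist _ Y SY) f =
    fmap Q (@kmor (T_ob (exist _ X SX)) (T_ob (exist _ Y SY)) (@trunc_map P p _ _ f - n)).
  rewrite /T_cmap; congr (fmap Q _); apply/esym/kclsP.
  exists (fun i => - s' i) => i; rewrite cmap_addE cmap_oppE cmap_addE cmap_oppE nE.
  by rewrite compmN compNm; zmod.
apply: (@far_zero _ _ _ 1); elim/succ_ind => j pj1 lj.
have /andP[pj pj2] := p_next pj1 lj.
rewrite cmap_addE cmap_oppE nE /s' !trunc_difE /= fs /trunc_ob pj pj1 pj2 /=.
by rewrite subrr.
Qed.

Lemma T_cmap_eq (X Y : KI) (f g : cmap (sval X) (sval Y)) :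
  null_homotopic (f - g) -> T_cmap f = T_cmap g.
Proof.
move=> /T_cmap_null; rewrite T_cmapD T_cmapN => /eqP; rewrite subr_eq0 => /eqP //.
Qed.

Definition T_mor (X Y : KI) (a : Hom X Y) : @Hom V (T_ob X) (T_ob Y) :=
  T_cmap (repr (a : khom (sval X) (sval Y))).

Lemma T_morE (X Y : KI) (f : cmap (sval X) (sval Y)) :
  T_mor ([k f] : @Hom KI X Y) = T_cmap f.
Proof. exact/T_cmap_eq/krepr. Qed.

Lemma T_mor1 (X : KI) : T_mor (idm X) = idm (T_ob X : V).
Proof.
rewrite [LHS](@T_morE X X (cmap_id _)) /T_cmap.
have -> : @kmor (T_ob X) (T_ob X) (trunc_map p (cmap_id (sval X))) = idm (T_ob X).
  by congr kcls; apply: cmap_ext => i /=; rewrite sel_map1.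
exact: (fmap1 Q (T_ob X)).
Qed.

Lemma T_morM (X Y Z : KI) (b : Hom Y Z) (a : Hom X Y) : T_mor (b ∘ a) = T_mor b ∘ T_mor a.
Proof.
elim/kclsW: a => a; elim/kclsW: b => b.
rewrite [X in T_mor X](kcomp_kcls b a) (T_morE (cmap_comp b a)) (T_morE a) (T_morE b).
apply/esym; apply: etrans (@quot_kmor_comp (T_ob X) (T_ob Y) (T_ob Z) _ _) _.
by rewrite -trunc_map_comp.
Qed.

Lemma T_morD (X Y : KI) (a b : Hom X Y) : T_mor (a + b) = T_mor a + T_mor b.
Proof.
elim/kclsW: a => a; elim/kclsW: b => b.
rewrite [X in T_mor X](esym (kclsD a b)) (T_morE (a + b)) (T_morE a) (T_morE b).
exact: T_cmapD.
Qed.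

Definition T_functor : functor KI V := @Functor KI V T_ob T_mor T_mor1 T_morM T_morD.

Definition T_shift (X : KI) : @Hom V (T_ob (Sig X)) (vSig (@Kb_Sig F S hS) (T_ob X)) :=
  fmap Q (@kmor (T_ob (Sig X)) (Sig (T_ob X)) (trunc_shift p (sval X))).

Lemma T_shift_iso (X : KI) : is_iso (T_shift X).
Proof.
apply: vquot_iso; apply: (@far_iso _ _ _ 1); elim/succ_ind => j pj lj.
by have /andP[_ pj2] := p_next pj lj; apply: trunc_shift_isoP.
Qed.

Lemma T_shift_nat (X Y : KI) (a : Hom X Y) :
  T_shift Y ∘ fmap T_functor (fmap Sig a) =
  fmap (vSig (@Kb_Sig F S hS)) (fmap T_functor a) ∘ T_shift X.
Proof.
elim/kclsW: a => a /=.
rewrite [X in T_mor X](kSig_kcls a) (T_morE a) (T_morE (X := Sig X) (Y := Sig Y) (cmap_shift a)).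
have -> : vsusp (@Kb_Sig F S hS) (T_cmap a) =
    fmap Q (fmap Sig (@kmor (T_ob X) (T_ob Y) (trunc_map p a))).
  exact: vSig_quot.
have -> : fmap Sig (@kmor (T_ob X) (T_ob Y) (trunc_map p a)) =
    @kmor (Sig (T_ob X)) (Sig (T_ob Y)) (cmap_shift (trunc_map p a)).
  exact: kSig_kcls.
apply: etrans (@quot_kmor_comp (T_ob (Sig X)) (T_ob (Sig Y)) (Sig (T_ob Y)) _ _) _.
apply: etrans (esym (@quot_kmor_comp (T_ob (Sig X)) (Sig (T_ob X)) (Sig (T_ob Y)) _ _)).
by rewrite trunc_shift_nat.
Qed.

Lemma T_cone (X Y : KI) (f : cmap (sval X) (sval Y)) :
  let C : KI := exist _ (cone f) (infty_b_cone f (svalP X) (svalP Y)) in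
  @dist V _ _ _ (fmap T_functor ([k f] : @Hom KI X Y))
    (fmap T_functor ([k cone_inr f] : @Hom KI Y C))
    (T_shift X ∘ fmap T_functor ([k cone_prl f] : @Hom KI C (Sig X))).
Proof.
move=> C; pose C' : KS := exist S _ (S_cone (trunc_map p f) (svalP (T_ob X)) (svalP (T_ob Y))).
exists (T_ob X), (T_ob Y), C', (@kmor (T_ob X) (T_ob Y) (trunc_map p f)),
  (@kmor (T_ob Y) C' (cone_inr _)), (@kmor C' (Sig (T_ob X)) (cone_prl _)).
split; first exact: kdist_cone.
exists (idm _), (idm _), (fmap Q (@kmor (T_ob C) C' (trunc_cone p f))); split.
  split; try exact: is_iso_id.
  apply: vquot_iso; apply: (@far_iso _ _ _ 1); elim/succ_ind => j pj lj.
  by have /andP[_ pj2] := p_next pj lj; apply: trunc_cone_iso.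
split.
- by rewrite comp1m compm1 [LHS](T_morE f).
- rewrite compm1 [X in _ ∘ X](T_morE (X := Y) (Y := C) (cone_inr f)).
  apply: etrans (@quot_kmor_comp (T_ob Y) (T_ob C) C' _ _) _.
  by rewrite trunc_cone_inr.
- rewrite fmap1 comp1m [X in _ ∘ X](T_morE (X := C) (Y := Sig X) (cone_prl f)).
  apply: etrans (@quot_kmor_comp (T_ob C) (T_ob (Sig X)) (Sig (T_ob X)) _ _) _.
  apply: etrans (esym (@quot_kmor_comp (T_ob C) C' (Sig (T_ob X)) _ _)).
  by rewrite trunc_cone_prl.
Qed.

(** [dist] allows the cone of a map between complexes outside K^{oo,b}. [tri_map_iso] exchanges it
    for the cone of a representative of [u], to which [T_cone] applies. *)
Lemma T_dist (X Y Z : KI) (u : Hom X Y) (v : Hom Y Z) (w : Hom Z (Sig X)) :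
  dist u v w -> @dist V _ _ _ (fmap T_functor u) (fmap T_functor v)
    (T_shift X ∘ fmap T_functor w).
Proof.
elim/kclsW: u => f d.
pose C : KI := exist _ (cone f) (infty_b_cone f (svalP X) (svalP Y)).
have t : @tri_iso KI Sig X Y Z [k f] v w X Y C [k f] [k cone_inr f] [k cone_prl f].
  apply: (tri_map_iso (homotopy_exact P) d (kdist_cone f) (a := idm _) (b := idm _));
    try exact: is_iso_id.
  by rewrite comp1m compm1.
apply: vdist_iso (T_cone f).
exact: (functor_tri_iso T_shift_nat t).
Qed.

Definition T_tri : triFunctor KI V :=
  @TriFunctor KI V T_functor T_shift T_shift_iso T_shift_nat T_dist.

End Generic.
End Quotients.

(** * Maps inverted by a functor, tested on resolutions *)

Lemma iso_of_split (C : preadditive) (X Y : C) (s : Hom X Y) (a b : Hom Y X) :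
  s ∘ a = idm Y -> b ∘ s = idm X -> is_iso s.
Proof.
by move=> sa bs; exists a; split=> //; rewrite -bs; congr (_ ∘ _);
  rewrite -[a]comp1m -bs -compA sa compm1.
Qed.

(** A resolution of [Y] lifts through [s] to a map [h], and [h] is again bijective for the objects
    of [W]. Hence [T h] has a right inverse by the same argument and a left inverse because
    [T (s ∘ h)] is invertible; so [T h], and then [T s], is invertible. *)
Lemma resolved_iso (C D : preadditive) (T : functor C D) (W : C -> Prop) :
  (forall Y : C, exists A (g : Hom A Y),
     [/\ W A, is_iso (fmap T g) & forall A', W A' -> post_bij A' g]) ->
  forall (X Y : C) (s : Hom X Y), (forall A, W A -> post_bij A s) -> is_iso (fmap T s).
Proof.
move=> res.
have split_epi (X Y : C) (s : Hom X Y) : (forall A, W A -> post_bij A s) ->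
    exists A (h : Hom A X), [/\ forall A', W A' -> post_bij A' h &
      exists a, fmap T s ∘ (fmap T h ∘ a) = idm _ /\ is_iso (fmap T s ∘ fmap T h)].
  move=> sW; have [A [g [WA [t [tg gt]] gW]]] := res Y.
  have [h sh] := (sW A WA).2 g; exists A, h; split; last first.
    exists t; rewrite compA -fmapM sh gt; split=> //.
    by exists t.
  move=> A' WA'; have [gi gs] := gW A' WA'; have [si ss] := sW A' WA'; split=> [x hx|y].
    by apply: gi; rewrite -sh -compA hx compm0.
  have [x gx] := gs (s ∘ y); exists x.
  apply/eqP; rewrite -subr_eq0; apply/eqP/si.
  by rewrite compDr compmN compA sh gx subrr.
move=> X Y s sW; have [A [h [hW [a [sa [t [ts st]]]]]]] := split_epi X Y s sW.
have [A' [h' [_ [b [hb _]]]]] := split_epi _ _ h hW.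
have hb' : is_iso (fmap T h).
  by apply: (iso_of_split (a := fmap T h' ∘ b) (b := t ∘ fmap T s)); rewrite -?compA.
have [c [ch hc]] := hb'.
have -> : fmap T s = (fmap T s ∘ fmap T h) ∘ c by rewrite -compA hc compm1.
by apply: is_iso_comp; [exists t | exists (fmap T h)].
Qed.

Lemma coresolved_iso (C D : preadditive) (T : functor C D) (W : C -> Prop) :
  (forall Y : C, exists A (g : Hom Y A),
     [/\ W A, is_iso (fmap T g) & forall A', W A' -> pre_bij A' g]) ->
  forall (X Y : C) (s : Hom X Y), (forall A, W A -> pre_bij A s) -> is_iso (fmap T s).
Proof.
move=> res X Y s sW; apply/is_iso_op.
apply: (@resolved_iso (op C) (op D) (op_functor T) W _ Y X s) => // Z.
have [A [g [WA gi gW]]] := res Z; exists A, g; split=> //.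
exact/is_iso_op.
Qed.

Definition le0 (i : int) := i <= 0.
Definition ge0 (i : int) := 0 <= i.

Section Sides.
Variable F : frobeniusCategory.
Local Notation P := (projectives F).
Local Notation K := (homotopyCategory P).
Implicit Types X Y Z : complex P.

Lemma le0_next j : le0 (j + 1) -> 1 < `|j + 1| -> le0 j && le0 (j + 1 + 1).
Proof. by rewrite /le0; lia. Qed.

Lemma ge0_next j : ge0 (j + 1) -> 1 < `|j + 1| -> ge0 j && ge0 (j + 1 + 1).
Proof. by rewrite /ge0; lia. Qed.

Lemma minus_b_trunc X : infty_b X -> minus_b (trunc le0 X).
Proof.
move=> iX; split; first exact: (trunc_le_bounded_above 0 X).
by apply: (@trunc_infty_b _ _ _ 0) => //; left.
Qed.

Lemma plus_b_trunc X : infty_b X -> plus_b (trunc ge0 X).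
Proof.
move=> iX; split; first exact: (trunc_ge_bounded_below 0 X).
by apply: (@trunc_infty_b _ _ _ 0) => //; right.
Qed.

Lemma bounded_cone X Y (f : cmap X Y) : bounded X -> bounded Y -> bounded (cone f).
Proof.
by move=> [? ?] [? ?]; split; [apply: bounded_below_cone | apply: bounded_above_cone].
Qed.

(** Elimination removes all degrees up to some [m]; what remains of two bounded above complexes is
    bounded, and so is its cone. *)
Lemma minus_far_iso (X Y : @full_tri K _ (@minus_b_shift F))
    (f : cmap (sval X) (sval Y)) (n : int) :
  (forall i, le0 i -> n < `|i| -> is_iso (f i)) -> cone_in (@Kb F _ _) (kmor f).
Proof.
(* Every [i <= m] is nonpositive and satisfies [n < |i|]; the absolute value covers a negative
   [n]. *)
move=> fi; pose m : int := - (1 + `|n|).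
have bt Z : bounded_above Z -> bounded (trunc (fun i => ~~ (i <= m)) Z).
  move=> aZ; split; last exact: trunc_bounded_above.
  by exists m => i im; apply: trunc_zero; rewrite negbK; apply/orP; left; lia.
apply: (cone_in_trunc (@bounded_minus_b F) (r := fun i => i <= m)).
- by move=> i im; apply: fi; move: im; rewrite /m /le0; lia.
- by move=> i im; apply/orP; left; lia.
- by apply: bounded_cone; apply: bt; [case: (svalP X) | case: (svalP Y)].
Qed.

Lemma plus_far_iso (X Y : @full_tri K _ (@plus_b_shift F))
    (f : cmap (sval X) (sval Y)) (n : int) :
  (forall i, ge0 i -> n < `|i| -> is_iso (f i)) -> cone_in (@Kb F _ _) (kmor f).
Proof.
move=> fi; pose m : int := 1 + `|n|.
have bt Z : bounded_below Z -> bounded (trunc (fun i => ~~ (m <= i)) Z).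
  move=> aZ; split; first exact: trunc_bounded_below.
  by exists m => i im; apply: trunc_zero; rewrite negbK; apply/orP; left; lia.
apply: (cone_in_trunc (@bounded_plus_b F) (r := fun i => m <= i)).
- by move=> i im; apply: fi; move: im; rewrite /m /ge0; lia.
- by move=> i im; apply/orP; right; lia.
- by apply: bounded_cone; apply: bt; [case: (svalP X) | case: (svalP Y)].
Qed.

(** A map vanishing far to the left factors through the part of [Y] from degree [m] on, which is
    bounded and so zero in the quotient. *)
Lemma minus_far_zero (X Y : @full_tri K _ (@minus_b_shift F))
    (f : cmap (sval X) (sval Y)) (n : int) :
  (forall i, le0 i -> n < `|i| -> f i = 0) ->
  fmap (vquot (@Kb F _ (@minus_b_shift F))) (kmor f) = 0.
Proof.
move=> f0; pose m : int := - (1 + `|n|).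
have up i : m <= i -> m <= i + 1 by lia.
have [i|g gE] := null_factor_from_trunc (p := fun i => m <= i) up (f := f).
  by move=> im; apply: f0; move: im; rewrite /m /le0; lia.
have bZ : bounded (trunc_ge m (sval Y)).
  split; first exact: trunc_ge_bounded_below.
  by apply: trunc_bounded_above; case: (svalP Y).
apply: (factor_quot_zero (@bounded_minus_b F)
  (Z := exist _ _ (bounded_minus_b bZ)) bZ gE).
Qed.

Lemma plus_far_zero (X Y : @full_tri K _ (@plus_b_shift F))
    (f : cmap (sval X) (sval Y)) (n : int) :
  (forall i, ge0 i -> n < `|i| -> f i = 0) ->
  fmap (vquot (@Kb F _ (@plus_b_shift F))) (kmor f) = 0.
Proof.
move=> f0; pose m : int := 1 + `|n|.
have down i : i + 1 <= m -> i <= m by lia.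
have [i|g gE] := null_factor_to_trunc (p := fun i => i <= m) down (f := f).
  by move=> im; apply: f0; move: im; rewrite /m /ge0; lia.
have bZ : bounded (trunc_le m (sval X)).
  split; last exact: trunc_le_bounded_above.
  by apply: trunc_bounded_below; case: (svalP X).
apply: (factor_quot_zero (@bounded_plus_b F)
  (Z := exist _ _ (bounded_plus_b bZ)) bZ gE).
Qed.

Local Notation KI := (K_infty_b F).
Local Notation Vm := (K_minus_b_mod_Kb F).
Local Notation Vp := (K_plus_b_mod_Kb F).

Definition Tm : triFunctor KI Vm :=
  T_tri (@minus_b_cone F) minus_b_trunc le0_next minus_far_iso minus_far_zero.

Definition Tp : triFunctor KI Vp :=
  T_tri (@plus_b_cone F) plus_b_trunc ge0_next plus_far_iso plus_far_zero.

End Sides.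

(** * Acyclic resolutions and truncation on the quotient *)

Section Resolutions.
Variable F : frobeniusCategory.
Local Notation P := (projectives F).
Local Notation K := (homotopyCategory P).
Implicit Types X Y Z : complex P.
Local Notation "[ 'k' g ]" := (kcls g : @Hom K _ _) (format "[ 'k'  g ]").
Local Notation KI := (K_infty_b F).
Local Notation D := (K_infty_b_mod_Kb F).
Local Notation Vm := (K_minus_b_mod_Kb F).
Local Notation Vp := (K_plus_b_mod_Kb F).
Local Notation QD := (vquot (@Kb F _ (@infty_b_shift F))).
Local Notation Qm := (vquot (@Kb F _ (@minus_b_shift F))).
Local Notation Qp := (vquot (@Kb F _ (@plus_b_shift F))).
Local Notation KE := (homotopy_exact P).

Definition acyc (X : KI) : Prop := acyclic (sval X).

Lemma acyclic_to_plus (A B : KI) (f : Hom A B) :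
  acyc A -> bounded_below (sval B) -> f = 0.
Proof. by elim/kclsW: f => f aA bB; apply: acyclic_to_bounded_below. Qed.

Lemma minus_to_acyclic (A B : KI) (f : Hom A B) :
  bounded_above (sval A) -> acyc B -> f = 0.
Proof. by elim/kclsW: f => f aA bB; apply: bounded_above_to_acyclic. Qed.

Lemma post_bij_bounded_below (A X Y Z : KI) (s : Hom X Y) (v : Hom Y Z) (w : Hom Z (Sig X)) :
  dist s v w -> bounded_below (sval Z) -> acyc A -> post_bij A s.
Proof.
move=> d bZ aA; apply: (post_bij_of_cone KE d (A := sval A)) => f.
  exact: (@acyclic_to_plus A Z f).
exact: (@acyclic_to_plus (Sig A) Z f (acyclic_shift aA)).
Qed.

Lemma pre_bij_bounded_above (A X Y Z : KI) (s : Hom X Y) (v : Hom Y Z) (w : Hom Z (Sig X)) :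
  dist s v w -> bounded_above (sval Z) -> acyc A -> pre_bij A s.
Proof.
move=> d bZ aA; apply: (pre_bij_of_cone KE d (A := sval A)) => f.
  exact: (@minus_to_acyclic Z A f).
exact: (@minus_to_acyclic Z (Sig A) f bZ (acyclic_shift aA)).
Qed.

(** Turns an equality of complexes into a chain map, the form in which it can be extended. *)
Lemma trunc_le_iso X Y m : trunc_le m Y = trunc_le m X ->
  exists f : cmap (trunc_le m Y) (trunc_le m X), forall i, is_iso (f i).
Proof. by move=> ->; exists (cmap_id _) => i; apply: is_iso_id. Qed.

Lemma trunc_ge_iso X Y m : trunc_ge m Y = trunc_ge m X ->
  exists f : cmap (trunc_ge m Y) (trunc_ge m X), forall i, is_iso (f i).
Proof. by move=> ->; exists (cmap_id _) => i; apply: is_iso_id. Qed.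

Lemma sel_map_iso (b : bool) (C : additive) (X Y : C) (f : Hom X Y) :
  b -> is_iso (sel_map b b f) -> is_iso f.
Proof. by move=> ->. Qed.

Lemma resolution (X : KI) : exists (A : KI) (m : int) (g : cmap (sval A) (sval X)),
  acyc A /\ forall i, i <= m -> is_iso (g i).
Proof.
have /infty_bP [[m [A [aA e]]] _] := svalP X.
have [f fi] := trunc_le_iso (esym e); have [g gf] := extend_right f aA.
exists (exist _ A (acyclic_infty_b aA)), m, g; split=> // i im.
by have := fi i; rewrite -gf; apply: sel_map_iso.
Qed.

Lemma coresolution (X : KI) : exists (A : KI) (m : int) (g : cmap (sval X) (sval A)),
  acyc A /\ forall i, m <= i -> is_iso (g i).
Proof.
have /infty_bP [_ [m [A [aA e]]]] := svalP X.
have [f fi] := trunc_ge_iso e; have [g gf] := extend_left f aA.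
exists (exist _ A (acyclic_infty_b aA)), m, g; split=> // i im.
by have := fi i; rewrite -gf; apply: sel_map_iso.
Qed.

(** The plain cone of [g] need not be bounded below; eliminating the degrees where [g] is invertible
    leaves a complex that is. *)
Lemma iso_left_dist (X Y : KI) (m : int) (g : cmap (sval X) (sval Y)) :
  (forall i, i <= m -> is_iso (g i)) ->
  exists (Z : KI) (v : Hom Y Z) (w : Hom Z (Sig X)), plus_b (sval Z) /\
    dist ([k g] : @Hom KI X Y) v w.
Proof.
move=> gi; have [|v [w d]] := kdist_replace (cone_trunc (p := fun i => i <= m) gi _).
  by move=> i im; apply/orP; left; lia.
have iZ : infty_b (cone (trunc_map (fun i => ~~ (i <= m)) g)).
  have -> : (fun i => ~~ (i <= m)) = (fun i => m + 1 <= i) by apply: funext => i; lia.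
  by apply: infty_b_cone; apply: (@trunc_infty_b _ _ _ (m + 1)); try exact: svalP; right.
exists (exist _ _ iZ), v, w; split=> //; split=> //.
by apply: bounded_below_cone; exists m => i im; apply: trunc_zero; rewrite negbK; apply/orP; left; lia.
Qed.

Lemma iso_right_dist (X Y : KI) (m : int) (g : cmap (sval X) (sval Y)) :
  (forall i, m <= i -> is_iso (g i)) ->
  exists (Z : KI) (v : Hom Y Z) (w : Hom Z (Sig X)), minus_b (sval Z) /\
    dist ([k g] : @Hom KI X Y) v w.
Proof.
move=> gi; have [|v [w d]] := kdist_replace (cone_trunc (p := fun i => m <= i) gi _).
  by move=> i im; apply/orP; right; lia.
have iZ : infty_b (cone (trunc_map (fun i => ~~ (m <= i)) g)).
  have -> : (fun i => ~~ (m <= i)) = (fun i => i <= m - 1) by apply: funext => i; lia.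
  by apply: infty_b_cone; apply: (@trunc_infty_b _ _ _ (m - 1)); try exact: svalP; left.
exists (exist _ _ iZ), v, w; split=> //; split=> //.
by apply: bounded_above_cone; exists m => i im; apply: trunc_zero; rewrite negbK; apply/orP; left; lia.
Qed.

Lemma cone_in_post_bij (A X Y : KI) (s : Hom X Y) :
  cone_in (@Kb F _ (@infty_b_shift F)) s -> acyc A -> post_bij A s.
Proof. by move=> [Z [v [w [d [bZ _]]]]]; apply: post_bij_bounded_below d bZ. Qed.

Lemma cone_in_pre_bij (A X Y : KI) (s : Hom X Y) :
  cone_in (@Kb F _ (@infty_b_shift F)) s -> acyc A -> pre_bij A s.
Proof. by move=> [Z [v [w [d [_ bZ]]]]]; apply: pre_bij_bounded_above d bZ. Qed.

Lemma Tm_kcls (X Y : KI) (g : cmap (sval X) (sval Y)) :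
  fmap (Tm F) ([k g] : @Hom KI X Y) =
  fmap Qm (@kmor F _ (@minus_b_shift F) (Tm F X) (Tm F Y) (trunc_map le0 g)).
Proof. exact: (T_morE (@minus_b_trunc F) le0_next (@minus_far_zero F) g). Qed.

Lemma Tp_kcls (X Y : KI) (g : cmap (sval X) (sval Y)) :
  fmap (Tp F) ([k g] : @Hom KI X Y) =
  fmap Qp (@kmor F _ (@plus_b_shift F) (Tp F X) (Tp F Y) (trunc_map ge0 g)).
Proof. exact: (T_morE (@plus_b_trunc F) ge0_next (@plus_far_zero F) g). Qed.

Lemma Tm_far_iso (X Y : KI) (m : int) (g : cmap (sval X) (sval Y)) :
  (forall i, i <= m -> is_iso (g i)) -> is_iso (fmap (Tm F) ([k g] : @Hom KI X Y)).
Proof.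
move=> gi; rewrite Tm_kcls; refine (vquot_iso _).
apply: (@minus_far_iso _ _ _ _ `|m|) => i i0 im; rewrite /= /trunc_ob.
have : is_iso (g i) by apply: gi; move: i0 im; rewrite /le0; lia.
by case: (le0 i) => // _; apply: zero_iso_id; apply: (zero_is_zero P).
Qed.

Lemma Tp_far_iso (X Y : KI) (m : int) (g : cmap (sval X) (sval Y)) :
  (forall i, m <= i -> is_iso (g i)) -> is_iso (fmap (Tp F) ([k g] : @Hom KI X Y)).
Proof.
move=> gi; rewrite Tp_kcls; refine (vquot_iso _).
apply: (@plus_far_iso _ _ _ _ `|m|) => i i0 im; rewrite /= /trunc_ob.
have : is_iso (g i) by apply: gi; move: i0 im; rewrite /ge0; lia.
by case: (ge0 i) => // _; apply: zero_iso_id; apply: (zero_is_zero P).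
Qed.

Lemma Tm_iso (X Y : KI) (s : Hom X Y) :
  (forall A, acyc A -> post_bij A s) -> is_iso (fmap (Tm F) s).
Proof.
apply: resolved_iso => Z; have [A [m [g [aA gi]]]] := resolution Z.
exists A, [k g]; split; [exact: aA | exact: Tm_far_iso gi |].
by have [C [v [w [[bC _] d]]]] := iso_left_dist gi => A'; apply: post_bij_bounded_below d bC.
Qed.

Lemma Tp_iso (X Y : KI) (s : Hom X Y) :
  (forall A, acyc A -> pre_bij A s) -> is_iso (fmap (Tp F) s).
Proof.
apply: coresolved_iso => Z; have [A [m [g [aA gi]]]] := coresolution Z.
exists A, [k g]; split; [exact: aA | exact: Tp_far_iso gi |].
by have [C [v [w [[bC _] d]]]] := iso_right_dist gi => A'; apply: pre_bij_bounded_above d bC.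
Qed.

Lemma Tm_inverts (X Y : KI) (s : Hom X Y) :
  cone_in (@Kb F _ (@infty_b_shift F)) s -> is_iso (fmap (Tm F) s).
Proof. by move=> cs; apply: Tm_iso => A; apply: cone_in_post_bij. Qed.

Lemma Tp_inverts (X Y : KI) (s : Hom X Y) :
  cone_in (@Kb F _ (@infty_b_shift F)) s -> is_iso (fmap (Tp F) s).
Proof. by move=> cs; apply: Tp_iso => A; apply: cone_in_pre_bij. Qed.

Definition Lm : functor D Vm := verdier_lift Tm_inverts.
Definition Lp : functor D Vp := verdier_lift Tp_inverts.

Lemma Lm_quot (X Y : KI) (f : Hom X Y) : fmap Lm (fmap QD f) = fmap (Tm F) f.
Proof. exact: verdier_lift_quot. Qed.

Lemma Lp_quot (X Y : KI) (f : Hom X Y) : fmap Lp (fmap QD f) = fmap (Tp F) f.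
Proof. exact: verdier_lift_quot. Qed.

Local Notation Im := (minus_functor F).
Local Notation Ip := (plus_functor F).

Lemma Im_quot (X Y : @full_tri K _ (@minus_b_shift F)) (f : cmap (sval X) (sval Y)) :
  fmap Im (fmap Qm (kmor f)) = fmap QD (@kmor F _ (@infty_b_shift F) (Im X) (Im Y) f).
Proof. exact: verdier_lift_quot. Qed.

Lemma Ip_quot (X Y : @full_tri K _ (@plus_b_shift F)) (f : cmap (sval X) (sval Y)) :
  fmap Ip (fmap Qp (kmor f)) = fmap QD (@kmor F _ (@infty_b_shift F) (Ip X) (Ip Y) f).
Proof. exact: verdier_lift_quot. Qed.

Lemma ImLm_quot (X Y : KI) (f : cmap (sval X) (sval Y)) :
  fmap (functor_comp Im Lm) (fmap QD (kmor f)) =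
  fmap QD (@kmor F _ (@infty_b_shift F) (Im (Lm X)) (Im (Lm Y)) (trunc_map le0 f)).
Proof. exact: etrans (congr1 (fmap Im) (etrans (Lm_quot (kmor f)) (Tm_kcls f))) (Im_quot _). Qed.

Lemma IpLp_quot (X Y : KI) (f : cmap (sval X) (sval Y)) :
  fmap (functor_comp Ip Lp) (fmap QD (kmor f)) =
  fmap QD (@kmor F _ (@infty_b_shift F) (Ip (Lp X)) (Ip (Lp Y)) (trunc_map ge0 f)).
Proof. exact: etrans (congr1 (fmap Ip) (etrans (Lp_quot (kmor f)) (Tp_kcls f))) (Ip_quot _). Qed.

Lemma LmIm_quot (X Y : @full_tri K _ (@minus_b_shift F)) (f : cmap (sval X) (sval Y)) :
  fmap (functor_comp Lm Im) (fmap Qm (kmor f)) =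
  fmap Qm (@kmor F _ (@minus_b_shift F) (Lm (Im X)) (Lm (Im Y)) (trunc_map le0 f)).
Proof.
exact: etrans (congr1 (fmap Lm) (Im_quot f)) (etrans (Lm_quot _) (@Tm_kcls (Im X) (Im Y) f)).
Qed.

Lemma LpIp_quot (X Y : @full_tri K _ (@plus_b_shift F)) (f : cmap (sval X) (sval Y)) :
  fmap (functor_comp Lp Ip) (fmap Qp (kmor f)) =
  fmap Qp (@kmor F _ (@plus_b_shift F) (Lp (Ip X)) (Lp (Ip Y)) (trunc_map ge0 f)).
Proof.
exact: etrans (congr1 (fmap Lp) (Ip_quot f)) (etrans (Lp_quot _) (@Tp_kcls (Ip X) (Ip Y) f)).
Qed.

Lemma le0_down i : le0 (i + 1) -> le0 i. Proof. by rewrite /le0; lia. Qed.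
Lemma ge0_up i : ge0 i -> ge0 (i + 1). Proof. by rewrite /ge0; lia. Qed.

Definition pi_m (X : KI) : @Hom D X (Im (Lm X)) :=
  fmap QD (@kmor F _ (@infty_b_shift F) X (Im (Lm X)) (to_trunc le0_down (sval X))).

Definition iota_p (X : KI) : @Hom D (Ip (Lp X)) X :=
  fmap QD (@kmor F _ (@infty_b_shift F) (Ip (Lp X)) X (from_trunc ge0_up (sval X))).

(** By [verdier_natural] only maps of K^{oo,b} need checking, and on a chain map representing one
    the square commutes strictly. *)
Lemma pi_m_nat (X Y : D) (f : Hom X Y) : pi_m Y ∘ f = fmap Im (fmap Lm f) ∘ pi_m X.
Proof.
apply: (@verdier_natural _ _ D (functor_id D) (functor_comp Im Lm) pi_m) => {X Y f} X Y.
elim/kclsW=> f; rewrite [fmap (functor_comp _ _) _](@ImLm_quot X Y f).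
apply: etrans (@quot_kmor_comp _ _ _ X Y (Im (Lm Y)) _ f) _.
apply: etrans (esym (@quot_kmor_comp _ _ _ X (Im (Lm X)) (Im (Lm Y)) _ _)).
by rewrite to_trunc_nat.
Qed.

Lemma iota_p_nat (X Y : D) (f : Hom X Y) : f ∘ iota_p X = iota_p Y ∘ fmap Ip (fmap Lp f).
Proof.
apply/esym.
apply: (@verdier_natural _ _ D (functor_comp Ip Lp) (functor_id D) iota_p) => {X Y f} X Y.
elim/kclsW=> f; rewrite [fmap (functor_comp _ _) _](@IpLp_quot X Y f).
apply: etrans (@quot_kmor_comp _ _ _ (Ip (Lp X)) (Ip (Lp Y)) Y _ _) _.
apply: etrans (esym (@quot_kmor_comp _ _ _ (Ip (Lp X)) X Y f _)).
by rewrite from_trunc_nat.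
Qed.

Definition unit_m (X : Vm) : @Hom Vm X (Lm (Im X)) :=
  fmap Qm (@kmor F _ (@minus_b_shift F) X (Lm (Im X)) (to_trunc le0_down (sval X))).

Definition counit_p (X : Vp) : @Hom Vp (Lp (Ip X)) X :=
  fmap Qp (@kmor F _ (@plus_b_shift F) (Lp (Ip X)) X (from_trunc ge0_up (sval X))).

Lemma unit_m_iso (X : Vm) : is_iso (unit_m X).
Proof.
refine (vquot_iso _); apply: (@minus_far_iso _ _ _ _ 0) => i i0 _.
exact: to_trunc_iso.
Qed.

Lemma counit_p_iso (X : Vp) : is_iso (counit_p X).
Proof.
refine (vquot_iso _); apply: (@plus_far_iso _ _ _ _ 0) => i i0 _.
exact: from_trunc_iso.
Qed.

Lemma unit_m_nat (X Y : Vm) (f : Hom X Y) : unit_m Y ∘ f = fmap Lm (fmap Im f) ∘ unit_m X.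
Proof.
apply: (@verdier_natural _ _ Vm (functor_id Vm) (functor_comp Lm Im) unit_m) => {X Y f} X Y.
elim/kclsW=> f; rewrite [fmap (functor_comp _ _) _](@LmIm_quot X Y f).
apply: etrans (@quot_kmor_comp _ _ _ X Y (Lm (Im Y)) _ f) _.
apply: etrans (esym (@quot_kmor_comp _ _ _ X (Lm (Im X)) (Lm (Im Y)) _ _)).
by rewrite to_trunc_nat.
Qed.

Lemma counit_p_nat (X Y : Vp) (f : Hom X Y) :
  f ∘ counit_p X = counit_p Y ∘ fmap Lp (fmap Ip f).
Proof.
apply/esym.
apply: (@verdier_natural _ _ Vp (functor_comp Lp Ip) (functor_id Vp) counit_p) => {X Y f} X Y.
elim/kclsW=> f; rewrite [fmap (functor_comp _ _) _](@LpIp_quot X Y f).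
apply: etrans (@quot_kmor_comp _ _ _ (Lp (Ip X)) (Lp (Ip Y)) Y _ _) _.
apply: etrans (esym (@quot_kmor_comp _ _ _ (Lp (Ip X)) X Y f _)).
by rewrite from_trunc_nat.
Qed.

Lemma minus_ff : fully_faithful Im.
Proof.
have nI (X : Vm) : pi_m (Im X) = fmap Im (unit_m X) by rewrite [RHS]Im_quot.
exact: (@ff_unit _ _ Im Lm unit_m pi_m unit_m_iso unit_m_nat pi_m_nat nI).
Qed.

Lemma plus_ff : fully_faithful Ip.
Proof.
have nI (X : Vp) : iota_p (Ip X) = fmap Ip (counit_p X) by rewrite [RHS]Ip_quot.
apply: ff_op.
refine (@ff_unit _ _ (op_functor Ip) (op_functor Lp) counit_p iota_p _
  (fun (X Y : op Vp) f => counit_p_nat f) (fun (X Y : op D) f => @iota_p_nat Y X f)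
  (fun X : op Vp => nI X)) => X.
exact/is_iso_op/counit_p_iso.
Qed.

Lemma from_acyclic (A Y : KI) : acyc A ->
  (forall f : Hom A Y, fmap QD f = 0 -> f = 0) /\
  (forall g : @Hom D A Y, exists f : Hom A Y, fmap QD f = g).
Proof.
by move=> aA; apply: local_to_bijective => X Z s cs; apply: cone_in_post_bij.
Qed.

Lemma to_acyclic (A Y : KI) : acyc A ->
  (forall f : Hom Y A, fmap QD f = 0 -> f = 0) /\
  (forall g : @Hom D Y A, exists f : Hom Y A, fmap QD f = g).
Proof.
by move=> aA; apply: local_from_bijective => X Z s cs; apply: cone_in_pre_bij.
Qed.

Lemma acyclic_ff : fully_faithful (acyclic_functor F).
Proof.
pose i (X : K_infty_empty F) : KI := exist _ (sval X) (acyclic_infty_b (proj2_sig X)).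
apply: fully_faithfulP => X Y f.
  exact: (proj1 (@from_acyclic (i X) (i Y) (svalP X)) f).
exact: (proj2 (@from_acyclic (i X) (i Y) (svalP X)) f).
Qed.

End Resolutions.

Lemma isomorphic_sym (C : preadditive) (X Y : C) : isomorphic X Y -> isomorphic Y X.
Proof. by move=> [f [g [gf fg]]]; exists g, f. Qed.

Lemma isomorphic_trans (C : preadditive) (X Y Z : C) :
  isomorphic X Y -> isomorphic Y Z -> isomorphic X Z.
Proof. by move=> [f fi] [g gi]; exists (g ∘ f); apply: is_iso_comp. Qed.

Lemma isomorphic_functor (C D : preadditive) (G : functor C D) (X Y : C) :
  isomorphic X Y -> isomorphic (G X) (G Y).
Proof. by move=> [f fi]; exists (fmap G f); apply: fmap_iso. Qed.

(** * The stable t-structures *)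

Section Recollement.
Variable F : frobeniusCategory.
Local Notation P := (projectives F).
Local Notation K := (homotopyCategory P).
Implicit Types X Y Z : complex P.
Local Notation "[ 'k' g ]" := (kcls g : @Hom K _ _) (format "[ 'k'  g ]").
Local Notation KI := (K_infty_b F).
Local Notation D := (K_infty_b_mod_Kb F).
Local Notation kb := (@Kb F _ (@infty_b_shift F)).
Local Notation QD := (vquot kb).
Local Notation KE := (homotopy_exact P).

(** The three essential images in one form, with witnesses taken in K^{oo,b} so that only the
    underlying complex matters. *)
Definition ess (S : complex P -> Prop) (X : D) : Prop :=
  exists C : KI, S (sval C) /\ isomorphic (C : D) X.

Lemma ess_plus (X : D) : ess_image (plus_functor F) X <-> ess (@plus_b F) X.
Proof.
split=> [[[C pC] iC]|[[C iC] [/= pC CX]]].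
  by exists (plus_functor F (exist _ C pC)).
exists (exist _ C pC); suff -> : plus_functor F (exist _ C pC) = exist _ C iC by [].
by rewrite /=; congr exist; apply: Prop_irrelevance.
Qed.

Lemma ess_minus (X : D) : ess_image (minus_functor F) X <-> ess (@minus_b F) X.
Proof.
split=> [[[C pC] iC]|[[C iC] [/= pC CX]]].
  by exists (minus_functor F (exist _ C pC)).
exists (exist _ C pC); suff -> : minus_functor F (exist _ C pC) = exist _ C iC by [].
by rewrite /=; congr exist; apply: Prop_irrelevance.
Qed.

Lemma ess_acyclic (X : D) : ess_image (acyclic_functor F) X <-> ess (@acyclic F) X.
Proof.
split=> [[[C pC] iC]|[[C iC] [/= pC CX]]].
  by exists (acyclic_functor F (exist _ C pC)).
exists (exist _ C pC); suff -> : acyclic_functor F (exist _ C pC) = exist _ C iC by [].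
by rewrite /=; congr exist; apply: Prop_irrelevance.
Qed.

Lemma ess_iso S (X Y : D) : isomorphic X Y -> ess S X -> ess S Y.
Proof. by move=> XY [C [SC CX]]; exists C; split=> //; apply: isomorphic_trans XY. Qed.

Lemma ess_shift_stable (S : complex P -> Prop) :
  (forall X, S X -> infty_b X) -> (forall X, S X -> S (shift X)) ->
  (forall X, S (shift X) -> S X) -> shift_stable (ess S).
Proof.
move=> Si Ss Su X; split=> [[C [SC CX]]|[Y [[C [SC CY]] XY]]]; last first.
  exists (Sig C); split; first exact: Ss.
  apply: (isomorphic_trans (Y := Sig Y)); last exact: isomorphic_sym.
  exact: (isomorphic_functor (vSig (@Kb_Sig F _ (@infty_b_shift F))) CY).
case: C SC CX => C iC /= SC CX; have [C' eC] := shift_surj C.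
subst C; have SC' := Su _ SC; pose Y : KI := exist _ C' (Si _ SC').
exists Y; split; first by exists Y; split=> //; exists (idm _); apply: is_iso_id.
apply: isomorphic_sym; move: CX.
by rewrite (Prop_irrelevance iC (infty_b_shift (Si _ SC'))) => CX; exact: CX.
Qed.

Definition zero_complex : complex P.
Proof. by refine (@Complex P (fun=> zero P) (fun=> 0) _) => i; rewrite comp0m. Defined.

Lemma zero_complex_bounded : bounded zero_complex.
Proof. by split; exists 0 => i _; apply: (zero_is_zero P). Qed.

Lemma ess_zero S : S zero_complex -> exists2 X : D, is_zero X & ess S X.
Proof.
move=> Sz; pose Z : KI := exist _ zero_complex (bounded_infty_b zero_complex_bounded).
exists Z; first exact: (bounded_quot_zero (@bounded_infty_b F) (X := Z) zero_complex_bounded).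
by exists Z; split=> //; exists (idm _); apply: is_iso_id.
Qed.

Lemma acyclic_zero_complex : acyclic zero_complex.
Proof. by apply: acyclic_zero => i; apply: (zero_is_zero P). Qed.

(** * Orthogonality to acyclic complexes *)

Definition rperp (X : KI) := forall (A : KI), acyc A -> forall f : Hom A X, f = 0.
Definition lperp (X : KI) := forall (A : KI), acyc A -> forall f : Hom X A, f = 0.
Definition biperp (X Y : KI) (s : Hom X Y) :=
  forall A : KI, acyc A -> post_bij A s /\ pre_bij A s.

Lemma unshift_ob (A : KI) : acyc A -> exists A' : KI, acyc A' /\ A = Sig A'.
Proof.
case: A => A iA /= aA; have [A' e] := shift_surj A; subst A.
exists (exist _ A' (infty_b_unshift iA)); split; first exact: acyclic_unshift.
by rewrite /=; congr exist; apply: Prop_irrelevance.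
Qed.

(** Each acyclic complex is itself a suspension, so a map into [Sig X] desuspends. *)
Lemma rperp_shift (X : KI) : rperp X -> rperp (Sig X).
Proof.
move=> rX A /unshift_ob [A' [aA' ->]] f; have [g <-] := sig_surj KE f.
by rewrite (rX A' aA' g) fmap0.
Qed.

Lemma lperp_shift (X : KI) : lperp X -> lperp (Sig X).
Proof.
move=> rX A /unshift_ob [A' [aA' ->]] f; have [g <-] := sig_surj KE f.
by rewrite (rX A' aA' g) fmap0.
Qed.

Lemma biperp_shift (X Y : KI) (s : Hom X Y) : biperp s -> biperp (fmap Sig s).
Proof.
move=> bs A /unshift_ob [A' [aA' ->]]; have [[i1 s1] [i2 s2]] := bs A' aA'.
split; split=> f.
- have [g <-] := sig_surj KE f.
  rewrite -[X in X = 0](fmapM (Sig : functor KI KI)) => /(sig_inj KE)/i1 ->.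
  by rewrite fmap0.
- have [g <-] := sig_surj KE f; have [x <-] := s1 g; exists (fmap Sig x).
  by rewrite -[LHS](fmapM (Sig : functor KI KI)).
- have [g <-] := sig_surj KE f.
  rewrite -[X in X = 0](fmapM (Sig : functor KI KI)) => /(sig_inj KE)/i2 ->.
  by rewrite fmap0.
- have [g <-] := sig_surj KE f; have [x <-] := s2 g; exists (fmap Sig x).
  by rewrite -[LHS](fmapM (Sig : functor KI KI)).
Qed.

Section Cones.
Variables (X Y Z : KI) (u : Hom X Y) (v : Hom Y Z) (w : Hom Z (Sig X)).
Hypothesis d : dist u v w.

Lemma rperp_cone : rperp X -> rperp Y -> rperp Z.
Proof.
move=> rX rY A aA f; have [|y vy] := tri_ex2 KE d (g := f).
  exact: (rperp_shift rX aA (w ∘ f)).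
by rewrite -vy (rY A aA y) compm0.
Qed.

Lemma lperp_cone : lperp X -> lperp Y -> lperp Z.
Proof.
move=> lX lY A aA f; have [|y wy] := tri_coex2 KE d (g := f).
  exact: (lY A aA (f ∘ v)).
by rewrite -wy (lperp_shift lX aA y) comp0m.
Qed.

Lemma biperp_cone_rperp : biperp u -> rperp Z.
Proof.
move=> bu A aA; apply: (cone_post_zero KE d (A := sval A)).
  exact: (bu A aA).1.
exact: (biperp_shift bu aA).1.
Qed.

Lemma biperp_cone_lperp : biperp u -> lperp Z.
Proof.
move=> bu A aA; apply: (cone_pre_zero KE d (A := sval A)).
  exact: (bu A aA).2.
exact: (biperp_shift bu aA).2.
Qed.

End Cones.

Lemma vdist_quot (X Y Z : KI) (u : Hom X Y) (v : Hom Y Z) (w : Hom Z (Sig X)) :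
  dist u v w -> @dist D X Y Z (fmap QD u) (fmap QD v) (fmap QD w).
Proof. by move=> d; exists X, Y, Z, u, v, w; split=> //; apply: tri_iso_refl. Qed.

Lemma quot_iso (X Y : KI) : @isomorphic K (sval X) (sval Y) -> isomorphic (X : D) Y.
Proof. by move=> [f fi]; exists (fmap QD (f : @Hom KI X Y)); apply: (fmap_iso QD). Qed.

Lemma rperp_iso (X Y : KI) : isomorphic (X : D) Y -> rperp X -> rperp Y.
Proof.
move=> [a [b [ba ab]]] rX A aA f; apply: (proj1 (@from_acyclic F A Y aA) f).
have [g gE] := proj2 (@from_acyclic F A X aA) (b ∘ fmap QD f).
by rewrite -[LHS]comp1m -ab -compA -gE (rX A aA g) fmap0 compm0.
Qed.

Lemma lperp_iso (X Y : KI) : isomorphic (X : D) Y -> lperp X -> lperp Y.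
Proof.
move=> [a [b [ba ab]]] lX A aA f; apply: (proj1 (@to_acyclic F A Y aA) f).
have [g gE] := proj2 (@to_acyclic F A X aA) (fmap QD f ∘ a).
by rewrite -[LHS]compm1 -ab compA -gE (lX A aA g) fmap0 comp0m.
Qed.

(** If acyclic complexes have no maps to [X], its resolution by an acyclic complex is the zero map,
    and [X] is isomorphic to the bounded below third term of the triangle. *)
Lemma ess_plusP (X : KI) : ess (@plus_b F) X <-> rperp X.
Proof.
split=> [[C [[bC _] CX]]|rX].
  apply: rperp_iso CX _ => A aA f; exact: acyclic_to_plus aA bC.
have [A [m [g [aA gi]]]] := resolution X.
have [Z [v [w [pZ d]]]] := iso_left_dist gi.
exists Z; split=> //; apply/isomorphic_sym/quot_iso; exists v.
apply: (tri_iso_right KE d) => [f|].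
  exact: (@acyclic_to_plus F (Sig A) Z f (acyclic_shift aA) pZ.1).
exact: (rX A aA ([k g] : @Hom KI A X)).
Qed.

Lemma shift_ob (X : KI) : exists X' : KI, X = Sig X'.
Proof.
case: X => X iX; have [X' e] := shift_surj X; subst X.
exists (exist _ X' (infty_b_unshift iX)).
by rewrite /=; congr exist; apply: Prop_irrelevance.
Qed.

(* Rotate a coresolution of the desuspension of X. *)
Lemma minus_acyclic_dist (X : KI) : exists (C A : KI) (u : Hom C X) (v : Hom X A)
  (w : Hom A (Sig C)), [/\ minus_b (sval C), acyc A & dist u v w].
Proof.
have [X' ->] := shift_ob X; have [A [m [g [aA gi]]]] := coresolution X'.
have [Z [v [w [pZ d]]]] := iso_right_dist gi.
exists Z, (Sig A), w, (- fmap Sig ([k g] : @Hom KI X' A)), (- fmap Sig v); split=> //.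
  exact: acyclic_shift.
exact: (tri_rot KE (tri_rot KE d)).
Qed.

(** Here the map from [X] to the acyclic term vanishes, so the bounded above first term is
    isomorphic to [X]. *)
Lemma ess_minusP (X : KI) : ess (@minus_b F) X <-> lperp X.
Proof.
split=> [[C [[bC _] CX]]|lX].
  apply: lperp_iso CX _ => A aA f; exact: minus_to_acyclic bC aA.
have [C [A [u [v [w [pC aA d]]]]]] := minus_acyclic_dist X.
exists C; split=> //; apply/quot_iso; exists u.
apply: (tri_iso_left KE d) => [f|].
  exact: (@minus_to_acyclic F (Sig C) A f (bounded_above_shift pC.1) aA).
exact: (lX A aA v).
Qed.

Lemma quot_iso_biperp (X Y : KI) (s : Hom X Y) : is_iso (fmap QD s) -> biperp s.
Proof.
move=> [t [ts st]] A aA; split; split.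
- move=> x sx; apply: (proj1 (@from_acyclic F A X aA) x).
  by rewrite -[LHS]comp1m -ts -compA -fmapM sx fmap0 compm0.
- move=> y; have [x xE] := proj2 (@from_acyclic F A X aA) (t ∘ fmap QD y); exists x.
  apply/eqP; rewrite -subr_eq0; apply/eqP/(proj1 (@from_acyclic F A Y aA)).
  by rewrite fmapD fmapN fmapM xE compA st comp1m subrr.
- move=> y ys; apply: (proj1 (@to_acyclic F A Y aA) y).
  by rewrite -[LHS]compm1 -st compA -fmapM ys fmap0 comp0m.
- move=> x; have [y yE] := proj2 (@to_acyclic F A Y aA) (fmap QD x ∘ t); exists y.
  apply/eqP; rewrite -subr_eq0; apply/eqP/(proj1 (@to_acyclic F A X aA)).
  by rewrite fmapD fmapN fmapM yE -compA ts compm1 subrr.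
Qed.


Lemma pi_m_iso (X : KI) : bounded_above (sval X) -> is_iso (pi_m X).
Proof.
move=> bX; refine (vquot_iso _).
apply: (cone_in_trunc (@bounded_infty_b F) (r := le0)).
- by move=> i i0; apply: to_trunc_iso.
- by move=> i i0; rewrite le0_down.
- have bt Z : bounded_above Z -> bounded (trunc (fun i => ~~ le0 i) Z).
    move=> bZ; split; last exact: trunc_bounded_above.
    by exists 0 => i i0; apply: trunc_zero; apply/orP; left; rewrite /le0; lia.
  by apply: bounded_cone; apply: bt => //; apply: (trunc_le_bounded_above 0).
Qed.

Lemma iota_p_iso (X : KI) : bounded_below (sval X) -> is_iso (iota_p X).
Proof.
move=> bX; refine (vquot_iso _).
apply: (cone_in_trunc (@bounded_infty_b F) (r := ge0)).
- by move=> i i0; apply: from_trunc_iso.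
- by move=> i i0; rewrite (ge0_up i0) orbT.
- have bt Z : bounded_below Z -> bounded (trunc (fun i => ~~ ge0 i) Z).
    move=> bZ; split; first exact: trunc_bounded_below.
    by exists 0 => i i0; apply: trunc_zero; apply/orP; left; rewrite /ge0; lia.
  by apply: bounded_cone; apply: bt => //; apply: (trunc_ge_bounded_below 0).
Qed.

(** By naturality of [iota_p], the map factors through the part of [Y] in degrees at least 0. That
    part is bounded because [Y] is bounded above, and [iota_p X] is invertible because [X] is
    bounded below. *)
Lemma plus_minus_zero (X Y : KI) (f : @Hom D X Y) :
  bounded_below (sval X) -> bounded_above (sval Y) -> f = 0.
Proof.
move=> bX aY; apply: (iso_cancel_r (iota_p_iso bX)); rewrite comp0m iota_p_nat.
have bLY : bounded (sval (Lp F (Y : D))).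
  by split; [apply: (trunc_ge_bounded_below 0) | apply: trunc_bounded_above].
have z := bounded_quot_zero (@bounded_plus_b F) (X := Lp F (Y : D)) bLY.
by rewrite -[fmap (Lp F) f]comp1m z comp0m fmap0 compm0.
Qed.

(* The map g has a left inverse h in K, and 1 - gh factors through the cone of g, which
   is zero in D: it is isomorphic both to a bounded below and to a bounded above complex. *)
Lemma biperp_iso (A X : KI) (g : Hom A X) : acyc A -> biperp g -> is_iso (fmap QD g).
Proof.
elim/kclsW: g => g aA bg.
pose N : KI := exist _ (cone g) (infty_b_cone g (svalP A) (svalP X)).
have d : @dist KI A X N [k g] [k cone_inr g] [k cone_prl g] by apply: kdist_cone.
have /ess_plusP [B [[bB _] [b ib]]] := biperp_cone_rperp d bg.
have /ess_minusP [C [[bC _] [c ic]]] := biperp_cone_lperp d bg.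
have [b' [_ _ bb']] := iso_inverse ib; have [c' [_ _ cc']] := iso_inverse ic.
have N0 : idm (N : D) = 0.
  have h : c' ∘ b = 0 by apply: plus_minus_zero.
  have -> : idm (N : D) = c ∘ (c' ∘ b) ∘ b' by rewrite compA cc' comp1m bb'.
  by rewrite h compm0 comp0m.
have [h hg] := (bg A aA).2.2 (idm A).
exists (fmap QD h); split; first by rewrite -fmapM hg fmap1.
have [r re] : exists r : Hom N X, r ∘ ([k cone_inr g] : @Hom KI X N) =
    idm X - ([k g] : @Hom KI A X) ∘ h.
  apply: (tri_coex1 KE d (g := idm X - ([k g] : @Hom KI A X) ∘ h)).
  rewrite [LHS]compDl compNm -compA; apply/eqP; rewrite subr_eq0; apply/eqP.
  by rewrite comp1m [X in _ = _ ∘ X]hg compm1.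
have : fmap QD (idm X - ([k g] : @Hom KI A X) ∘ h) = 0.
  by rewrite -re fmapM -[fmap QD r]compm1 N0 compm0 comp0m.
by rewrite fmapD fmapN fmapM fmap1 => /eqP; rewrite subr_eq0 => /eqP/esym.
Qed.

Lemma ess_acyclicP (X : KI) : ess (@acyclic F) X <->
  exists (A : KI) (g : Hom A X), acyc A /\ biperp g.
Proof.
split=> [[A [aA [a ia]]]|[A [g [aA bg]]]].
  have [g gE] := proj2 (@from_acyclic F A X aA) a.
  by exists A, g; split=> //; apply: quot_iso_biperp; rewrite gE.
by exists A; split=> //; exists (fmap QD g); apply: biperp_iso.
Qed.

(** * Triangulated subcategories and decomposition triangles *)

Lemma ess_tri_sub (S : complex P -> Prop) :
  (forall X, S X -> infty_b X) -> (forall X, S X -> S (shift X)) ->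
  (forall X, S (shift X) -> S X) -> S zero_complex ->
  (forall (X Y Z : KI) (u : Hom X Y) (v : Hom Y Z) (w : Hom Z (Sig X)),
     dist u v w -> ess S X -> ess S Y -> ess S Z) ->
  triangulated_sub (ess S).
Proof.
move=> S1 S2 S3 S4 S5; split.
- exact: ess_zero.
- exact: ess_iso.
- exact: ess_shift_stable.
- move=> X Y Z u v w [X' [Y' [Z' [u' [v' [w' [d [a [b [c [[ia ib ic] _]]]]]]]]]]] SX SY.
  apply: (ess_iso (X := Z')); first by apply: isomorphic_sym; exists c.
  by apply: S5 d _ _; [apply: ess_iso SX; exists a | apply: ess_iso SY; exists b].
Qed.

Lemma plus_tri_sub : triangulated_sub (ess (@plus_b F)).
Proof.
apply: ess_tri_sub.
- exact: plus_infty_b.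
- exact: plus_b_shift.
- exact: plus_b_unshift.
- exact/bounded_plus_b/zero_complex_bounded.
- by move=> X Y Z u v w d /ess_plusP rX /ess_plusP rY; apply/ess_plusP; apply: rperp_cone d rX rY.
Qed.

Lemma minus_tri_sub : triangulated_sub (ess (@minus_b F)).
Proof.
apply: ess_tri_sub.
- exact: minus_infty_b.
- exact: minus_b_shift.
- exact: minus_b_unshift.
- exact/bounded_minus_b/zero_complex_bounded.
- by move=> X Y Z u v w d /ess_minusP rX /ess_minusP rY; apply/ess_minusP; apply: lperp_cone d rX rY.
Qed.

(** Since Hom(A, -) inverts [b], the map [u ∘ a] lifts to a map [h] of acyclic complexes. The cone
    of [h] is acyclic, and the five lemma shows that its map to [Z] is bijective for acyclic
    complexes on both sides. *)
Lemma acyclic_tri_sub : triangulated_sub (ess (@acyclic F)).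
Proof.
apply: ess_tri_sub.
- exact: acyclic_infty_b.
- exact: acyclic_shift.
- exact: acyclic_unshift.
- exact: acyclic_zero_complex.
- move=> X Y Z u v w d /ess_acyclicP [A [a [aA ba]]] /ess_acyclicP [B [b [aB bb]]].
  apply/ess_acyclicP; have [h] := (bb A aA).1.2 (u ∘ a); elim/kclsW: h => h e.
  pose C : KI := exist _ (cone h) (infty_b_cone h (svalP A) (svalP B)).
  have d' : @dist KI A B C [k h] [k cone_inr h] [k cone_prl h] by apply: kdist_cone.
  have [c [e1 e2]] := tri_map KE d' d (a := a) (b := b) e.
  exists C, c; split; first exact: acyclic_cone.
  have sa := biperp_shift ba; have sb := biperp_shift bb.
  move=> A' aA'; split.
    by apply: (post_bij_cone KE d' d e e1 e2 (A := sval A')); [case: (ba _ aA') | case: (bb _ aA')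
      | case: (sa _ aA') | case: (sb _ aA')].
  by apply: (pre_bij_cone KE d' d e e1 e2 (A := sval A')); [case: (ba _ aA') | case: (bb _ aA')
      | case: (sa _ aA') | case: (sb _ aA')].
Qed.

Lemma ess_t_structure (S S' : complex P -> Prop) :
  shift_stable (ess S) -> shift_stable (ess S') ->
  (forall (X Y : KI) (f : @Hom D X Y), S (sval X) -> S' (sval Y) -> f = 0) ->
  (forall X : KI, exists (A B : KI) (u : Hom A X) (v : Hom X B) (w : Hom B (Sig A)),
     [/\ S (sval A), S' (sval B) & dist u v w]) ->
  stable_t_structure (ess S) (ess S').
Proof.
move=> h1 h2 h0 hd; split=> //.
  move=> X Y f [X' [SX [a ia]]] [Y' [SY [b ib]]]; have [b' [ib' b'b bb']] := iso_inverse ib.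
  apply: (iso_cancel_r ia); apply: (iso_cancel_l ib').
  by rewrite comp0m compm0; apply: h0.
move=> X; have [A [B [u [v [w [SA SB d]]]]]] := hd X.
exists A, B, (fmap QD u), (fmap QD v), (fmap QD w); split; last exact: vdist_quot.
  by exists A; split=> //; exists (idm _); apply: is_iso_id.
by exists B; split=> //; exists (idm _); apply: is_iso_id.
Qed.

Lemma plus_minus_t : stable_t_structure (ess (@plus_b F)) (ess (@minus_b F)).
Proof.
have [_ _ sp _] := plus_tri_sub; have [_ _ sm _] := minus_tri_sub.
apply: ess_t_structure => // [X Y f [bX _] [aY _]|X]; first exact: plus_minus_zero.
pose A : KI := exist _ (trunc ge0 (sval X)) (plus_infty_b (plus_b_trunc (svalP X))).
(* The inclusion of the truncation is an isomorphism in degrees at least 0, so its cone can be taken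
   bounded above. *)
have [|Z [v [w [mZ d]]]] := @iso_right_dist F A X 0 (from_trunc ge0_up (sval X)).
  by move=> i; apply: from_trunc_iso.
exists A, Z, [k from_trunc ge0_up (sval X)], v, w; split=> //.
exact: plus_b_trunc (svalP X).
Qed.

Lemma minus_acyclic_t : stable_t_structure (ess (@minus_b F)) (ess (@acyclic F)).
Proof.
have [_ _ sm _] := minus_tri_sub; have [_ _ sa _] := acyclic_tri_sub.
apply: ess_t_structure => // [X Y f [bX _] aY|X].
  have [g <-] := proj2 (@to_acyclic F Y X aY) f.
  by rewrite (minus_to_acyclic g bX aY) fmap0.
by have [C [A [u [v [w [mC aA d]]]]]] := minus_acyclic_dist X; exists C, A, u, v, w.
Qed.

Lemma acyclic_plus_t : stable_t_structure (ess (@acyclic F)) (ess (@plus_b F)).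
Proof.
have [_ _ sp _] := plus_tri_sub; have [_ _ sa _] := acyclic_tri_sub.
apply: ess_t_structure => // [X Y f aX [bY _]|X].
  have [g <-] := proj2 (@from_acyclic F X Y aX) f.
  by rewrite (acyclic_to_plus g aX bY) fmap0.
have [A [m [g [aA gi]]]] := resolution X; have [Z [v [w [pZ d]]]] := iso_left_dist gi.
by exists A, Z, [k g], v, w.
Qed.

Lemma recollement_triangle : @triangle_of_recollements D
  (ess_image (plus_functor F)) (ess_image (minus_functor F)) (ess_image (acyclic_functor F)).
Proof.
have e1 : ess_image (plus_functor F) = ess (@plus_b F).
  by apply: funext => X; apply/propext/ess_plus.
have e2 : ess_image (minus_functor F) = ess (@minus_b F).
  by apply: funext => X; apply/propext/ess_minus.
have e3 : ess_image (acyclic_functor F) = ess (@acyclic F).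
  by apply: funext => X; apply/propext/ess_acyclic.
rewrite e1 e2 e3; split.
  by split; [apply: plus_tri_sub | apply: minus_tri_sub | apply: acyclic_tri_sub].
by split; [apply: plus_minus_t | apply: minus_acyclic_t | apply: acyclic_plus_t].
Qed.

End Recollement.

(** * The triangle equivalences *)

Section TruncShift.
Variables (A : additive) (p : pred int) (X : complex A).

Lemma trunc_shift_to_trunc (p_down : forall i, p (i + 1) -> p i) :
  cmap_comp (trunc_shift p X) (to_trunc p_down (shift X)) = cmap_shift (to_trunc p_down X).
Proof.
apply: cmap_ext => i /=; have := @p_down i; rewrite /trunc_ob.
by case: (p i); case: (p (i + 1)) => /= h; rewrite ?(comp1m, compm1, compm0) //; case: (notF (h isT)).
Qed.

Lemma from_trunc_trunc_shift (p_up : forall i, p i -> p (i + 1)) :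
  cmap_comp (cmap_shift (from_trunc p_up X)) (trunc_shift p X) = from_trunc p_up (shift X).
Proof.
apply: cmap_ext => i /=; have := @p_up i; rewrite /trunc_ob.
by case: (p i); case: (p (i + 1)) => /= h; rewrite ?(comp1m, compm1, compm0) //; case: (notF (h isT)).
Qed.

End TruncShift.

Section Equivalences.
Variable F : frobeniusCategory.
Local Notation P := (projectives F).
Local Notation K := (homotopyCategory P).
Implicit Types X Y Z : complex P.
Local Notation "[ 'k' g ]" := (kcls g : @Hom K _ _) (format "[ 'k'  g ]").
Local Notation KI := (K_infty_b F).
Local Notation W := (K_infty_empty F).
Local Notation Vm := (K_minus_b_mod_Kb F).
Local Notation Vp := (K_plus_b_mod_Kb F).
Local Notation QD := (vquot (@Kb F _ (@infty_b_shift F))).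
Local Notation Km := (@full_tri K _ (@minus_b_shift F)).
Local Notation Kp := (@full_tri K _ (@plus_b_shift F)).
Local Notation Qm := (vquot (@Kb F _ (@minus_b_shift F))).
Local Notation Qp := (vquot (@Kb F _ (@plus_b_shift F))).
Local Notation Im := (minus_functor F).
Local Notation Ip := (plus_functor F).
Local Notation Lm := (Lm F).
Local Notation Lp := (Lp F).
Local Notation KE := (homotopy_exact P).

Definition acyclic_inc : functor W KI :=
  @full_inc K _ _ (@acyclic_shift F) (@infty_b_shift F) (@acyclic_infty_b F).

(** The two sides are the same complex with different membership proofs, hence the identity of the
    underlying complex. *)
Definition acyclic_inc_shift (X : W) : Hom (acyclic_inc (Sig X)) (Sig (acyclic_inc X)) :=
  @idm K (shift (sval X)).

Definition acyclic_tri_inc : triFunctor W KI.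
Proof.
refine (@TriFunctor W KI acyclic_inc acyclic_inc_shift _ _ _).
- by move=> X; apply: (@is_iso_id K).
- by move=> X Y f; rewrite [LHS](@comp1m K) [RHS](@compm1 K).
- by move=> X Y Z u v w d; rewrite [X in dist _ _ X](@comp1m K).
Defined.

Local Notation J := acyclic_tri_inc.

Definition TmW : triFunctor W Vm := triFunctor_comp (Tm F) J.
Definition TpW : triFunctor W Vp := triFunctor_comp (Tp F) J.

Lemma W_iso_closed : iso_closed W.
Proof.
move=> X Y Z X' Y' Z' u v w u' v' w' t d.
exact: (@kdist_iso P _ _ _ _ _ _ u v w u' v' w' t d).
Qed.

Lemma J_shift1m (X : W) (Y : KI) (f : @Hom KI Y (J (Sig X))) : trif_shift J X ∘ f = f.
Proof. exact: (@comp1m K). Qed.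

Lemma comp_J_shift (V : triangulation) (G : triFunctor KI V) (A C : W) (j : Hom C (Sig A)) :
  trif_shift (triFunctor_comp G J) A ∘ fmap (triFunctor_comp G J) j =
  trif_shift G (J A) ∘ fmap G (fmap J j : Hom (J C) (Sig (J A))).
Proof. by rewrite -[in RHS](J_shift1m (fmap J j)) fmapM compA. Qed.

Lemma acyc_ob (A : KI) : acyc A -> exists A' : W, J A' = A.
Proof.
case: A => A iA /= aA; exists (exist _ A aA).
by rewrite /=; congr exist; apply: Prop_irrelevance.
Qed.

Lemma acyc_J (A : W) : acyc (J A). Proof. exact: proj2_sig A. Qed.

(** * Acyclic complexes and the bounded above quotient *)

Section Minus.

Definition kpi (X : KI) : @Hom KI X (Im (Lm X)) := [k to_trunc le0_down (sval X)].

(** The truncation map is an isomorphism in degrees at most 0; the remaining bounded below cone is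
    invisible to acyclic complexes. *)
Lemma kpi_post_bij (A X : KI) : acyc A -> post_bij A (kpi X).
Proof.
have [|Z [v [w [[bZ _] d]]]] := @iso_left_dist F X (Im (Lm X)) 0 (to_trunc le0_down (sval X)).
  by move=> i; exact: (@to_trunc_iso P le0 le0_down (sval X) i).
exact: post_bij_bounded_below d bZ.
Qed.

Lemma Tm_kpi_iso (X : KI) : is_iso (fmap (Tm F) (kpi X)).
Proof.
apply: (@Tm_far_iso F X (Im (Lm X)) 0 (to_trunc le0_down (sval X))) => i.
exact: (@to_trunc_iso P le0 le0_down (sval X) i).
Qed.

Lemma acyclic_resolution (X : KI) : exists (A : KI) (g : Hom A X),
  [/\ acyc A, is_iso (fmap (Tm F) g), forall A', acyc A' -> post_bij A' g &
      forall A', acyc A' -> post_bij A' (fmap Sig g)].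
Proof.
have [A [m [g [aA gi]]]] := resolution X; exists A, [k g].
have [Z [v [w [[bZ _] d]]]] := iso_left_dist gi; split=> //.
- exact: Tm_far_iso gi.
- by move=> A' aA'; apply: post_bij_bounded_below d bZ aA'.
- move=> A' aA'; refine (post_bij_bounded_below (dist_susp d) _ aA').
  exact: bounded_below_shift.
Qed.

(** A map between truncations of acyclic complexes, composed with [pi_m], starts at the acyclic
    [J A]. It therefore comes from K^{oo,b} and lifts uniquely through [kpi] to a map of acyclic
    complexes. *)
Lemma TmW_ff : fully_faithful TmW.
Proof.
apply: fully_faithfulP => A B f.
  move=> Tf0; have aA := acyc_J A.
  apply: (kpi_post_bij (J B) aA).1; apply: (proj1 (from_acyclic _ aA)).
  rewrite fmapM [LHS](pi_m_nat (fmap QD (fmap J f))) Lm_quot.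
  by rewrite (_ : fmap (Tm F) _ = 0) // fmap0 comp0m.
have aA := acyc_J A.
have [g gE] := proj2 (from_acyclic (Im (Lm (J B))) aA) (fmap Im f ∘ pi_m (J A)).
have [h hE] := (kpi_post_bij (J B) aA).2 g; exists (h : @Hom W A B).
apply/eqP; rewrite -subr_eq0; apply/eqP; set y := _ - _.
have y0 : fmap Im y ∘ pi_m (J A) = 0.
  have e : fmap Im (fmap TmW (h : @Hom W A B)) ∘ pi_m (J A) = fmap Im f ∘ pi_m (J A).
    rewrite -gE -hE fmapM [RHS](pi_m_nat (fmap QD h)) Lm_quot.
    by [].
  by rewrite /y fmapD fmapN compDl compNm e subrr.
(* [pi_m (J A)] is not invertible in the quotient, but [Lm] makes it so; [y] itself is then
   recovered through [pi_m], invertible on the bounded above target. *)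
have Ly0 : fmap Lm (fmap Im y) = 0.
  have := Tm_kpi_iso (J A); rewrite -Lm_quot => i.
  apply: (iso_cancel_r i); rewrite comp0m.
  apply: etrans (esym (fmapM Lm (fmap Im y) (pi_m (J A)))) _.
  by rewrite y0 fmap0.
apply: (ff_inj (@minus_ff F)); rewrite fmap0.
have i : is_iso (pi_m (Im (TmW B))) by apply: pi_m_iso; apply: (trunc_le_bounded_above 0).
by apply: (iso_cancel_l i); rewrite pi_m_nat Ly0 fmap0 comp0m compm0.
Qed.

Lemma TmW_es (Y : Vm) : ess_image TmW Y.
Proof.
have [A [g [aA gi _ _]]] := acyclic_resolution (Im Y).
have [A' e] := acyc_ob aA; exists A'.
apply: (isomorphic_trans (Y := Tm F (Im Y))); last first.
  by apply: isomorphic_sym; exists (unit_m Y); apply: unit_m_iso.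
have -> : TmW A' = Tm F A by rewrite -e.
by exists (fmap (Tm F) g).
Qed.

(** Resolve the first two terms, lift [u], and take the cone. By the five lemma the induced map of
    third terms is seen as an isomorphism by acyclic complexes, so [Tm_iso] inverts its
    truncation. *)
Lemma TmW_resolve (X Y Z : KI) (u : Hom X Y) (v : Hom Y Z) (w : Hom Z (Sig X)) :
  dist u v w -> exists (A B C : W) (h : Hom A B) (i : Hom B C) (j : Hom C (Sig A)), dist h i j /\
    tri_iso (fmap (Tm F) u) (fmap (Tm F) v) (trif_shift (Tm F) X ∘ fmap (Tm F) w)
      (fmap TmW h) (fmap TmW i) (trif_shift TmW A ∘ fmap TmW j).
Proof.
move=> d; have [A0 [a [aA ia pa sa]]] := acyclic_resolution X.
have [A e] := acyc_ob aA; subst A0.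
have [B0 [b [aB ib pb sb]]] := acyclic_resolution Y.
have [B e] := acyc_ob aB; subst B0.
have [h] := (pb _ aA).2 (u ∘ a); elim/kclsW: h => h e.
pose C : W := exist _ (cone h) (acyclic_cone h aA aB).
have d' : @dist KI (J A) (J B) (J C) [k h] [k cone_inr h] [k cone_prl h] by apply: kdist_cone.
have [c [e1 e2]] := tri_map KE d' d (a := a) (b := b) e.
have ic : is_iso (fmap (Tm F) (c : @Hom KI (J C) Z)).
  apply: Tm_iso => A' aA'.
  exact: (post_bij_cone KE d' d e e1 e2 (A := sval A') (pa _ aA') (pb _ aA') (sa _ aA') (sb _ aA')).
exists A, B, C, [k h], [k cone_inr h], [k cone_prl h]; split; first exact: kdist_cone.
apply: tri_iso_sym; exists (fmap (Tm F) a), (fmap (Tm F) b), (fmap (Tm F) (c : @Hom KI (J C) Z)).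
split=> //; split.
- apply: etrans (esym (fmapM (Tm F) b [k h])) _; apply: etrans (fmapM (Tm F) u a).
  by congr (fmap (Tm F) _).
- apply: etrans (esym (fmapM (Tm F) (c : @Hom KI (J C) Z) [k cone_inr h])) _.
  by apply: etrans (fmapM (Tm F) v b); congr (fmap (Tm F) _).
- rewrite comp_J_shift compA -trif_shift_nat.
  rewrite -[LHS]compA -[RHS]compA; congr (_ ∘ _).
  pose j : @Hom KI (J C) (Sig (J A)) := [k cone_prl h].
  refine (etrans (esym (fmapM (Tm F) (fmap Sig (a : @Hom KI (J A) X)) j)) _).
  refine (etrans _ (fmapM (Tm F) w (c : @Hom KI (J C) Z))).
  congr (fmap (Tm F) _); exact: e2.
Qed.

(* The index [i] leaves the proof that X lies in K^{oo,b} free: Im (Sig X) and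
   Sig (Im X) only agree up to that proof. *)
Definition trunc_unit (X : Km) (i : infty_b (sval X)) : @Hom Vm X (Tm F (exist _ (sval X) i)) :=
  fmap Qm (@kmor F _ (@minus_b_shift F) X (Tm F (exist _ (sval X) i)) (to_trunc le0_down (sval X))).

Lemma trunc_unit_iso (X : Km) i : is_iso (@trunc_unit X i).
Proof.
refine (vquot_iso _); apply: (@minus_far_iso _ _ _ _ 0) => j j0 _.
exact: to_trunc_iso.
Qed.

Lemma trunc_unit_nat (X Y : Km) i j (u : Hom X Y) :
  @trunc_unit Y j ∘ fmap Qm u =
  fmap (Tm F) (u : @Hom KI (exist _ (sval X) i) (exist _ (sval Y) j)) ∘ @trunc_unit X i.
Proof.
elim/kclsW: u => u; rewrite (@Tm_kcls F (exist _ _ i) (exist _ _ j) u).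
pose TX := Tm F (exist _ (sval X) i) : Km; pose TY := Tm F (exist _ (sval Y) j) : Km.
apply: etrans (@quot_kmor_comp F _ _ X Y TY _ u) _.
apply: etrans (esym (@quot_kmor_comp F _ _ X TX TY _ _)).
by rewrite to_trunc_nat.
Qed.

Lemma trunc_unit_shift (X : Km) (i : infty_b (sval X)) :
  trif_shift (Tm F) (exist _ (sval X) i) ∘ @trunc_unit (Sig X) (infty_b_shift i) =
  fmap Sig (@trunc_unit X i).
Proof.
pose TX : Km := Tm F (exist _ (sval X) i).
pose TSX : Km := Tm F (exist _ (sval (Sig X)) (infty_b_shift i)).
apply: etrans (@quot_kmor_comp F _ (@minus_b_shift F) (Sig X : Km) TSX (Sig TX : Km) _ _) _.
apply: etrans (esym (vSig_quot (@Kb_Sig F _ (@minus_b_shift F)) _)).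
congr (fmap Qm _); apply: etrans (esym (kSig_kcls _)); congr kcls.
exact: trunc_shift_to_trunc.
Qed.

(** A triangle of the quotient comes from K^{-,b}. There [trunc_unit] identifies it with its own
    truncation, to which [TmW_resolve] applies. *)
Lemma TmW_dist (X Y Z : Vm) (u : Hom X Y) (v : Hom Y Z) (w : Hom Z (Sig X)) :
  dist u v w -> exists (A B C : W) (h : Hom A B) (i : Hom B C) (j : Hom C (Sig A)), dist h i j /\
    tri_iso u v w (fmap TmW h) (fmap TmW i) (trif_shift TmW A ∘ fmap TmW j).
Proof.
move=> [X1 [Y1 [Z1 [u1 [v1 [w1 [d t]]]]]]].
have iX := minus_infty_b (svalP X1); have iY := minus_infty_b (svalP Y1).
have iZ := minus_infty_b (svalP Z1).
pose X2 : KI := exist _ (sval X1) iX; pose Y2 : KI := exist _ (sval Y1) iY.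
pose Z2 : KI := exist _ (sval Z1) iZ.
have [A [B [C [h [i [j [d' t']]]]]]] := @TmW_resolve X2 Y2 Z2 u1 v1 w1 d.
exists A, B, C, h, i, j; split=> //; apply: tri_iso_trans t (tri_iso_trans _ t').
exists (trunc_unit iX), (trunc_unit iY), (trunc_unit iZ); split.
  by split; apply: trunc_unit_iso.
split; try exact: trunc_unit_nat.
rewrite -trunc_unit_shift; apply: etrans (esym (compA _ _ _)) _.
by rewrite (@trunc_unit_nat Z1 (Sig X1) iZ (infty_b_shift iX) w1) compA.
Qed.

End Minus.

(** * Acyclic complexes and the bounded below quotient *)

Section Plus.

Definition kiota (X : KI) : @Hom KI (Ip (Lp X)) X := [k from_trunc ge0_up (sval X)].

Lemma kiota_pre_bij (A X : KI) : acyc A -> pre_bij A (kiota X).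
Proof.
have [|Z [v [w [[bZ _] d]]]] := @iso_right_dist F (Ip (Lp X)) X 0 (from_trunc ge0_up (sval X)).
  by move=> i; exact: (@from_trunc_iso P ge0 ge0_up (sval X) i).
exact: pre_bij_bounded_above d bZ.
Qed.

Lemma Tp_kiota_iso (X : KI) : is_iso (fmap (Tp F) (kiota X)).
Proof.
apply: (@Tp_far_iso F (Ip (Lp X)) X 0 (from_trunc ge0_up (sval X))) => i.
exact: (@from_trunc_iso P ge0 ge0_up (sval X) i).
Qed.

Lemma acyclic_coresolution (X : KI) : exists (A : KI) (g : Hom X A),
  [/\ acyc A, is_iso (fmap (Tp F) g), forall A', acyc A' -> pre_bij A' g &
      forall A', acyc A' -> pre_bij A' (fmap Sig g)].
Proof.
have [A [m [g [aA gi]]]] := coresolution X; exists A, [k g].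
have [Z [v [w [[bZ _] d]]]] := iso_right_dist gi; split=> //.
- exact: Tp_far_iso gi.
- by move=> A' aA'; apply: pre_bij_bounded_above d bZ aA'.
- move=> A' aA'; refine (pre_bij_bounded_above (dist_susp d) _ aA').
  exact: bounded_above_shift.
Qed.

Lemma TpW_ff : fully_faithful TpW.
Proof.
apply: fully_faithfulP => B A f; have aA := acyc_J A.
  move=> Tf0; apply: (kiota_pre_bij (J B) aA).1; apply: (proj1 (to_acyclic _ aA)).
  rewrite fmapM [LHS](iota_p_nat (fmap QD (fmap J f))) Lp_quot.
  by rewrite (_ : fmap (Tp F) _ = 0) // fmap0 compm0.
have [g gE] := proj2 (to_acyclic (Ip (Lp (J B))) aA) (iota_p (J A) ∘ fmap Ip f).
have [h hE] := (kiota_pre_bij (J B) aA).2 g; exists (h : @Hom W B A).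
apply/eqP; rewrite -subr_eq0; apply/eqP; set y := _ - _.
have y0 : iota_p (J A) ∘ fmap Ip y = 0.
  have e : iota_p (J A) ∘ fmap Ip (fmap TpW (h : @Hom W B A)) = iota_p (J A) ∘ fmap Ip f.
    rewrite -gE -hE fmapM [RHS](iota_p_nat (fmap QD h)) Lp_quot.
    by [].
  by rewrite /y fmapD fmapN compDr compmN e subrr.
have Ly0 : fmap Lp (fmap Ip y) = 0.
  have := Tp_kiota_iso (J A); rewrite -Lp_quot => i.
  apply: (iso_cancel_l i); rewrite compm0.
  apply: etrans (esym (fmapM Lp (iota_p (J A)) (fmap Ip y))) _.
  by rewrite y0 fmap0.
apply: (ff_inj (@plus_ff F)); rewrite fmap0.
have i : is_iso (iota_p (Ip (TpW B))) by apply: iota_p_iso; apply: (trunc_ge_bounded_below 0).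
by apply: (iso_cancel_r i); rewrite iota_p_nat Ly0 fmap0 comp0m compm0.
Qed.

Lemma TpW_es (Y : Vp) : ess_image TpW Y.
Proof.
have [A [g [aA gi _ _]]] := acyclic_coresolution (Ip Y).
have [A' e] := acyc_ob aA; exists A'.
apply: (isomorphic_trans (Y := Tp F (Ip Y))); last first.
  by exists (counit_p Y); apply: counit_p_iso.
have -> : TpW A' = Tp F A by rewrite -e.
by apply: isomorphic_sym; exists (fmap (Tp F) g).
Qed.

(** Now [b ∘ u] extends along the coresolution [a], since maps into the acyclic [J B] do not
    distinguish [X] from [J A]; the comparison runs from the given triangle to the acyclic one. *)
Lemma TpW_coresolve (X Y Z : KI) (u : Hom X Y) (v : Hom Y Z) (w : Hom Z (Sig X)) :
  dist u v w -> exists (A B C : W) (h : Hom A B) (i : Hom B C) (j : Hom C (Sig A)), dist h i j /\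
    tri_iso (fmap (Tp F) u) (fmap (Tp F) v) (trif_shift (Tp F) X ∘ fmap (Tp F) w)
      (fmap TpW h) (fmap TpW i) (trif_shift TpW A ∘ fmap TpW j).
Proof.
move=> d; have [A0 [a [aA ia pa sa]]] := acyclic_coresolution X.
have [A e] := acyc_ob aA; subst A0.
have [B0 [b [aB ib pb sb]]] := acyclic_coresolution Y.
have [B e] := acyc_ob aB; subst B0.
have [h] := (pa _ aB).2 (b ∘ u); elim/kclsW: h => h /esym e.
pose C : W := exist _ (cone h) (acyclic_cone h aA aB).
have d' : @dist KI (J A) (J B) (J C) [k h] [k cone_inr h] [k cone_prl h] by apply: kdist_cone.
have [c [e1 e2]] := tri_map KE d d' (a := a) (b := b) e.
have ic : is_iso (fmap (Tp F) (c : @Hom KI Z (J C))).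
  apply: Tp_iso => A' aA'.
  exact: (pre_bij_cone KE d d' e e1 e2 (A := sval A') (pa _ aA') (pb _ aA') (sa _ aA') (sb _ aA')).
exists A, B, C, [k h], [k cone_inr h], [k cone_prl h]; split; first exact: kdist_cone.
exists (fmap (Tp F) a), (fmap (Tp F) b), (fmap (Tp F) (c : @Hom KI Z (J C))).
split=> //; split.
- apply: etrans (esym (fmapM (Tp F) b u)) _.
  refine (etrans _ (fmapM (Tp F) ([k h] : @Hom KI (J A) (J B)) a)).
  by congr (fmap (Tp F) _).
- apply: etrans (esym (fmapM (Tp F) (c : @Hom KI Z (J C)) v)) _.
  refine (etrans _ (fmapM (Tp F) ([k cone_inr h] : @Hom KI (J B) (J C)) b)).
  by congr (fmap (Tp F) _).
- rewrite comp_J_shift compA -trif_shift_nat.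
  rewrite -[LHS]compA -[RHS]compA; congr (_ ∘ _).
  pose j : @Hom KI (J C) (Sig (J A)) := [k cone_prl h].
  refine (etrans (esym (fmapM (Tp F) (fmap Sig (a : @Hom KI X (J A))) w)) _).
  refine (etrans _ (fmapM (Tp F) j (c : @Hom KI Z (J C)))).
  congr (fmap (Tp F) _); exact: e2.
Qed.

Definition trunc_counit (X : Kp) (i : infty_b (sval X)) : @Hom Vp (Tp F (exist _ (sval X) i)) X :=
  fmap Qp (@kmor F _ (@plus_b_shift F) (Tp F (exist _ (sval X) i)) X (from_trunc ge0_up (sval X))).

Lemma trunc_counit_iso (X : Kp) i : is_iso (@trunc_counit X i).
Proof.
refine (vquot_iso _); apply: (@plus_far_iso _ _ _ _ 0) => j j0 _.
exact: from_trunc_iso.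
Qed.

Lemma trunc_counit_nat (X Y : Kp) i j (u : Hom X Y) :
  @trunc_counit Y j ∘ fmap (Tp F) (u : @Hom KI (exist _ (sval X) i) (exist _ (sval Y) j)) =
  fmap Qp u ∘ @trunc_counit X i.
Proof.
elim/kclsW: u => u; rewrite (@Tp_kcls F (exist _ _ i) (exist _ _ j) u).
pose TX := Tp F (exist _ (sval X) i) : Kp; pose TY := Tp F (exist _ (sval Y) j) : Kp.
apply: etrans (@quot_kmor_comp F _ _ TX TY Y _ _) _.
apply: etrans (esym (@quot_kmor_comp F _ _ TX X Y u _)).
by rewrite from_trunc_nat.
Qed.

Lemma trunc_counit_shift (X : Kp) (i : infty_b (sval X)) :
  fmap Sig (@trunc_counit X i) ∘ trif_shift (Tp F) (exist _ (sval X) i) =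
  @trunc_counit (Sig X) (infty_b_shift i).
Proof.
pose TX : Kp := Tp F (exist _ (sval X) i).
pose TSX : Kp := Tp F (exist _ (sval (Sig X)) (infty_b_shift i)).
have -> : fmap Sig (@trunc_counit X i) =
    fmap Qp (@kmor F _ (@plus_b_shift F) (Sig TX) (Sig X) (cmap_shift (from_trunc ge0_up (sval X)))).
  apply: etrans (vSig_quot (@Kb_Sig F _ (@plus_b_shift F)) _) _.
  by congr (fmap Qp _); apply: kSig_kcls.
apply: etrans (@quot_kmor_comp F _ (@plus_b_shift F) TSX (Sig TX : Kp) (Sig X : Kp) _ _) _.
by rewrite from_trunc_trunc_shift.
Qed.

Lemma TpW_dist (X Y Z : Vp) (u : Hom X Y) (v : Hom Y Z) (w : Hom Z (Sig X)) :
  dist u v w -> exists (A B C : W) (h : Hom A B) (i : Hom B C) (j : Hom C (Sig A)), dist h i j /\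
    tri_iso u v w (fmap TpW h) (fmap TpW i) (trif_shift TpW A ∘ fmap TpW j).
Proof.
move=> [X1 [Y1 [Z1 [u1 [v1 [w1 [d t]]]]]]].
have iX := plus_infty_b (svalP X1); have iY := plus_infty_b (svalP Y1).
have iZ := plus_infty_b (svalP Z1).
pose X2 : KI := exist _ (sval X1) iX; pose Y2 : KI := exist _ (sval Y1) iY.
pose Z2 : KI := exist _ (sval Z1) iZ.
have [A [B [C [h [i [j [d' t']]]]]]] := @TpW_coresolve X2 Y2 Z2 u1 v1 w1 d.
exists A, B, C, h, i, j; split=> //; apply: tri_iso_trans t (tri_iso_trans _ t').
apply: tri_iso_sym; exists (trunc_counit iX), (trunc_counit iY), (trunc_counit iZ); split.
  by split; apply: trunc_counit_iso.
split; try exact: trunc_counit_nat.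
rewrite compA trunc_counit_shift.
by rewrite (@trunc_counit_nat Z1 (Sig X1) iZ (infty_b_shift iX) w1).
Qed.

End Plus.

End Equivalences.

Theorem theorem6p6 (F : frobeniusCategory) :
  (fully_faithful (plus_functor F) /\
   fully_faithful (minus_functor F) /\
   fully_faithful (acyclic_functor F)) /\
  @triangle_of_recollements (K_infty_b_mod_Kb F)
    (ess_image (plus_functor F))
    (ess_image (minus_functor F))
    (ess_image (acyclic_functor F)) /\
  triangle_equivalent (K_plus_b_mod_Kb F) (K_minus_b_mod_Kb F) /\
  triangle_equivalent (K_minus_b_mod_Kb F) (K_infty_empty F).
Proof.
split; first by split; [exact: plus_ff | split; [exact: minus_ff | exact: acyclic_ff]].
split; first exact: recollement_triangle.
have Wc := @W_iso_closed F.
split; last exact: (triangle_equivalent_inverse (@TmW_ff F) (@TmW_es F) Wc (@TmW_dist F)).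
(* The two quotients are compared through acyclic complexes: invert truncation to degrees at least
   0, then truncate to degrees at most 0. *)
apply: (triangle_equivalent_trans (T' := K_infty_empty F)).
  exact: (triangle_equivalent_inverse (@TpW_ff F) (@TpW_es F) Wc (@TpW_dist F)).
exact: (triangle_equivalent_direct (@TmW_ff F) (@TmW_es F)).
Qed.
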